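(* (Discrete Poincaré inequality.) Let $\Omega\subset\mathbb{R}^d$, $d\in\{2,3\}$, be a bounded polyhedral domain and assume that $\Omega$ is convex. Let $\{\mathbb{T}_h\}$ be a family of conformal meshes of $\overline\Omega$ with the semi-regular property and let $h\le1$. Then there exists a positive constant $C_{dc}^P$, independent of $h$ but dependent on the maximum angle, such that $$\|\psi_h\|_{L^2(\Omega)}\le C_{dc}^P\,|\psi_h|_{h*}\qquad\forall\psi_h\in P_{dc,h}^1 .$$
   Context: Mesh: $\mathbb{T}_h$ is a conformal simplicial mesh of $\overline\Omega$ (closed $d$-simplices, no hanging nodes), $h_T=\operatorname{diam}T$, $h=\max_Th_T$. $\mathcal{F}_h^i$, $\mathcal{F}_h^\partial$ are the sets of interior and boundary faces, $\mathcal{F}_h$ their union. For $F=T_1\cap T_2\in\mathcal{F}_h^i$, $[\![\varphi]\!]=\varphi|_{T_1}-\varphi|_{T_2}$ on $F$; for $F\in\mathcal{F}_h^\partial$, $[\![\varphi]\!]=\varphi$. $\Pi_F^0$ is the $L^2(F)$-projection onto constants on $F$. $\ell_{T,F}=d!\,|T|_d/|F|_{d-1}$ for a face $F$ of $T$ ($|\cdot|_k$ the $k$-dimensional Hausdorff measure). $P_{dc,h}^1$ is the space of functions in $L^2(\Omega)$ whose restriction to each $T\in\mathbb{T}_h$ is a polynomial of degree at most $1$. Norm: $|v|_{h*}=\big(\sum_{T\in\mathbb{T}_h}|v|_{H^1(T)}^2+\sum_{F\in\mathcal{F}_h}\kappa_{F*}\|\Pi_F^0[\![v]\!]\|_{L^2(F)}^2\big)^{1/2}$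 with $\kappa_{F*}=(\sqrt{\ell_{T_1,F}}+\sqrt{\ell_{T_2,F}})^{-2}$ for $F=T_1\cap T_2\in\mathcal{F}_h^i$ and $\kappa_{F*}=\ell_{T_\partial,F}^{-1}$ for $F=\partial T_\partial\cap\partial\Omega\in\mathcal{F}_h^\partial$. Lengths $h_i$ (for each $T$). If $d=2$: label the vertices so that $\overline{p_2p_3}$ is the longest edge, $h_1=|p_1-p_2|$, $h_2=|p_1-p_3|$, $h_2\le h_1$. If $d=3$: $L_{\min}$ is the shortest edge and $h_2=|L_{\min}|$, its endpoints being $\{p_1,p_3\}$ or $\{p_2,p_3\}$; among the four edges sharing an endpoint with $L_{\min}$ the longest has endpoints $p_1,p_2$, and $h_1=|p_1-p_2|$. Consider the plane through the midpoint of $\overline{p_1p_2}$ perpendicular to $p_1-p_2$: either (Type i) $p_3,p_4$ are in the same half-space and $L_{\min}$ has endpoints $p_1,p_3$, or (Type ii) $p_3,p_4$ are in different half-spaces and $L_{\min}$ has endpoints $p_2,p_3$; in both, $h_3=|p_1-p_4|$, and $p_1,p_4$ are assumed to lie in the same half-space. Semi-regular property: with $H_T=\frac{\prod_{i=1}^dh_i}{|T|_d}h_T$, there is $\gamma_0>0$ with $H_T/h_T\le\gamma_0$ for all $\mathbb{T}_h$ in the family and all $T\in\mathbb{T}_h$. (This is equivalent to the maximum-angle condition; dependence on the maximum angle means dependence on $\gamma_0$.) *)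

(* Defs.v *)
From HB Require Import structures.
From mathcomp Require Import all_boot all_order all_algebra finmap.
From mathcomp Require Import all_classical all_reals all_analysis.

Set Implicit Arguments.
Unset Strict Implicit.
Unset Printing Implicit Defensive.

Import Order.TTheory GRing.Theory Num.Theory.
Import numFieldNormedType.Exports.

Local Open Scope classical_set_scope.
Local Open Scope ring_scope.

(* R^d carries its Borel sigma-algebra. *)
HB.instance Definition _ (R : realType) (m n : nat) :=
  Measurable.copy 'M[R]_(m, n) (g_sigma_algebraType (@open 'M[R]_(m, n))).

Section euclidean_space.
Variables (R : realType) (d : nat).
Implicit Types (x y : 'rV[R]_d) (A : set 'rV[R]_d).

Definition dotv x y : R := \sum_(i < d) x 0 i * y 0 i.

(* The library norm of ['rV[R]_d] is the sup norm; lengths here are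
   Euclidean. *)
Definition dist x y : R := Num.sqrt (dotv (x - y) (x - y)).

Definition ediam A : \bar R :=
  maxe 0%E (ereal_sup [set z | exists x y, [/\ A x, A y & z = (dist x y)%:E]]).

Definition diam A : R := fine (ediam A).

End euclidean_space.

(* Lebesgue measure of R^d as a set function on Borel sets, by integrating the
   measures of the slices over the first coordinate. *)
Fixpoint lebesgue_rV (R : realType) (d : nat) : set 'rV[R]_d -> \bar R :=
  match d with
  | 0%N => fun A => \d_(0 : 'rV[R]_0) A
  | d'.+1 => fun A =>
      (\int[@lebesgue_measure R]_t
         lebesgue_rV [set y : 'rV[R]_d' |
           A (row_mx (t%:M : 'rV[R]_1) y : 'rV[R]_d'.+1)])%E
  end.

(* Volume of the Euclidean unit ball of R^k. *)
Fixpoint unit_ball_volume (R : realType) (k : nat) : R :=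
  match k with
  | 0%N => 1
  | 1%N => 2
  | k'.+2 => 2 * pi / k'.+2%:R * unit_ball_volume R k'
  end.

Section hausdorff.
Variables (R : realType) (d : nat).
Local Open Scope ereal_scope.

(* k-dimensional Hausdorff measure, for k > 0 (empty sets of a cover then
   contribute 0), normalized so as to agree with Lebesgue measure on R^k. *)
Definition hausdorff_content (k : nat) (delta : R) (A : set 'rV[R]_d) : \bar R :=
  ereal_inf [set \sum_(i <oo)
                   (unit_ball_volume R k / 2 ^+ k)%:E * ediam (U i) ^+ k
            | U in [set U : (set 'rV[R]_d)^nat |
                     (forall i, ediam (U i) <= delta%:E) /\
                     A `<=` \bigcup_i U i]].

Definition hausdorff (k : nat) (A : set 'rV[R]_d) : \bar R :=
  ereal_sup [set hausdorff_content k delta A | delta in [set e : R | (0 < e)%R]].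

End hausdorff.

Section integrals.
Variables (R : realType) (d : nat) (mu : set 'rV[R]_d -> \bar R).
Implicit Types (D : set 'rV[R]_d) (f : 'rV[R]_d -> R).

(* [Rintegral] of the library, for a set function [mu] that is not packaged as
   a measure. *)
Definition rint D f : R := fine (\int[mu]_(x in D) (f x)%:E)%E.

Definition in_L2 D f : Prop :=
  measurable_fun D f /\ (\int[mu]_(x in D) ((f x) ^+ 2)%:E < +oo)%E.

Definition L2norm D f : R := Num.sqrt (rint D (fun x => f x ^+ 2)).

(* L^2(mu, D)-orthogonal projection onto the constants. *)
Definition proj0 D f : R :=
  xget 0 [set c | forall q : R, rint D (fun x => (f x - c) * q) = 0].

End integrals.

Section meshes.
Variables (R : realType) (d : nat).
Local Notation pt := 'rV[R]_d.

(* A simplex of any dimension is given by its finite set of vertices. *)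
Definition vset := {fset pt}.
Definition mesh := {fset vset}.

Implicit Types (T F : vset) (Th : mesh) (Omega : set pt).

Definition hull T : set pt :=
  [set x | exists w : pt -> R,
     [/\ forall p, p \in T -> 0 <= w p,
         \sum_(p <- T) w p = 1 &
         x = \sum_(p <- T) w p *: p]].

Definition affinely_independent T : Prop :=
  forall w : pt -> R,
    \sum_(p <- T) w p = 0 -> \sum_(p <- T) w p *: p = 0 ->
    forall p, p \in T -> w p = 0.

Definition d_simplex T : Prop := #|` T| = d.+1 /\ affinely_independent T.

Definition polyhedral Omega : Prop :=
  exists K : {fset vset},
    (forall T, T \in K -> d_simplex T) /\
    closure Omega = [set x | exists2 T, T \in K & hull T x].

Definition bounded_polyhedral_domain Omega : Prop :=
  [/\ open Omega, Omega !=set0, connected Omega, bounded_set Omega &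
      polyhedral Omega].

Definition conformal_mesh Omega Th : Prop :=
  [/\ forall T, T \in Th -> d_simplex T,
      closure Omega = [set x | exists2 T, T \in Th & hull T x] &
      forall T1 T2, T1 \in Th -> T2 \in Th ->
        hull T1 `&` hull T2 = hull (T1 `&` T2)%fset].

Definition mesh_size Th : R := \big[Num.max/0]_(T <- Th) diam (hull T).

Definition volume T : R := fine (hausdorff d (hull T)).
Definition face_area F : R := fine (hausdorff d.-1 (hull F)).

(* Lengths h_1, h_2 (d = 2) for some admissible labelling of the vertices. *)
Definition lengths2 T (h1 h2 : R) : Prop :=
  exists p1 p2 p3 : pt,
    [/\ T = [fset p1; p2; p3]%fset,
        forall x y, x \in T -> y \in T -> dist x y <= dist p2 p3,
        h1 = dist p1 p2, h2 = dist p1 p3 & h2 <= h1].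

(* Positive on the side of [p] of the perpendicular bisector plane of [p],
   [q]. *)
Definition side (p q x : pt) : R := dotv (x - 2^-1 *: (p + q)) (p - q).

(* Half-spaces are closed, so a point of the plane lies in both. *)
Definition same_half (p q x y : pt) : Prop :=
  (0 <= side p q x /\ 0 <= side p q y) \/ (side p q x <= 0 /\ side p q y <= 0).
Definition diff_half (p q x y : pt) : Prop :=
  (0 <= side p q x /\ side p q y <= 0) \/ (side p q x <= 0 /\ 0 <= side p q y).

(* Lengths h_1, h_2, h_3 (d = 3) for some admissible labelling; [a] and [p3]
   are the endpoints of the shortest edge. *)
Definition lengths3 T (h1 h2 h3 : R) : Prop :=
  exists p1 p2 p3 p4 a : pt,
    [/\ T = [fset p1; p2; p3; p4]%fset,
        (a = p1 /\ same_half p1 p2 p3 p4) \/ (a = p2 /\ diff_half p1 p2 p3 p4),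
        same_half p1 p2 p1 p4,
        (forall x y, x \in T -> y \in T -> x != y -> dist a p3 <= dist x y) /\
        (forall x y, x \in [fset a; p3]%fset -> y \in (T `\` [fset a; p3])%fset ->
           dist x y <= dist p1 p2) &
        [/\ h1 = dist p1 p2, h2 = dist a p3 & h3 = dist p1 p4]].

Definition lengths T (hs : seq R) : Prop :=
  match d with
  | 2%N => exists h1 h2, hs = [:: h1; h2] /\ lengths2 T h1 h2
  | 3%N => exists h1 h2 h3, hs = [:: h1; h2; h3] /\ lengths3 T h1 h2 h3
  | _ => False
  end.

Definition H_ T (hs : seq R) : R :=
  (\prod_(h <- hs) h) / volume T * diam (hull T).

(* Ties may allow several labellings of T; one of them is used for each T. *)
Definition semi_regular (gamma0 : R) (fam : set mesh) : Prop :=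
  forall Th, fam Th -> forall T, T \in Th ->
    exists2 hs, lengths T hs & H_ T hs / diam (hull T) <= gamma0.

Definition faces Th : {fset vset} :=
  (\bigcup_(T <- Th) [fset F in fpowerset T | #|` F| == d])%fset.

(* The elements of the mesh having [F] as a face. *)
Definition elts Th F : seq vset := [seq T <- Th | (F `<=` T)%fset].
Definition elt1 Th F : vset := nth fset0 (elts Th F) 0.
Definition elt2 Th F : vset := nth fset0 (elts Th F) 1.

Definition interior_faces Th : {fset vset} :=
  [fset F in faces Th | (1 < size (elts Th F))%N]%fset.

Definition on_boundary Omega F : Prop := hull F `<=` closure Omega `\` Omega.

Definition boundary_faces Omega Th : {fset vset} :=
  [fset F in faces Th | `[< on_boundary Omega F >]]%fset.

Definition ell T F : R := d`!%:R * volume T / face_area F.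

Definition kappa_int Th F : R :=
  (Num.sqrt (ell (elt1 Th F) F) + Num.sqrt (ell (elt2 Th F) F)) ^- 2.
Definition kappa_bd Th F : R := (ell (elt1 Th F) F)^-1.

(* A piecewise function is a family [v] of functions indexed by the elements:
   [v T] is the restriction to T, extended to R^d. *)
Implicit Types v : vset -> pt -> R.

Definition jump_int Th v F : pt -> R :=
  fun x => v (elt1 Th F) x - v (elt2 Th F) x.
Definition jump_bd Th v F : pt -> R := v (elt1 Th F).

Definition H1_seminorm T (f : pt -> R) : R :=
  Num.sqrt (rint (@lebesgue_rV R d) (hull T)
              (fun x => \sum_(i < d) ('D_(delta_mx 0 i) f x) ^+ 2)).

Definition face_norm F (f : pt -> R) : R := L2norm (hausdorff d.-1) (hull F) f.

Definition face_proj F (f : pt -> R) : pt -> R :=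
  fun=> proj0 (hausdorff d.-1) (hull F) f.

Definition hstar_norm Omega Th v : R :=
  Num.sqrt
    (\sum_(T <- Th) H1_seminorm T (v T) ^+ 2 +
     (\sum_(F <- interior_faces Th)
        kappa_int Th F * face_norm F (face_proj F (jump_int Th v F)) ^+ 2 +
      \sum_(F <- boundary_faces Omega Th)
        kappa_bd Th F * face_norm F (face_proj F (jump_bd Th v F)) ^+ 2)).

Definition poly_deg1 (f : pt -> R) : Prop :=
  exists (a : pt) (c : R), forall x, f x = dotv a x + c.

Definition is_restriction (psi : pt -> R) T (f : pt -> R) : Prop :=
  poly_deg1 f /\
  (@lebesgue_rV R d).-negligible [set x | hull T x /\ psi x <> f x].

Definition P1dc Omega Th (psi : pt -> R) : Prop :=
  in_L2 (@lebesgue_rV R d) Omega psi /\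
  forall T, T \in Th -> exists f, is_restriction psi T f.

(* The polynomials representing [psi] in [P1dc] on the elements. *)
Definition restriction (psi : pt -> R) T : pt -> R :=
  xget (fun=> 0) [set f | is_restriction psi T f].

End meshes.

(* Main.v *)
(** Let [X] be the first coordinate, [m] the Lebesgue measure of an element [T]
    with barycenter [b], and [nu] the first component of the (suitably scaled)
    outward normal of a face with barycenter [b_F].  On [T], the sum over the
    faces of [nu * X (b_F) * f (b_F) ^ 2], a quadrature of the flux of
    [f ^ 2 * X e_1], equals [m * f b ^ 2] up to terms controlled by [|grad f|]:
    the errors are values of the linear map sending vertex values to the first
    component of the gradient of their affine interpolant, and by semi-regularity
    this map is bounded by the Lipschitz constant of the vertex values, uniformly
    in the shape of [T].  Summed over the mesh, the face terms combine into
    [nu * X (b_F) * (f1 ^ 2 - f2 ^ 2)], in which only the jump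
    [f1 (b_F) - f2 (b_F)], i.e. the projection of the jump onto constants, occurs,
    and Young's inequality with the larger of the two elements absorbs the rest. *)

From HB Require Import structures.
Require Import Defs.
From mathcomp Require Import all_boot all_order all_algebra finmap.
From mathcomp Require Import all_classical all_reals all_analysis.
From mathcomp Require Import perm measurable_realfun ring lra.
Set Implicit Arguments.
Unset Strict Implicit.
Unset Printing Implicit Defensive.
Import Order.TTheory GRing.Theory Num.Theory.
Import numFieldNormedType.Exports.
Local Open Scope classical_set_scope.
Local Open Scope ring_scope.

(** * Lebesgue measure on R^d *)

(** The elements may be arbitrarily flat, so inverse inequalities have no constant independent of
    the shape. The field X e_1 has divergence 1, which turns a flux into a mass, and only one
    component of each gradient has to be controlled. Faces are sampled at barycenters because the
    norm sees a jump only through its mean, and for an affine function the mean over a face is the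
    value there. The penalty fits: kappa times the area is, up to constants, the squared area over
    the larger adjacent volume, which is the weight that Young's inequality produces when a fraction
    of the mass of that element is absorbed. Hausdorff and Lebesgue measure are related only up to
    unspecified constants; the exact facts needed about surface measure are invariance under
    translations and under the affine exchange of two vertices of a face, while the opposite normals
    of neighbours come from ratios of volumes. *)

Section borel.
Context {R : realType} {d : nat}.
Implicit Types (x y : 'rV[R]_d) (A : set 'rV[R]_d).

Lemma open_measurable_rV A : open A -> measurable A.
Proof. by move=> oA; apply: sub_sigma_algebra. Qed.

Lemma closed_measurable_rV A : closed A -> measurable A.
Proof.
move=> /closed_openC oA; rewrite -(setCK A); apply: measurableC.
exact: open_measurable_rV.
Qed.

Lemma ball_rVP x (e : R) y : 0 < e ->
  ball x e y <-> forall i, `|x 0 i - y 0 i| < e.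
Proof.
move=> e0; split=> [[_ H] i|H]; first exact: H 0 i.
by split=> // i j; rewrite (ord1 i); exact: H.
Qed.

(* An open set is a countable union of cubes with rational center and size. *)
Lemma measurable_fun_rV d' (T : measurableType d') (f : T -> 'rV[R]_d) :
  (forall i, measurable_fun setT (fun t => f t 0 i)) -> measurable_fun setT f.
Proof.
move=> mf; apply: (measurability (@open 'rV[R]_d)) => // _ [U oU <-].
rewrite setTI.
pose q (z : 'rV[rat]_d) : 'rV[R]_d := map_mx ratr z.
pose B (zn : 'rV[rat]_d * nat) := ball (q zn.1) (zn.2.+1%:R^-1 : R).
have e0 n : 0 < (n.+1%:R^-1 : R) by rewrite invr_gt0 ltr0n.
have -> : U = \bigcup_(zn in [set zn | B zn `<=` U]) B zn.
  apply/seteqP; split=> [x Ux|x [zn BU Bx]]; last exact: BU.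
  have /nbhs_ballP[e /= e_gt0 beU] : nbhs x U by exact: open_nbhs_nbhs.
  have [n ne] : exists n : nat, (n.+1%:R^-1 : R) < e / 2.
    have [n _ /(_ n (leqnn _)) /= Hn] :=
      near_infty_natSinv_lt (PosNum (divr_gt0 e_gt0 (ltr0n R 2))).
    by exists n.
  have /choice[z Hz] : forall i, exists z : rat,
      `|x 0 i - ratr z| < (n.+1%:R^-1 : R).
    move=> i; have [|z] := @rat_in_itvoo R (x 0 i - n.+1%:R^-1) (x 0 i + n.+1%:R^-1).
      by rewrite ltrD2l gtrN.
    rewrite in_itv /= => /andP[z1 z2]; exists z.
    by rewrite ltr_distlC z1 z2.
  have xz : ball (q (\row_i z i)) (n.+1%:R^-1 : R) x.
    by apply/ball_rVP => // i; rewrite !mxE distrC.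
  exists (\row_i z i, n) => //= y By; apply: beU.
  apply/ball_rVP => // i.
  move/ball_rVP : xz => /(_ (e0 n) i); move/ball_rVP : By => /(_ (e0 n) i).
  rewrite !mxE => h1 h2.
  rewrite (le_lt_trans (ler_distD (ratr (z i)) _ _)) // distrC.
  by rewrite (lt_trans (ltrD h2 h1)) //= [ltRHS]splitr ltrD.
rewrite preimage_bigcup bigcup_mkcond.
apply: countable_bigcupT_measurable => [|[z n]]; first exact: countableP.
case: ifP => // _.
have -> : f @^-1` B (z, n) =
   \bigcap_(i in [set: 'I_d]) [set t | `|q z 0 i - f t 0 i| < n.+1%:R^-1].
  apply/seteqP; split=> [t /ball_rVP H i _|t H]; first exact: H.
  by apply/ball_rVP => // i; exact: H.
apply: fin_bigcap_measurable => [|i _].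
  exact: finite_finset.
have mg : measurable_fun setT (fun t => `|q z 0 i - f t 0 i|).
  by apply: measurableT_comp => //; apply: measurable_funB.
have := mg measurableT `]-oo, (n.+1%:R^-1 : R)[%classic (measurable_itv _).
rewrite setTI; congr measurable; apply/seteqP; split=> t /=;
  by rewrite in_itv.
Qed.

End borel.

Section lebesgue.
Context {R : realType}.
Local Open Scope ereal_scope.

Lemma measurable_coord d (i : 'I_d) :
  measurable_fun setT (fun x : 'rV[R]_d => x 0%R i).
Proof.
move=> _ B mB; rewrite setTI.
have cf : continuous (fun x : 'rV[R]_d => x 0%R i) by exact: coord_continuous.
suff : measurable_fun setT (fun x : 'rV[R]_d => x 0%R i).
  by move=> /(_ measurableT _ mB); rewrite setTI.
apply: (measurability _ (RGenOpens.measurableE R)) => //.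
move=> _ [_ [a [b ->]] <-]; rewrite setTI; apply: open_measurable_rV.
by move/continuousP : cf; apply; exact: interval_open.
Qed.

Definition cons_rV d (tx : measurableTypeR R * 'rV[R]_d) : 'rV[R]_d.+1 :=
  row_mx (tx.1%:M : 'rV[R]_1) tx.2.

Lemma cons_rV0 d t (y : 'rV[R]_d) : cons_rV (t, y) 0%R ord0 = t.
Proof.
rewrite (_ : ord0 = lshift d (ord0 : 'I_1)); last exact/val_inj.
by rewrite /cons_rV (@row_mxEl _ 1 1 d) mxE mulr1n.
Qed.

Lemma cons_rVS d t (y : 'rV[R]_d) i : cons_rV (t, y) 0%R (lift ord0 i) = y 0%R i.
Proof.
rewrite (_ : lift ord0 i = rshift 1 i); last exact/val_inj.
by rewrite /cons_rV (@row_mxEr _ 1 1 d).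
Qed.

Lemma measurable_cons_rV d : measurable_fun setT (@cons_rV d).
Proof.
apply: measurable_fun_rV => i; case: (unliftP ord0 i) => [j|] ->.
  rewrite (_ : (fun _ => _) = (fun x : 'rV[R]_d => x 0%R j) \o snd).
    by apply: (measurableT_comp (measurable_coord j)); exact: measurable_snd.
  by apply/funext => -[t y]; rewrite cons_rVS.
rewrite (_ : (fun _ => _) = fst); first exact: measurable_fst.
by apply/funext => -[t y]; rewrite cons_rV0.
Qed.

(** The recursive definition integrates bare set functions; recognizing it as the image of a product
    measure yields countable additivity and sigma-finiteness by induction on the dimension. *)
Lemma lebesgue_rVS d :
  @lebesgue_rV R d.+1 =
  pushforward (@lebesgue_measure R \x @lebesgue_rV R d) (@cons_rV d).
Proof.
apply/funext => A; rewrite /pushforward /product_measure1 /=.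
apply: eq_integral => t _ /=; congr (lebesgue_rV _).
by apply/seteqP; split => y /=; rewrite /xsection /= inE.
Qed.

Lemma pushforward_sigma_finite d1 d2 (T1 : measurableType d1) (T2 : measurableType d2)
    (mu : set T1 -> \bar R) (f : T1 -> T2) (g : T2 -> T1) :
  cancel f g -> cancel g f -> measurable_fun setT g -> sigma_finite setT mu ->
  sigma_finite setT (pushforward mu f).
Proof.
move=> fK gK mg [F FT Foo].
exists (fun n => g @^-1` F n) => [|n].
  by rewrite -preimage_bigcup -FT preimage_setT.
have [mF Foo1] := Foo n; split.
  by rewrite -[_ @^-1` _]setTI; exact: mg.
rewrite /pushforward (_ : _ @^-1` _ = F n) //.
by apply/seteqP; split => x /=; rewrite fK.
Qed.

Lemma product_sigma_finite d1 d2 (T1 : measurableType d1) (T2 : measurableType d2)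
    (m1 : {sigma_finite_measure set T1 -> \bar R})
    (m2 : {sigma_finite_measure set T2 -> \bar R}) :
  sigma_finite setT (m1 \x m2).
Proof.
have /sigma_finiteP[F [TF ndF Foo]] := sigma_finiteT m1.
have /sigma_finiteP[G [TG ndG Goo]] := sigma_finiteT m2.
exists (fun n => F n `*` G n) => [|n].
  apply/seteqP; split => // -[x y] _.
  have [[i _ Fx] [j _ Gy]] : (\bigcup_n F n) x /\ (\bigcup_n G n) y by rewrite -TF -TG.
  exists (maxn i j) => //; split => /=.
    by move: x Fx; exact/subsetPset/ndF/leq_maxl.
  by move: y Gy; exact/subsetPset/ndG/leq_maxr.
have [[mF Fn] [mG Gn]] := (Foo n, Goo n); split; first exact: measurableX.
by rewrite product_measure1E// lte_mul_pinfty// ge0_fin_numE.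
Qed.

Definition uncons_rV d (x : 'rV[R]_d.+1) : measurableTypeR R * 'rV[R]_d :=
  (lsubmx (x : 'rV[R]_(1 + d)%N) 0%R 0%R, rsubmx (x : 'rV[R]_(1 + d)%N)).

Lemma cons_rVK d : cancel (@cons_rV d) (@uncons_rV d).
Proof.
by move=> [t y]; rewrite /uncons_rV /cons_rV row_mxKl row_mxKr mxE mulr1n.
Qed.

Lemma uncons_rVK d : cancel (@uncons_rV d) (@cons_rV d).
Proof.
move=> x; rewrite /uncons_rV /cons_rV /= -mx11_scalar.
exact: (@hsubmxK _ 1 1 d x).
Qed.

Lemma measurable_uncons_rV d : measurable_fun setT (@uncons_rV d).
Proof.
apply: measurable_fun_pair.
  by under eq_fun do rewrite mxE; exact: measurable_coord.
apply: measurable_fun_rV => i; under eq_fun do rewrite mxE.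
exact: measurable_coord.
Qed.

(** Sigma-finiteness as a proposition becomes a packaged structure, which product measures and
    Fubini's theorem require; the underlying set function is unchanged. *)
Lemma sigma_finite_measureE d (T : measurableType d) (mu : {measure set T -> \bar R}) :
  sigma_finite setT mu ->
  exists nu : {sigma_finite_measure set T -> \bar R}, mu = nu :> (set T -> \bar R).
Proof.
move=> smu; pose H1 := isSFinite.Build _ _ _ _ (sfinite_measure_sigma_finite smu).
pose H2 := isSigmaFinite.Build _ _ _ _ smu.
pose nu := HB.pack_for (SigmaFiniteMeasure.type T R) (Measure.sort mu) H1 H2.
by exists nu.
Qed.

(** Existential because the product in dimension [d.+1] is a measure only once the lower dimension
    carries a packaged sigma-finite measure; the instances below are read off from it. *)
Lemma lebesgue_rV_measure d : exists mu : {sigma_finite_measure set 'rV[R]_d -> \bar R},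
  @lebesgue_rV R d = mu :> (set 'rV[R]_d -> \bar R).
Proof.
elim: d => [|d [mu IH]].
  by exists (\d_(0%R : 'rV[R]_0)).
rewrite lebesgue_rVS IH.
pose m0 : {measure set 'rV[R]_d.+1 -> \bar R} :=
  pushforward (@lebesgue_measure R \x mu) (@cons_rV d).
apply: (sigma_finite_measureE (mu := m0 (@measurable_cons_rV d))).
apply: (pushforward_sigma_finite (@cons_rVK d) (@uncons_rVK d)).
  exact: measurable_uncons_rV.
exact: product_sigma_finite.
Qed.

Let lebesgue_rV_set0 d : @lebesgue_rV R d set0 = 0.
Proof. by have [mu ->] := lebesgue_rV_measure d; exact: measure0. Qed.

Let lebesgue_rV_ge0 d A : 0 <= @lebesgue_rV R d A.
Proof. by have [mu ->] := lebesgue_rV_measure d; exact: measure_ge0. Qed.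

Let lebesgue_rV_sigma_additive d : semi_sigma_additive (@lebesgue_rV R d).
Proof.
by have [mu ->] := lebesgue_rV_measure d; exact: measure_semi_sigma_additive.
Qed.

HB.instance Definition _ d := isMeasure.Build _ _ _ (@lebesgue_rV R d)
  (@lebesgue_rV_set0 d) (@lebesgue_rV_ge0 d) (@lebesgue_rV_sigma_additive d).

Let lebesgue_rV_sigma_finite d : sigma_finite setT (@lebesgue_rV R d).
Proof. by have [mu ->] := lebesgue_rV_measure d; exact: sigma_finiteT. Qed.

HB.instance Definition _ d := Measure_isSigmaFinite.Build _ _ _
  (@lebesgue_rV R d) (@lebesgue_rV_sigma_finite d).

Definition box d (a b : 'rV[R]_d) : set 'rV[R]_d :=
  [set x | forall i, (a 0 i <= x 0 i <= b 0 i)%R].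

Lemma measurable_box d (a b : 'rV[R]_d) : measurable (box a b).
Proof.
rewrite (_ : box a b = \bigcap_(i in [set: 'I_d])
    ((fun x : 'rV[R]_d => x 0%R i) @^-1` `[a 0%R i, b 0%R i]%classic)).
  apply: fin_bigcap_measurable => [|i _]; first exact: finite_finset.
  rewrite -[_ @^-1` _]setTI; apply: measurable_coord => //.
by apply/seteqP; split=> x /= H i => [_|]; have := H i; rewrite /= in_itv //=; exact.
Qed.

Lemma lebesgue_rV_box d (a b : 'rV[R]_d) : (forall i, a 0 i <= b 0 i)%R ->
  lebesgue_rV (box a b) = (\prod_i (b 0 i - a 0 i))%:E.
Proof.
elim: d a b => [|d IH] a b ab.
  rewrite big_ord0 /= diracE mem_set //; by case.
pose a' : 'rV[R]_d := \row_i a 0%R (lift ord0 i).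
pose b' : 'rV[R]_d := \row_i b 0%R (lift ord0 i).
have ab' i : (a' 0 i <= b' 0 i)%R by rewrite !mxE.
rewrite /= big_ord_recl EFinM.
transitivity (\int[@lebesgue_measure R]_t
   ((\1_(`[a 0%R ord0, b 0%R ord0]%classic : set R) t)%:E *
     (\prod_(i < d) (b 0 (lift ord0 i) - a 0 (lift ord0 i)))%:E)).
  apply: eq_integral => t _; rewrite indicE.
  rewrite (_ : [set y | _] = if (a 0 ord0 <= t <= b 0 ord0)%R then box a' b' else set0).
    rewrite mem_setE; rewrite in_itv /=; case: ifP => _; last by rewrite measure0 mul0e.
    rewrite IH // mul1e; congr EFin.
    by apply: eq_bigr => i _; rewrite !mxE.
  apply/seteqP; split=> y.
    rewrite -[[set _ | _] y]/(box a b (cons_rV (t, y))) => H.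
    have := H ord0; rewrite cons_rV0 => -> i.
    by have := H (lift ord0 i); rewrite cons_rVS !mxE.
  case: ifP => // tab H.
  rewrite -[[set _ | _] y]/(box a b (cons_rV (t, y))) => i.
  case: (unliftP ord0 i) => [j|] ->; last by rewrite cons_rV0.
  by rewrite (cons_rVS t y j); have := H j; rewrite !mxE.
rewrite ge0_integralZr //=.
- rewrite (integral_indic (@lebesgue_measure R) measurableT) //.
  rewrite setIT; congr (_ * _); apply: (etrans (lebesgue_measure_itv _)).
  rewrite /= lte_fin.
  have [//|ba] := ltP; have -> : (a 0 ord0 = b 0 ord0)%R.
    by apply/eqP; rewrite eq_le ab.
  by rewrite subrr.
- exact/measurable_EFinP.
- by rewrite lee_fin; apply: prodr_ge0 => i _; rewrite subr_ge0.
Qed.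

Lemma lebesgue_measure_translation (c : R) (A : set R) : measurable A ->
  lebesgue_measure ((fun t => t + c)%R @^-1` A) = lebesgue_measure A.
Proof.
pose f (t : measurableTypeR R) : measurableTypeR R := (t + c)%R.
have mf : measurable_fun setT f by apply: measurable_funD.
move=> mA; pose m : {measure set (measurableTypeR R) -> \bar R} :=
  pushforward (@lebesgue_measure R) f.
rewrite -[LHS]/(m mf A); apply/esym/lebesgue_measure_unique => // _ [[x y]] _ <-.
rewrite -[RHS]/(lebesgue_measure (f @^-1` `]x, y]%classic)).
rewrite (_ : f @^-1` _ = `](x - c)%R, (y - c)%R]%classic).
  rewrite !lebesgue_measure_itv /= !lte_fin ltrD2r; case: ifP => // _.
  by rewrite -!EFinD opprD addrACA opprK addNr addr0.
by apply/seteqP; split => t /=; rewrite !in_itv /= ltrBlDr lerBrDr.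
Qed.

Lemma measurable_addv d (v : 'rV[R]_d) : measurable_fun setT (fun x : 'rV[R]_d => x + v)%R.
Proof.
apply: measurable_fun_rV => i; under eq_fun do rewrite mxE.
by apply: measurable_funD => //; exact: measurable_coord.
Qed.

(** By induction: the shift of the first coordinate is invariance on the line, applied to the slice
    measure [g]; the other coordinates are shifted inside the slices. *)
Lemma lebesgue_rV_translation d (v : 'rV[R]_d) (A : set 'rV[R]_d) : measurable A ->
  lebesgue_rV ((fun x => x + v)%R @^-1` A) = lebesgue_rV A.
Proof.
elim: d v A => [|d IH] v A mA.
  by congr lebesgue_rV; apply/seteqP; split => x /=; rewrite (thinmx0 (x + v)%R) (thinmx0 x).
pose g t := lebesgue_rV [set y | A (cons_rV (t, y))].
pose v' : 'rV[R]_d := \row_i v 0%R (lift ord0 i).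
have mA' : measurable (@cons_rV d @^-1` A).
  by rewrite -[_ @^-1` _]setTI; apply: measurable_cons_rV.
have gE : g = @lebesgue_rV R d \o xsection (@cons_rV d @^-1` A).
  apply/funext => t; rewrite /g /=; congr lebesgue_rV.
  by apply/seteqP; split => y; rewrite /xsection /= inE.
have mg : measurable_fun setT g by rewrite gE; exact: measurable_fun_xsection.
pose f (t : measurableTypeR R) : measurableTypeR R := (t + v 0%R ord0)%R.
have mf : measurable_fun setT f by apply: measurable_funD.
transitivity (\int[@lebesgue_measure R]_t (g \o f) t).
  apply: eq_integral => t _ /=; rewrite /g -(IH v').
    congr lebesgue_rV; apply/seteqP.
    have E y : (cons_rV (t, y) + v)%R = cons_rV ((t + v 0 ord0)%R, (y + v')%R).
      apply/rowP => i; case: (unliftP ord0 i) => [j|] ->.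
        by rewrite (cons_rVS _ (y + v')%R j) mxE (cons_rVS t y j) !mxE.
      by rewrite cons_rV0 mxE cons_rV0.
    by split => y; rewrite -[[set _ | _] y]/(A (cons_rV (t, y) + v)%R) E.
  have := measurable_xsection (t + v 0 ord0)%R mA'.
  by congr measurable; apply/seteqP; split => y; rewrite /xsection /= inE.
rewrite -[RHS]/(\int[@lebesgue_measure R]_t g t).
rewrite -(ge0_integral_pushforward mf (@lebesgue_measure R) measurableT) //=.
by apply: eq_measure_integral => B mB _; exact: lebesgue_measure_translation.
Qed.

End lebesgue.

(** * Lebesgue measure under linear maps *)

Section multiplicative_det.
Variable R : realFieldType.

(* Conjugation by [diag (2, 1)] squares a shear, so a multiplicative function
   takes the value 1 on shears; LU elimination reduces to diagonal matrices. *)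
Lemma multiplicative_det n (f : 'M[R]_n -> R) :
  (forall A, 0 <= f A) ->
  (forall A B, A \in unitmx -> B \in unitmx -> f (A *m B) = f A * f B) ->
  (forall r : 'rV[R]_n, (forall i, r 0 i != 0) ->
    f (diag_mx r) = \prod_i `|r 0 i|) ->
  forall A, A \in unitmx -> f A = `|\det A|.
Proof.
elim: n f => [|n IH] f f0 fM fD A Au.
  have -> : A = diag_mx 0 by apply/matrixP; case.
  by rewrite fD => [|[]//]; rewrite det_diag !big_ord0 normr1.
have f1 : f 1%:M = 1.
  rewrite -[1%:M]/((1 : R)%:M) -diag_const_mx fD; last by move=> i; rewrite mxE oner_neq0.
  by rewrite big1 // => i _; rewrite mxE normr1.
have f_neq0 B : B \in unitmx -> f B != 0.
  move=> Bu; have := fM B (invmx B) Bu; rewrite unitmx_inv Bu mulmxV // f1.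
  by move=> /(_ isT) E; apply: contra_eq_neq E => ->; rewrite mul0r oner_neq0.
have fshear (B C D : 'M[R]_n.+1) : B \in unitmx -> C \in unitmx -> D \in unitmx ->
    C = B *m B -> D *m C = B *m D -> f B = 1.
  move=> Bu Cu Du CB DC; have := fM _ _ Du Cu; rewrite DC CB !fM //.
  rewrite mulrC => /(mulfI (f_neq0 _ Du)) => E.
  by apply: (mulfI (f_neq0 _ Bu)); rewrite -E mulr1.
pose D : 'M[R]_(1 + n) := block_mx 2%:M 0 0 1%:M.
have Du : D \in unitmx.
  rewrite unitmxE (@det_lblock _ 1 n) det_scalar det1 mulr1 expr1 unitfE pnatr_eq0 //.
have fL (e : 'cV[R]_n) : f (block_mx 1%:M 0 e 1%:M : 'M[R]_(1 + n)) = 1.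
  apply: (@fshear _ (block_mx 1%:M 0 (2 *: e) 1%:M : 'M[R]_(1 + n)) D) => //.
  - by rewrite unitmxE (@det_lblock _ 1 n) !det1 mulr1 unitr1.
  - by rewrite unitmxE (@det_lblock _ 1 n) !det1 mulr1 unitr1.
  - rewrite (@mulmx_block _ 1 n 1 n 1 n) !mulmx0 !mul0mx !mul1mx !mulmx1 !addr0 !add0r.
    by rewrite scaler_nat mulr2n.
  - rewrite /D !(@mulmx_block _ 1 n 1 n 1 n) !mulmx0 !mul0mx !mul1mx !mulmx1 !addr0 !add0r.
    by rewrite mul_mx_scalar.
have fU (e : 'rV[R]_n) : f (block_mx 1%:M e 0 1%:M : 'M[R]_(1 + n)) = 1.
  apply: (@fshear _ (block_mx 1%:M (2 *: e) 0 1%:M : 'M[R]_(1 + n)) (invmx D)) => //.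
  - by rewrite unitmxE (@det_ublock _ 1 n) !det1 mulr1 unitr1.
  - by rewrite unitmxE (@det_ublock _ 1 n) !det1 mulr1 unitr1.
  - by rewrite unitmx_inv.
  - rewrite (@mulmx_block _ 1 n 1 n 1 n) !mulmx0 !mul0mx !mul1mx !mulmx1 !addr0 !add0r.
    by rewrite scaler_nat mulr2n.
  - apply: (can_inj (mulKmx Du)); rewrite mulKVmx // mulmxA; apply: (can_inj (mulmxK Du)).
    rewrite mulmxKV // /D !(@mulmx_block _ 1 n 1 n 1 n).
    rewrite !mulmx0 !mul0mx !mul1mx !mulmx1 !addr0 !add0r mul_scalar_mx //.
have r0E (x : 'rV[R]_1) (r : 'rV[R]_n) : (row_mx x r : 'rV[R]_n.+1) 0 ord0 = x 0 0.
  have -> : (ord0 : 'I_n.+1) = lshift n (ord0 : 'I_1) by exact/val_inj.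
  by rewrite (@row_mxEl _ 1 1 n).
have rSE (x : 'rV[R]_1) (r : 'rV[R]_n) i :
    (row_mx x r : 'rV[R]_n.+1) 0 (lift ord0 i) = r 0 i.
  have -> : lift ord0 i = rshift 1 i by exact/val_inj.
  by rewrite (@row_mxEr _ 1 1 n).
have fB (S : 'M[R]_n) : S \in unitmx -> f (block_mx 1%:M 0 0 S : 'M[R]_(1 + n)) = `|\det S|.
  move=> Su; apply: (IH (fun S => f (block_mx 1%:M 0 0 S : 'M[R]_(1 + n)))) => // [B C Bu Cu|r r0].
  - have mu X : X \in unitmx -> (block_mx 1%:M 0 0 X : 'M[R]_(1 + n)) \in unitmx.
      by rewrite !unitmxE (@det_ublock _ 1 n) det1 mul1r.
    rewrite -fM ?mu // (@mulmx_block _ 1 n 1 n 1 n).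
    by rewrite !mulmx0 !mul0mx !mul1mx !addr0 !add0r.
  - rewrite (_ : block_mx _ _ _ _ = diag_mx (row_mx 1 r)).
      rewrite fD => [|i].
        rewrite big_ord_recl r0E mxE eqxx normr1 mul1r.
        by apply: eq_bigr => i _; rewrite rSE.
      by case: (unliftP ord0 i) => [j|] ->; rewrite ?r0E ?(rSE _ _ j) // mxE oner_neq0.
    by rewrite diag_mx_row; congr block_mx; apply/matrixP => i j; rewrite !ord1 !mxE.
(* A row transposition [P] supplies a nonzero pivot; [P *m P = 1] and nonnegativity force
   [f P = 1]. *)
wlog A00 : A Au / A ord0 ord0 != 0.
  move=> W; have [i Ai0] : exists i, A i ord0 != 0.
    apply/existsP; apply: contraTT Au; rewrite negb_exists => /forallP Ai.
    rewrite unitmxE unitfE negbK (expand_det_col _ ord0) big1 // => i _.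
    by have := Ai i; rewrite negbK => /eqP ->; rewrite mul0r.
  pose P : 'M[R]_n.+1 := tperm_mx ord0 i.
  have Pu : P \in unitmx by exact: unitmx_perm.
  have PP : P *m P = 1%:M by rewrite -perm_mxM tperm2 perm_mx1.
  have fP : f P = 1.
    apply/eqP; rewrite -(@eqrXn2 _ 2) ?f0 ?ler01 // expr1n expr2 -fM // PP f1 //.
  have := W (P *m A); rewrite unitmx_mul Pu Au fM // fP mul1r => -> //.
    by rewrite det_mulmx det_perm normrM normrX normrN1 expr1n mul1r.
  by rewrite -row_permE mxE tpermL.
pose a := A ord0 ord0.
pose c : 'rV[R]_n := ursubmx (A : 'M[R]_(1 + n)).
pose e : 'cV[R]_n := dlsubmx (A : 'M[R]_(1 + n)).
pose B : 'M[R]_n := drsubmx (A : 'M[R]_(1 + n)).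
pose S := B - a^-1 *: (e *m c).
(* Factorization through the Schur complement [S]: two shears, a diagonal matrix and a block to
   which the induction hypothesis applies. *)
have AE : A = (block_mx 1%:M 0 (a^-1 *: e) 1%:M : 'M[R]_(1 + n)) *m
   ((block_mx a%:M 0 0 1%:M : 'M[R]_(1 + n)) *m
   ((block_mx 1%:M 0 0 S : 'M[R]_(1 + n)) *m
    (block_mx 1%:M (a^-1 *: c) 0 1%:M : 'M[R]_(1 + n)))).
  rewrite !(@mulmx_block _ 1 n 1 n 1 n).
  rewrite !mulmx0 !mul0mx !mul1mx !mulmx1 !addr0 !add0r.
  rewrite !mulmx1 !mul_scalar_mx mul_mx_scalar !scalerA mulfV // !scale1r.
  rewrite -scalemxAl /S [a^-1 *: _ + _]addrC subrK.
  have -> : a%:M = ulsubmx (A : 'M[R]_(1 + n)).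
    by rewrite [RHS]mx11_scalar !mxE /a; congr (A _ _)%:M; exact/val_inj.
  exact/esym/(@submxK _ 1 n 1 n A).
have Su : S \in unitmx.
  move: Au; rewrite {1}AE !unitmx_mul => /and4P[_ _ + _].
  by rewrite !unitmxE (@det_ublock _ 1 n) det1 mul1r.
have fa : f (block_mx a%:M 0 0 1%:M : 'M[R]_(1 + n)) = `|a|.
  rewrite (_ : block_mx _ _ _ _ = diag_mx (row_mx (const_mx a) (const_mx 1))).
    rewrite fD => [|i].
      rewrite big_ord_recl r0E mxE big1 ?mulr1 // => i _.
      by rewrite rSE mxE normr1.
    by case: (unliftP ord0 i) => [j|] ->; rewrite ?r0E ?(rSE _ _ j) mxE // oner_neq0.
  by rewrite diag_mx_row !diag_const_mx.
have det_ub : (block_mx a%:M 0 0 1%:M : 'M[R]_(1 + n)) \in unitmx.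
  by rewrite unitmxE (@det_ublock _ 1 n) det1 mulr1 det_scalar expr1 unitfE.
have [u1 u2 u3] : [/\ (block_mx 1%:M 0 (a^-1 *: e) 1%:M : 'M[R]_(1 + n)) \in unitmx,
   (block_mx 1%:M 0 0 S : 'M[R]_(1 + n)) \in unitmx &
   (block_mx 1%:M (a^-1 *: c) 0 1%:M : 'M[R]_(1 + n)) \in unitmx].
  by rewrite !unitmxE (@det_ublock _ 1 n) (@det_lblock _ 1 n) (@det_ublock _ 1 n) !det1 !mul1r unitr1 -unitmxE Su.
rewrite AE fM ?fM ?unitmx_mul ?u1 ?u2 ?u3 ?det_ub // fL fa fB // fU.
rewrite !det_mulmx (@det_lblock _ 1 n) !(@det_ublock _ 1 n) !det1 det_scalar !mul1r !mulr1 expr1.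
by rewrite normrM.
Qed.

End multiplicative_det.

(** * Uniqueness of translation-invariant measures *)

Section translation_invariant.
Context {R : realType} {d : nat}.
Implicit Types (A Q V : set 'rV[R]_d).
Local Open Scope ereal_scope.

(* Both sides compute the product measure of [{(x, y) | x + y \in A, y \in Q}],
   slicing it along either variable. *)
Lemma translation_invariant_unique
    (mu nu : {sigma_finite_measure set 'rV[R]_d -> \bar R}) V :
  (forall x y, V x -> V y -> V (x - y)%R) ->
  (forall v A, V v -> measurable A -> A `<=` V ->
    mu ((fun x => x + v)%R @^-1` A) = mu A) ->
  (forall v A, V v -> measurable A -> A `<=` V ->
    nu ((fun x => x + v)%R @^-1` A) = nu A) ->
  forall A Q, measurable A -> measurable Q -> A `<=` V -> Q `<=` V ->
    (forall x, Q x -> Q (- x)%R) -> mu A * nu Q = mu Q * nu A.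
Proof.
move=> VB muV nuV A Q mA mQ AV QV QN.
pose T := ('rV[R]_d * 'rV[R]_d)%type.
pose S1 : set T := [set p | A (p.1 + p.2)%R /\ Q p.2].
pose S2 : set T := [set p | A p.2 /\ Q (p.2 - p.1)%R].
have mcoord (f : T -> 'rV[R]_d) i : measurable_fun setT f ->
    measurable_fun setT (fun p => f p 0%R i).
  by move=> mf; apply: (measurableT_comp (measurable_coord i)).
have mS1 : measurable S1.
  rewrite (_ : S1 = ((fun p : T => p.1 + p.2)%R @^-1` A) `&` (snd @^-1` Q)) //.
  apply: measurableI.
    rewrite -[_ @^-1` _]setTI; apply: (_ : measurable_fun setT _) => //.
    apply: measurable_fun_rV => i; under eq_fun do rewrite mxE.
    by apply: measurable_funD; apply: mcoord; [exact: measurable_fst|exact: measurable_snd].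
  by rewrite -[_ @^-1` _]setTI; apply: measurable_snd.
have mS2 : measurable S2.
  rewrite (_ : S2 = (snd @^-1` A) `&` ((fun p : T => p.2 - p.1)%R @^-1` Q)) //.
  apply: measurableI.
    by rewrite -[_ @^-1` _]setTI; apply: measurable_snd.
  rewrite -[_ @^-1` _]setTI; apply: (_ : measurable_fun setT _) => //.
  apply: measurable_fun_rV => i; under eq_fun do rewrite !mxE.
  by apply: measurable_funB; apply: mcoord; [exact: measurable_snd|exact: measurable_fst].
have prodE S : measurable S -> (mu \x nu) S = (mu \x^ nu) S.
  move=> mS; apply: product_measure_unique => // B C mB mC.
  exact: product_measure2E.
have cst_integral (c : \bar R) B : 0 <= c -> measurable B ->
    \int[nu]_y (c * (\1_B y)%:E) = c * nu B.
  move=> c0 mB; rewrite ge0_integralZl //.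
  - by rewrite integral_indic // setIT.
  - exact/measurable_EFinP.
have E1 : (mu \x^ nu) S1 = mu A * nu Q.
  rewrite -cst_integral //; apply: eq_integral => y _ /=; rewrite indicE.
  have [/set_mem Qy|/negP Qy] := boolP (y \in Q).
    rewrite mule1 -(muV y A) //; last exact: QV.
    congr (mu _); apply/seteqP; split => x; rewrite /ysection /= inE; first by case.
    by move=> Ax; split.
  rewrite mule0 (_ : ysection _ _ = set0) ?measure0 //.
  by apply/seteqP; split => x //; rewrite /ysection /= inE => -[_ /mem_set].
have E2 : (mu \x^ nu) S2 = mu Q * nu A.
  rewrite -cst_integral //; apply: eq_integral => y _ /=; rewrite indicE.
  have [/set_mem Ay|/negP Ay] := boolP (y \in A).
    rewrite mule1 -(muV (- y)%R Q) //; last first.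
      by rewrite -[(- y)%R]sub0r -(subrr y); apply: (VB); [apply: VB|]; exact: AV.
    congr (mu _); apply/seteqP; split => x; rewrite /ysection /= inE.
      by case=> _ /= /QN; rewrite opprB.
    by move=> /QN; rewrite opprB.
  rewrite mule0 (_ : ysection _ _ = set0) ?measure0 //.
  by apply/seteqP; split => x //; rewrite /ysection /= inE => -[/mem_set].
rewrite -E1 -E2 -!prodE //; apply: eq_integral => x _ /=.
(* For [x] in [V] the two slices differ by the translation by [x], to which the invariance of [nu]
   applies; for other [x] both are empty. *)
have [Vx|nVx] := pselect (V x).
  rewrite -(nuV x (xsection S2 x)) //.
  - congr (nu _); apply/seteqP; split => y; rewrite /xsection /= !inE /=.
      by rewrite /S1 /S2 /= addrK addrC.
    by rewrite /S1 /S2 /= addrK addrC.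
  - exact: measurable_xsection.
  - by move=> y; rewrite /xsection /= inE => -[/AV].
suff [-> ->] : xsection S1 x = set0 /\ xsection S2 x = set0 by [].
split; apply/seteqP; split => y //; rewrite /xsection /= inE /=.
  by move=> [/AV Vxy /QV Vy]; apply: nVx; rewrite -[x](addrK y); exact: VB.
by move=> [/AV Vy /QV Vyx]; apply: nVx; rewrite -[x](subKr y); exact: VB.
Qed.

End translation_invariant.

Section linear_image.
Context {R : realType} {d : nat}.
Implicit Types (M : 'M[R]_d) (A : set 'rV[R]_d).
Local Notation leb := (@lebesgue_rV R d).

Lemma measurable_mulmx m n (M : 'M[R]_(m, n)) :
  measurable_fun setT (fun x : 'rV[R]_m => x *m M).
Proof.
apply: measurable_fun_rV => i; under eq_fun do rewrite mxE.
apply: measurable_sum => j; apply: measurable_funM => //.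
exact: measurable_coord.
Qed.

Let Q : set 'rV[R]_d := box (const_mx (-1)) (const_mx 1).

Let lebQ : leb Q = (2 ^+ d)%:E.
Proof.
rewrite lebesgue_rV_box => [|i]; last by rewrite !mxE; lra.
congr EFin; rewrite (eq_bigr (fun=> 2)) ?prodr_const ?card_ord // => i _.
by rewrite !mxE opprK.
Qed.

Let preim M A : set 'rV[R]_d := (fun x => x *m M) @^-1` A.

Let measurable_preim M A : measurable A -> measurable (preim M A).
Proof. by move=> mA; rewrite -[preim M A]setTI; apply: measurable_mulmx. Qed.

Let factor M : R := fine (leb (preim M Q)) / 2 ^+ d.

Let leb_preimQ M : M \in unitmx -> (leb (preim M Q) < +oo)%E.
Proof.
move=> Mu; pose c : R := \sum_i \sum_j `|invmx M i j|.
have c0 : 0 <= c by apply: sumr_ge0 => i _; apply: sumr_ge0.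
apply: (@le_lt_trans _ _ (leb (box (const_mx (- c)) (const_mx c)))).
  apply: le_measure; rewrite ?inE; [|exact: measurable_box|].
    by apply: measurable_preim; exact: measurable_box.
  move=> x /= Qx i; rewrite !mxE -ler_norml -[x](mulmxK Mu) mxE.
  apply: (le_trans (ler_norm_sum _ _ _)); apply: ler_sum => k _.
  rewrite normrM; apply: (@le_trans _ _ (1 * `|invmx M k i|)).
    by apply: ler_wpM2r => //; have := Qx k; rewrite !mxE ler_norml.
  by rewrite mul1r (bigD1 i) //= lerDl sumr_ge0.
by rewrite lebesgue_rV_box ?ltry // => i; rewrite !mxE; lra.
Qed.

(** The image of Lebesgue measure under [M] is again translation invariant, hence a multiple of
    Lebesgue measure; the cube [Q], symmetric as the uniqueness argument demands, fixes the
    factor. *)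
Let preim_factor M A : M \in unitmx -> measurable A ->
  leb (preim M A) = ((factor M)%:E * leb A)%E.
Proof.
move=> Mu mA.
pose m0 : {measure set 'rV[R]_d -> \bar R} := pushforward leb (fun x => x *m M).
pose m := m0 (@measurable_mulmx _ _ M).
have sm : sigma_finite setT m.
  apply: (@pushforward_sigma_finite _ _ _ _ _ leb _ (fun x => x *m invmx M)) => //.
  - exact: mulmxK.
  - exact: mulmxKV.
  - exact: measurable_mulmx.
  - exact: sigma_finiteT.
have [nu mnu] := sigma_finite_measureE sm.
have E : (nu A * leb Q = nu Q * leb A)%E.
  apply: (@translation_invariant_unique R d nu leb setT) => //.
  - move=> v B _ mB _; rewrite -mnu -[LHS]/(leb _) -[RHS]/(leb _).
    rewrite -(lebesgue_rV_translation (v *m invmx M) (measurable_preim M mB)).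
    congr leb; apply/seteqP.
    by split => x; rewrite /preim /= mulmxDl mulmxKV.
  - by move=> v B _ mB _; exact: lebesgue_rV_translation.
  - exact: measurable_box.
  - by move=> x Qx i; have := Qx i; rewrite !mxE -!ler_norml normrN.
move: E; rewrite -mnu lebQ -[m A]/(leb (preim M A)) -[m Q]/(leb (preim M Q)).
have Qoo := leb_preimQ Mu.
have Q_fin : leb (preim M Q) \is a fin_num by rewrite ge0_fin_numE.
rewrite /factor -{1}(fineK Q_fin) => E.
have d0 : (2 ^+ d : R) != 0 by rewrite expf_neq0.
rewrite [RHS](_ : _ = (((2 ^+ d)^-1 : R)%:E * ((fine (leb (preim M Q)))%:E * leb A))%E).
  by rewrite -E [X in (_ * X)%E]muleC muleA -EFinM mulVf // mul1e.
by rewrite muleA -EFinM mulrC.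
Qed.

Let factorM M N : M \in unitmx -> N \in unitmx ->
  factor (M *m N) = factor M * factor N.
Proof.
move=> Mu Nu; have mQ := measurable_box (const_mx (-1) : 'rV[R]_d) (const_mx 1).
have E : (leb (preim (M *m N) Q) = (factor M)%:E * ((factor N)%:E * leb Q))%E.
  rewrite -preim_factor // -preim_factor //; last exact: measurable_preim.
  by congr leb; apply/seteqP; split => x; rewrite /preim /= mulmxA.
move: E; rewrite preim_factor ?unitmx_mul ?Mu // lebQ -!EFinM => -[].
by rewrite mulrA => /mulIf; apply; rewrite expf_neq0.
Qed.

Let factor_ge0 M : 0 <= factor M.
Proof. by rewrite divr_ge0 // ?exprn_ge0 // fine_ge0. Qed.

Let factor_diag (r : 'rV[R]_d) : (forall i, r 0 i != 0) ->
  factor (diag_mx r) = \prod_i `|r 0 i|^-1.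
Proof.
move=> r0; rewrite /factor.
rewrite (_ : preim _ Q = box (\row_i (- `|r 0 i|^-1)) (\row_i `|r 0 i|^-1)).
  rewrite lebesgue_rV_box => [|i]; last first.
    by rewrite !mxE; have : 0 <= `|r 0 i|^-1 by []; lra.
  rewrite /=; apply: (@mulIf _ (2 ^+ d)); first by rewrite expf_neq0.
  have <- : \prod_(i < d) (2 : R) = 2 ^+ d by rewrite prodr_const card_ord.
  rewrite divfK ?prodr_const ?expf_neq0 // -prodr_const -big_split.
  by apply: eq_bigr => i _; rewrite !mxE /= opprK mulr2n mulrDr !mulr1.
have xE x i : (x *m diag_mx r) 0 i = x 0 i * r 0 i :> R by rewrite mul_mx_diag mxE.
have r_gt0 i : 0 < `|r 0 i| by rewrite normr_gt0.
apply/seteqP; split => x /= H i; have := H i; rewrite xE !mxE -!ler_norml normrM.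
  by rewrite -ler_pdivlMr // mul1r.
by rewrite -[X in _ <= X -> _]mul1r ler_pdivlMr.
Qed.

Lemma lebesgue_rV_mulmx M A : M \in unitmx -> measurable A ->
  leb [set x *m M | x in A] = (`|\det M|%:E * leb A)%E.
Proof.
move=> Mu mA.
have u1 X : X \in unitmx -> invmx X \in unitmx by rewrite unitmx_inv.
(* [factor] measures preimages, so it is [factor] of the inverse matrix that takes the product of
   the absolute values on diagonal matrices, as [multiplicative_det] asks. *)
have -> : `|\det M| = factor (invmx M).
  rewrite -(@multiplicative_det _ _ (fun X => factor (invmx X))) //.
  - move=> B C Bu Cu; rewrite mulrC -factorM ?u1 //.
    congr factor; apply: (can_inj (mulKmx (_ : B *m C \in unitmx))).
      by rewrite unitmx_mul Bu.
    by rewrite mulmxV ?unitmx_mul ?Bu // mulmxA mulmxK // mulmxV.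
  - move=> r r0.
    rewrite (_ : invmx _ = diag_mx (\row_i (r 0 i)^-1)).
      rewrite factor_diag => [|i]; last by rewrite mxE invr_eq0.
      by apply: eq_bigr => i _; rewrite mxE normrV ?unitfE ?r0 // invrK.
    have ru : diag_mx r \in unitmx.
      by rewrite unitmxE det_diag unitfE; apply/prodf_neq0.
    apply: (can_inj (mulKmx ru)); rewrite mulmxV //; apply/matrixP => i j.
    rewrite mul_diag_mx !mxE; case: eqP => [->|]; rewrite ?mulr1n ?mulfV //.
    by rewrite mulr0n mulr0.
rewrite -preim_factor ?u1 //; congr leb; apply/seteqP; split => x /=.
  by move=> [y Ay <-]; rewrite /preim /= mulmxK.
by rewrite /preim /= => Ax; exists (x *m invmx M) => //; rewrite mulmxKV.
Qed.

End linear_image.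

(** * Hausdorff measure *)

Section euclidean_distance.
Context {R : realType} {d : nat}.
Implicit Types (x y z : 'rV[R]_d) (A B : set 'rV[R]_d).

Lemma dotv_ge0 x : 0 <= dotv x x.
Proof. by apply: sumr_ge0 => i _; rewrite -expr2 sqr_ge0. Qed.

Lemma dist_ge0 x y : 0 <= dist x y.
Proof. exact: sqrtr_ge0. Qed.

Lemma le_coord_dist x y i : `|x 0 i - y 0 i| <= dist x y.
Proof.
rewrite /dist -sqrtr_sqr ler_sqrt ?dotv_ge0 // /dotv (bigD1 i) //= !mxE -expr2.
by rewrite lerDl; apply: sumr_ge0 => j _; rewrite -expr2 sqr_ge0.
Qed.

Lemma dist_le_sum x y : dist x y <= \sum_i `|x 0 i - y 0 i|.
Proof.
rewrite /dist -[leRHS]ger0_norm ?sumr_ge0 // -sqrtr_sqr ler_sqrt ?sqr_ge0 //.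
rewrite expr2 mulr_suml; apply: ler_sum => i _.
rewrite !mxE -expr2 -real_normK ?num_real // expr2.
by apply: ler_wpM2l => //; rewrite (bigD1 i) //= lerDl sumr_ge0.
Qed.

Lemma dist_translation v x y : dist (x + v) (y + v) = dist x y.
Proof. by rewrite /dist opprD addrACA subrr addr0. Qed.

Local Open Scope ereal_scope.

Lemma ediam_ge0 A : 0 <= ediam A.
Proof. by rewrite le_max lexx. Qed.

Lemma dist_le_ediam A x y : A x -> A y -> (dist x y)%:E <= ediam A.
Proof.
move=> Ax Ay; rewrite le_max; apply/orP; right; apply: ereal_sup_ubound.
by exists x, y.
Qed.

Lemma ediam_le A e : 0 <= e -> (forall x y, A x -> A y -> (dist x y)%:E <= e) ->
  ediam A <= e.
Proof.
move=> e0 H; rewrite ge_max e0 /=; apply: ge_ereal_sup => _ [x [y [Ax Ay ->]]].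
exact: H.
Qed.

Lemma ediam0 : ediam (@set0 'rV[R]_d) = 0.
Proof. by apply/eqP; rewrite eq_le ediam_ge0 andbT; exact: ediam_le. Qed.

Lemma ediam_translation v A : ediam ((fun x => x + v)%R @^-1` A) = ediam A.
Proof.
apply/eqP; rewrite eq_le; apply/andP; split.
  apply: ediam_le => [|x y Ax Ay]; first exact: ediam_ge0.
  by rewrite -(dist_translation v); exact: dist_le_ediam.
apply: ediam_le => [|x y Ax Ay]; first exact: ediam_ge0.
rewrite -(dist_translation (- v)%R); apply: dist_le_ediam => /=; by rewrite subrK.
Qed.

End euclidean_distance.

Lemma unit_ball_volume_gt0 (R : realType) k : 0 < unit_ball_volume R k.
Proof.
suff [] : 0 < unit_ball_volume R k /\ 0 < unit_ball_volume R k.+1 by [].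
elim: k => [|k [IH1 IH2]]; first by rewrite /= ltr01 ltr0n.
by split => //; rewrite mulr_gt0 // divr_gt0 // mulr_gt0 // pi_gt0.
Qed.

Section discrete_type.
Variable T : pointedType.

(** Every subset is made measurable, so that the coverings in [mu_ext] are by arbitrary sets, as in
    [hausdorff_content]. *)
Definition discrete_type : Type := T.
HB.instance Definition _ := Pointed.on discrete_type.
HB.instance Definition _ := @isMeasurable.Build default_measure_display
  discrete_type (@discrete_measurable T) (@discrete_measurable0 T)
  (@discrete_measurableC T) (@discrete_measurableU T).

End discrete_type.

Section hausdorff_outer_measure.
Context {R : realType} {d : nat} {k : nat}.
Implicit Types (A B X : set 'rV[R]_d) (e : R).
Local Open Scope ereal_scope.

Let w : R := (unit_ball_volume R k.+1 / 2 ^+ k.+1)%R.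

Let w_gt0 : (0 < w)%R.
Proof. by rewrite divr_gt0 ?unit_ball_volume_gt0 ?exprn_gt0. Qed.

Let size A : \bar R := w%:E * ediam A ^+ k.+1.

Let size_ge0 A : 0 <= size A.
Proof.
by apply: mule_ge0; [rewrite lee_fin ltW|apply: expe_ge0; exact: ediam_ge0].
Qed.

Let size0 : size set0 = 0.
Proof. by rewrite /size ediam0 expeS mul0e mule0. Qed.

(** The value [+oo] on sets of large diameter moves the restriction on coverings into their cost, so
    that the theory of outer measures generated by coverings applies. *)
Let gauge e (A : set (discrete_type 'rV[R]_d)) : \bar R :=
  if (ediam (A : set 'rV[R]_d) <= e%:E)%E then size A else +oo.

Let gauge_ge0 e A : 0 <= gauge e A.
Proof. by rewrite /gauge; case: ifP. Qed.

Let gauge0 e : (0 < e)%R -> gauge e set0 = 0.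
Proof. by move=> e0; rewrite /gauge ediam0 lee_fin ltW. Qed.

Lemma hausdorff_contentE e A :
  hausdorff_content k.+1 e A = mu_ext (gauge e) A.
Proof.
apply/eqP; rewrite eq_le; apply/andP; split.
  apply: le_ereal_inf_tmp => _ [U [_ AU] <-].
  have [Ue|/existsNP[i Ui]] := pselect (forall i, ediam (U i : set 'rV[R]_d) <= e%:E).
    apply: ereal_inf_lbound; exists U => //.
    by apply: eq_eseriesr => i _; rewrite /gauge Ue.
  rewrite (eseries_pinfty (k := i)) ?leey // => [j _|].
    by rewrite -ltNye (lt_le_trans _ (gauge_ge0 _ _)).
  by rewrite /gauge; case: ifP.
apply: le_ereal_inf_tmp => _ [U [Ue AU] <-].
apply: ereal_inf_lbound; exists U; first by split.
by apply: eq_eseriesr => i _; rewrite /gauge Ue.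
Qed.

Lemma hausdorff_content_le_hausdorff e A : (0 < e)%R ->
  hausdorff_content k.+1 e A <= hausdorff k.+1 A.
Proof. by move=> e0; apply: ereal_sup_ubound; exists e. Qed.

Let hausdorff0 : hausdorff k.+1 (@set0 'rV[R]_d) = 0.
Proof.
rewrite /hausdorff (_ : [set _ | _ in _] = [set 0]) ?ereal_sup1 //.
apply/seteqP; split => [_ [e /= e0 <-]|_ ->].
  by rewrite hausdorff_contentE mu_ext0 //; exact: gauge0.
exists 1%R => /=; first exact: ltr01.
by rewrite hausdorff_contentE mu_ext0 //; exact: gauge0.
Qed.

Let hausdorff_ge0 A : 0 <= hausdorff k.+1 A.
Proof.
apply: le_trans (hausdorff_content_le_hausdorff A (ltr01 : (0 < 1 :> R)%R)).
by rewrite hausdorff_contentE mu_ext_ge0.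
Qed.

Let le_hausdorff : {homo @hausdorff R d k.+1 : A B / A `<=` B >-> A <= B}.
Proof.
move=> A B AB; apply: ge_ereal_sup => _ [e /= e0 <-].
apply: le_trans (hausdorff_content_le_hausdorff B e0).
by rewrite !hausdorff_contentE; exact: le_mu_ext.
Qed.

Let hausdorff_sigma_subadditive : sigma_subadditive (@hausdorff R d k.+1).
Proof.
move=> F; apply: ge_ereal_sup => _ [e /= e0 <-].
rewrite hausdorff_contentE; apply: le_trans (mu_ext_sigma_subadditive _ _) _ => //.
apply: lee_nneseries => [i _ _|i _]; first exact: mu_ext_ge0.
by rewrite -hausdorff_contentE; exact: hausdorff_content_le_hausdorff.
Qed.

HB.instance Definition _ := isOuterMeasure.Build R 'rV[R]_d (@hausdorff R d k.+1)
  hausdorff0 hausdorff_ge0 le_hausdorff hausdorff_sigma_subadditive.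

Let hausdorff_content_anti e e' A : (e <= e')%R ->
  hausdorff_content k.+1 e' A <= hausdorff_content k.+1 e A.
Proof.
move=> ee'; apply: ereal_inf_le_tmp => _ [U [Ue AU] <-]; exists U => //.
by split => // i; rewrite (le_trans (Ue i)) // lee_fin.
Qed.

(** Metric additivity, for sets separated in one coordinate: a set of diameter at most [e / 2] meets
    at most one of them, so a fine covering of the union splits into coverings of the two. *)
Let hausdorff_separated A B i e : (0 < e)%R ->
  (forall x y, A x -> B y -> x 0 i + e <= y 0 i)%R ->
  hausdorff k.+1 A + hausdorff k.+1 B <= hausdorff k.+1 (A `|` B).
Proof.
move=> e0 AB.
have content_sep e1 e2 : (0 < e1)%R -> (0 < e2)%R ->
    hausdorff_content k.+1 e1 A + hausdorff_content k.+1 e2 B <= hausdorff k.+1 (A `|` B).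
  move=> e10 e20; pose e3 := Num.min e1 (Num.min e2 (e / 2)%R).
  have e30 : (0 < e3)%R by rewrite !lt_min e10 e20 divr_gt0.
  have [le31 le32 le3] : [/\ (e3 <= e1)%R, (e3 <= e2)%R & (e3 <= e / 2)%R].
    by split; rewrite !ge_min lexx ?orbT.
  apply: le_trans (hausdorff_content_le_hausdorff _ e30).
  apply: (@le_trans _ _ (hausdorff_content k.+1 e3 A + hausdorff_content k.+1 e3 B)).
    by apply: leeD; exact: hausdorff_content_anti.
  apply: le_ereal_inf_tmp => _ [U [Ue ABU] <-].
  pose part C n := if `[< U n `&` C !=set0 >] then U n else set0.
  have part_le C n : ediam (part C n) <= e3%:E.
    by rewrite /part; case: asboolP => // _; rewrite ediam0 lee_fin ltW.
  have part_cover C : C `<=` A `|` B -> C `<=` \bigcup_n part C n.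
    move=> CAB x Cx; have [n _ Ux] := ABU x (CAB x Cx).
    by exists n => //; rewrite /part; case: asboolP => // -[]; exists x.
  apply: (@le_trans _ _ (\sum_(n <oo) size (part A n) + \sum_(n <oo) size (part B n))).
    apply: leeD; apply: ereal_inf_lbound; [exists (part A)|exists (part B)] => //.
      by split => //; apply: part_cover => x; left.
    by split => //; apply: part_cover => x; right.
  rewrite -nneseriesD //; apply: lee_nneseries => [n _ _|n _].
    exact: adde_ge0.
  rewrite -/(size (U n)) /part.
  case: asboolP => [[x [Ux Ax]]|_]; case: asboolP => [[y [Uy By]]|_];
    rewrite ?size0 ?add0e ?adde0 //.
  have := le_trans (dist_le_ediam Ux Uy) (Ue n); rewrite lee_fin => xy3.
  exfalso; have := le_trans (le_coord_dist x y i) xy3; have := AB x y Ax By.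
  rewrite ler_norml; move: (x 0%R i) (y 0%R i) => s t st /andP[]; lra.
(* The two suprema are taken one after the other, by subtraction, which makes sense once [+oo] is
   excluded. *)
have [->|fin] := eqVneq (hausdorff k.+1 (A `|` B)) +oo; first by rewrite leey.
have hfin C : C `<=` A `|` B -> hausdorff k.+1 C \is a fin_num.
  move=> CAB; rewrite ge0_fin_numE ?hausdorff_ge0 //.
  by apply: le_lt_trans (le_hausdorff CAB) _; rewrite ltey.
have finA : hausdorff k.+1 A \is a fin_num by apply: hfin => x; left.
have finB : hausdorff k.+1 B \is a fin_num by apply: hfin => x; right.
have contentB_fin e2 : (0 < e2)%R -> hausdorff_content k.+1 e2 B \is a fin_num.
  move=> e20; rewrite ge0_fin_numE.
    apply: le_lt_trans (hausdorff_content_le_hausdorff _ e20) _.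
    by rewrite -ge0_fin_numE.
  by rewrite hausdorff_contentE mu_ext_ge0.
rewrite addeC -leeBrDr //; apply: ge_ereal_sup => _ [e2 /= e20 <-].
rewrite leeBrDr // addeC -leeBrDr ?contentB_fin //.
apply: ge_ereal_sup => _ [e1 /= e10 <-].
by rewrite leeBrDr ?contentB_fin //; exact: content_sep.
Qed.

(* The slabs [a + 1 / (n + 2) < x i <= a + 1 / (n + 1)] with [n] of a given
   parity are pairwise separated, so the measures of all slabs are summable. *)
Let hausdorff_halfspace i (a : R) :
  (hausdorff k.+1).-caratheodory [set x : 'rV[R]_d | (x 0 i <= a)%R].
Proof.
apply: le_caratheodory_measurable => X /=; set S := [set x | _].
change (hausdorff k.+1 (X `&` S) + hausdorff k.+1 (X `&` ~` S) <= hausdorff k.+1 X).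
have [->|fin] := eqVneq (hausdorff k.+1 X) +oo; first by rewrite leey.
pose r n : R := (a + n.+1%:R^-1)%R.
have r_lt m n : (m < n)%N -> (r n < r m)%R.
  by move=> mn; rewrite ltrD2l ltf_pV2 ?posrE ?ltr0n // ltr_nat.
have r_le m n : (m <= n)%N -> (r n <= r m)%R.
  by move=> mn; rewrite lerD2l lef_pV2 ?posrE ?ltr0n // ler_nat.
pose Sl n := X `&` [set x : 'rV[R]_d | (r n.+2 < x 0 i <= r n.+1)%R].
pose P n := X `&` [set x : 'rV[R]_d | (r n.+1 < x 0 i)%R].
have HX C : C `<=` X -> hausdorff k.+1 C <= hausdorff k.+1 X by exact: le_hausdorff.
have cover n : X `&` ~` S `<=` P n `|` \bigcup_(m in ~` `I_n) Sl m.
  move=> x [Xx /negP]; rewrite /S /= -ltNge => ax.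
  have [rx|xr] := ltP (r n.+1) (x 0%R i); first by left; split.
  right.
  have ex : exists m, (r m < x 0%R i)%R.
    have xa : (0 < x 0%R i - a)%R by rewrite subr_gt0.
    have [m _ /(_ m (leqnn _)) /= Hm] := near_infty_natSinv_lt (PosNum xa).
    by exists m; rewrite /r addrC -ltrBrDr.
  have [m rm min_m] := ex_minnP ex.
  have nm : (n.+1 < m)%N.
    by rewrite ltnNge; apply/negP => /r_le /le_lt_trans /(_ rm); rewrite ltNge xr.
  case: m nm rm min_m => [|[|m]] // nm rm min_m.
  exists m => /=; first by apply/negP; rewrite -leqNgt.
  by split => //=; rewrite rm leNgt; apply/negP => /min_m; rewrite ltnn.
have sumE (b : nat) N : \sum_(n < N) hausdorff k.+1 (Sl (n.*2 + b)%N) <=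
    hausdorff k.+1 (\bigcup_(n in `I_N) Sl (n.*2 + b)%N).
  elim: N => [|N IH]; first by rewrite big_ord0.
  rewrite big_ord_recr /= addeC; apply: le_trans (leeD2l _ IH) _.
  apply: le_trans (@hausdorff_separated _ _ i (r (N.*2 + b) - r (N.*2 + b).+1)%R _ _) _.
  - by rewrite subr_gt0 r_lt.
  - move=> x y [_ /andP[_ xr]] [n /= nN [_ /andP[ry _]]].
    have : (r (N.*2 + b)%N <= r (n.*2 + b).+2)%R.
      by apply: r_le; rewrite -addn2 addnAC leq_add2r addn2 -doubleS leq_double.
    lra.
  - apply: le_hausdorff => x [Sx|[n /= nN Sx]]; first by exists N => /=.
    by exists n => //=; rewrite ltnS ltnW.
have sum2 M : \sum_(n < M) hausdorff k.+1 (Sl n) <=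
    hausdorff k.+1 X + hausdorff k.+1 X.
  have splitE N : \sum_(n < N.*2) hausdorff k.+1 (Sl n) =
      \sum_(n < N) (hausdorff k.+1 (Sl (n.*2 + 0)%N) + hausdorff k.+1 (Sl (n.*2 + 1)%N)).
    elim: N => [|N IH]; first by rewrite !big_ord0.
    by rewrite doubleS !big_ord_recr /= IH addn0 addn1 addeA.
  apply: (@le_trans _ _ (\sum_(n < M.*2) hausdorff k.+1 (Sl n))).
    rewrite -!(big_mkord xpredT (fun n => hausdorff k.+1 (Sl n))).
    apply: lee_sum_nneg_natr => [n _ _|]; first exact: hausdorff_ge0.
    by rewrite -addnn leq_addr.
  rewrite splitE big_split /=; apply: leeD; apply: (le_trans (sumE _ _)); apply: HX;
    by move=> x [n _ []].
(* Up to a tail of the series of slabs, the part of [X] beyond [a] is [P n], which is separated from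
   [S] by [1 / (n + 2)]. *)
have tail_cvg : (fun N => hausdorff k.+1 X + \sum_(N <= n <oo) hausdorff k.+1 (Sl n))
    @ \oo --> hausdorff k.+1 X + 0.
  apply: cvgeD; [exact: fin_num_adde_defl|exact: cvg_cst|].
  apply: nneseries_tail_cvg => [|n _]; last exact: hausdorff_ge0.
  apply: (@le_lt_trans _ _ (hausdorff k.+1 X + hausdorff k.+1 X)).
    apply: lime_le; first by apply: is_cvg_nneseries => n _ _; exact: hausdorff_ge0.
    by apply: nearW => N; rewrite big_mkord.
  by apply: lte_add_pinfty; rewrite ltey.
rewrite -[leRHS]adde0; apply: (cvge_to_ge tail_cvg); apply: nearW => n.
apply: (@le_trans _ _ (hausdorff k.+1 (X `&` S) +
    (hausdorff k.+1 (P n) + \sum_(n <= m <oo) hausdorff k.+1 (Sl m)))).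
  apply: leeD2l; apply: le_trans (le_hausdorff (cover n)) _.
  apply: le_trans (outer_measureU2 _ _ _) _; apply: leeD2l.
  exact: outer_measure_sigma_subadditive_tail.
rewrite addeA; apply: leeD2r.
apply: le_trans (@hausdorff_separated _ _ i (n.+2%:R^-1)%R _ _) _.
- by rewrite invr_gt0 ltr0n.
- move=> x y [_ xa] [_ ry]; apply: le_trans (ltW ry).
  by rewrite lerD2r.
- by apply: HX => x [[]|[]].
Qed.

(** Half-spaces are Caratheodory measurable, so the identity from the Caratheodory sigma-algebra to
    the Borel one has measurable coordinates and is itself measurable. *)
Lemma hausdorff_caratheodory A : measurable A -> (hausdorff k.+1).-caratheodory A.
Proof.
move=> mA; pose T := caratheodory_type (@hausdorff R d k.+1).
have mid : measurable_fun setT (fun x : T => (x : 'rV[R]_d)).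
  apply: measurable_fun_rV => i.
  apply: (measurability _ (RGenOInfty.measurableE R)) => // _ [_ [a ->] <-].
  rewrite setTI (_ : _ @^-1` _ = ~` [set x : 'rV[R]_d | (x 0 i <= a)%R]).
    by apply: (@measurableC _ T); exact: hausdorff_halfspace.
  apply/seteqP; split => x /=; rewrite in_itv /= andbT ltNge; first by move=> /negP.
  by move=> /negP.
by have := mid measurableT A mA; rewrite setTI.
Qed.

Let hausdorff_sigma_additive : semi_sigma_additive (@hausdorff R d k.+1).
Proof.
move=> F mF tF mUF.
by apply: caratheodory_measure_sigma_additive => // [i|]; exact: hausdorff_caratheodory.
Qed.

HB.instance Definition _ := isMeasure.Build _ _ _ (@hausdorff R d k.+1)
  hausdorff0 hausdorff_ge0 hausdorff_sigma_additive.

Lemma hausdorff_translation v A :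
  hausdorff k.+1 ((fun x => x + v)%R @^-1` A) = hausdorff k.+1 A.
Proof.
suff le B u : hausdorff k.+1 ((fun x => x + u)%R @^-1` B) <= hausdorff k.+1 B.
  apply/eqP; rewrite eq_le le /=.
  apply: le_trans (le ((fun x => x + v)%R @^-1` A) (- v)%R).
  by apply: le_hausdorff => x /=; rewrite subrK.
apply: ge_ereal_sup => _ [e /= e0 <-].
apply: le_trans (hausdorff_content_le_hausdorff _ e0).
apply: le_ereal_inf_tmp => _ [U [Ue BU] <-]; apply: ereal_inf_lbound.
exists (fun n => (fun x => x + u)%R @^-1` U n).
  split => [n|x Bx]; first by rewrite ediam_translation.
  by have [n _ Un] := BU _ Bx; exists n.
by apply: eq_eseriesr => n _; rewrite ediam_translation.
Qed.

End hausdorff_outer_measure.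

(** * Finiteness and lower bounds of the Hausdorff measure *)

Section hausdorff_bounds.
Context {R : realType} {d k : nat}.
Implicit Types (A : set 'rV[R]_d) (e t : R).
Local Open Scope ereal_scope.

Let w : R := (unit_ball_volume R k.+1 / 2 ^+ k.+1)%R.

Let w_gt0 : (0 < w)%R.
Proof. by rewrite divr_gt0 ?unit_ball_volume_gt0 ?exprn_gt0. Qed.

Let hausdorff_content_finite_cover A (U : nat -> set 'rV[R]_d) n t e :
  (0 <= t)%R -> (t <= e)%R ->
  (forall i, (i < n)%N -> ediam (U i) <= t%:E) ->
  A `<=` \bigcup_(i in `I_n) U i ->
  hausdorff_content k.+1 e A <= (w * t ^+ k.+1 *+ n)%:E.
Proof.
move=> t0 te Ut AU; pose U' i := if (i < n)%N then U i else set0.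
apply: (@le_trans _ _ (\sum_(i <oo) w%:E * ediam (U' i) ^+ k.+1)).
  apply: ereal_inf_lbound; exists U' => //; split => [i|x Ax].
    rewrite /U'; case: ifP => [/Ut /le_trans|_]; first by apply; rewrite lee_fin.
    by rewrite ediam0 lee_fin (le_trans t0).
  by have [i /= ni Ux] := AU x Ax; exists i => //; rewrite /U' ni.
rewrite (nneseries_split _ n) => [|i _]; last first.
  by apply: mule_ge0; [rewrite lee_fin ltW|apply/expe_ge0/ediam_ge0].
rewrite [X in _ + X]eseries0 ?adde0 => [|i ni _]; last first.
  rewrite (_ : U' i = set0) ?ediam0 ?expeS ?mul0e ?mule0 //.
  by move: ni; rewrite add0n /U' ltnNge => ->.
rewrite add0n big_mkord.
apply: (@le_trans _ _ (\sum_(i < n) (w * t ^+ k.+1)%:E)).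
  apply: lee_sum => i _; rewrite /U' ltn_ord.
  have := Ut i (ltn_ord i); have := ediam_ge0 (U i).
  case: (ediam (U i)) => [r| |] //; rewrite !lee_fin => r0 rt.
  by rewrite -EFin_expe -EFinM lee_fin ler_pM2l // lerXn2r.
by rewrite sumEFin sumr_const card_ord.
Qed.

Lemma hausdorff_parallelepiped_fin (B : 'M[R]_(k.+1, d)) (c : 'rV[R]_d) :
  hausdorff k.+1 [set c + u *m B | u in box (const_mx 0) (const_mx 1)]%R < +oo.
Proof.
pose D : R := (\sum_j \sum_i `|B i j|)%R.
have D0 : (0 <= D)%R by apply: sumr_ge0 => j _; apply: sumr_ge0.
apply: (@le_lt_trans _ _ (w * (2 * D) ^+ k.+1)%:E); last exact: ltry.
apply: ge_ereal_sup => _ [e /= e0 <-].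
have [n Dn] : exists n, (D / n.+1%:R <= e)%R.
  exists (Num.truncn (D / e)); rewrite ler_pdivrMr ?ltr0n // mulrC -ler_pdivrMr //.
  by apply/ltW; have /andP[] := truncn_itv (divr_ge0 D0 (ltW e0)).
(* There are [n.+2] values per coordinate because the truncation of [u * (n + 1)] reaches [n + 1] at
   [u = 1]. The ratio of [n + 2] to [n + 1] is at most 2, whence [2 * D] in the bound. *)
pose F := {ffun 'I_k.+1 -> 'I_n.+2}.
pose cell (f : F) : set 'rV[R]_d := [set c + u *m B | u in
  [set u : 'rV[R]_k.+1 | forall i, ((f i)%:R <= u 0 i * n.+1%:R <= (f i).+1%:R)%R]]%R.
have cell_diam f : ediam (cell f) <= (D / n.+1%:R)%:E.
  apply: ediam_le => [|_ _ [u Hu <-] [v Hv <-]]; first by rewrite lee_fin divr_ge0.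
  rewrite lee_fin; apply: le_trans (dist_le_sum _ _) _.
  rewrite /D mulr_suml; apply: ler_sum => j _.
  rewrite !mxE opprD addrACA subrr add0r -sumrB mulr_suml.
  apply: le_trans (ler_norm_sum _ _ _) _; apply: ler_sum => i _.
  rewrite -mulrBl normrM mulrC; apply: ler_wpM2l => //.
  rewrite -[leRHS]div1r ler_pdivlMr ?ltr0n //.
  rewrite -[X in (_ * X)%R]normr_nat -normrM mulrBl ler_norml.
  have := Hu i; have := Hv i; rewrite -natr1.
  move: (_ * _)%R (_ * _)%R => a b /andP[? ?] /andP[? ?]; apply/andP; split; lra.
apply: (@le_trans _ _ (w * (D / n.+1%:R) ^+ k.+1 *+ #|F|)%:E); last first.
  rewrite lee_fin card_ffun !card_ord -mulrnAr ler_pM2l //.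
  rewrite -[leLHS]mulr_natl natrX -exprMn lerXn2r ?nnegrE ?mulr_ge0 //.
  rewrite mulrCA [leRHS]mulrC ler_wpM2l // ler_pdivrMr ?ltr0n // -natrM ler_nat.
  by rewrite mul2n -addnn addSn addnS !ltnS leq_addr.
apply: (@hausdorff_content_finite_cover _
  (fun i => if (insub i : option 'I_#|F|) is Some j then cell (enum_val j) else set0)) => //.
- by rewrite divr_ge0.
- move=> i iF; rewrite insubT //.
move=> _ [u Hu <-].
have tr i : (0 <= u 0 i * n.+1%:R)%R.
  by rewrite mulr_ge0 //; have := Hu i; rewrite mxE => /andP[].
have fP i : (Num.truncn (u 0%R i * n.+1%:R)%R < n.+2)%N.
  rewrite ltnS -(ler_nat R); apply: (@le_trans _ _ (u 0%R i * n.+1%:R)%R).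
    by have /andP[] := truncn_itv (tr i).
  by rewrite -[leRHS]mul1r ler_wpM2r //; have := Hu i; rewrite !mxE => /andP[].
pose f : F := [ffun i => Ordinal (fP i)].
exists (enum_rank f) => /=; first exact: ltn_ord.
rewrite insubT // => ?; rewrite (_ : Sub _ _ = enum_rank f); last exact/val_inj.
rewrite enum_rankK; exists u => // i; rewrite ffunE /=.
by have /andP[-> /ltW] := truncn_itv (tr i).
Qed.

(* The fibre [P x] over a point of a covering set of diameter [t] is enclosed
   in a box of volume [O(t ^ (k + 1))]. *)
Lemma lebesgue_le_hausdorff_fibre A (W : set 'rV[R]_d)
    (P : 'rV[R]_d -> set 'rV[R]_d) (c : R) : (0 < c)%R ->
  measurable W -> (forall y, W y -> exists2 x, A x & P x y) ->
  (forall x t, (0 <= t <= 1)%R -> exists B : set 'rV[R]_d, [/\ measurable B,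
    lebesgue_rV B <= (c * t ^+ k.+1)%:E &
    forall y, (dist x y <= t)%R -> P y `<=` B]) ->
  lebesgue_rV W <= (c / w)%:E * hausdorff k.+1 A.
Proof.
move=> c0 mW WA PB.
suff H : lebesgue_rV W <= (c / w)%:E * hausdorff_content k.+1 1 A.
  apply: le_trans H _; apply: lee_wpmul2l; first by rewrite lee_fin; apply/ltW/divr_gt0.
  exact: hausdorff_content_le_hausdorff.
have cw : (0 < c / w)%R by exact: divr_gt0.
rewrite muleC -lee_pdivrMr //.
apply: le_ereal_inf_tmp => _ [U [U1 AU] <-]; rewrite lee_pdivrMr //.
pose t i : R := fine (ediam (U i)).
have tE i : ediam (U i) = (t i)%:E.
  rewrite fineK // ge0_fin_numE ?ediam_ge0 //.
  by apply: le_lt_trans (U1 i) _; exact: ltry.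
have t01 i : (0 <= t i <= 1)%R.
  by rewrite -!lee_fin -tE ediam_ge0 U1.
have /choice[B HB] : forall i, exists B : set 'rV[R]_d, [/\ measurable B,
    lebesgue_rV B <= (c * t i ^+ k.+1)%:E &
    forall x y, U i x -> P x y -> B y].
  move=> i; have [[x Ux]|U0] := pselect (U i !=set0).
    have [B [mB lebB HB]] := PB x (t i) (t01 i); exists B; split => // z y Uz.
    by apply: HB; rewrite -lee_fin -tE; exact: dist_le_ediam.
  exists set0; split => //; last by move=> x y Ux; case: U0; exists x.
  rewrite measure0 lee_fin; apply: mulr_ge0; first exact: ltW.
  by apply: exprn_ge0; have /andP[] := t01 i.
apply: (@le_trans _ _ (\sum_(i <oo) lebesgue_rV (B i))).
  apply: measure_sigma_subadditive => // [i|y Wy]; first by have [] := HB i.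
  have [x Ax Pxy] := WA y Wy; have [i _ Ux] := AU x Ax.
  by exists i => //; have [_ _] := HB i; apply; [exact: Ux|].
rewrite muleC -nneseriesZl // => [|i _]; last first.
  by apply: mule_ge0; [rewrite lee_fin ltW|apply/expe_ge0/ediam_ge0].
apply: lee_nneseries => [i _ _|i _]; first exact: measure_ge0.
have [_ + _] := HB i; move=> /le_trans; apply.
by rewrite tE -EFin_expe -!EFinM lee_fin -/w mulrA divfK // gt_eqF.
Qed.

End hausdorff_bounds.

Section lebesgue_hausdorff.
Context {R : realType} {k : nat}.
Local Open Scope ereal_scope.

Let box_bound d (x a b : 'rV[R]_d) : (forall i, a 0 i <= b 0 i)%R ->
  lebesgue_rV (box (x + a) (x + b))%R = (\prod_i (b 0 i - a 0 i))%:E.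
Proof.
move=> ab; rewrite lebesgue_rV_box => [|i]; last by rewrite !mxE lerD2l.
by congr EFin; apply: eq_bigr => i _; rewrite !mxE opprD addrACA subrr add0r.
Qed.

(** Covering sets are enclosed in cubes. This is what makes the Hausdorff measure of a cube
    nonzero. *)
Lemma lebesgue_le_hausdorff : exists2 c : R, (0 < c)%R &
  forall W : set 'rV[R]_k.+1, measurable W ->
    lebesgue_rV W <= c%:E * hausdorff k.+1 W.
Proof.
exists (2 ^+ k.+1 / (unit_ball_volume R k.+1 / 2 ^+ k.+1))%R => [|W mW].
  by rewrite !divr_gt0 ?unit_ball_volume_gt0 ?exprn_gt0.
apply: (@lebesgue_le_hausdorff_fibre _ _ _ _ _ (fun x => [set x])) => //.
- by move=> y Wy; exists y.
move=> x t /andP[t0 _].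
exists (box (x + const_mx (- t)) (x + const_mx t))%R; split.
- exact: measurable_box.
- rewrite box_bound => [|i]; last by rewrite !mxE; lra.
  rewrite lee_fin (eq_bigr (fun=> 2 * t)%R) => [|i _]; last by rewrite !mxE; lra.
  by rewrite prodr_const card_ord exprMn.
- move=> y xy _ -> i; rewrite !mxE -ler_distlC.
  by rewrite (le_trans (le_coord_dist _ _ _)).
Qed.

(** The translates of a set of diameter [t <= 1] by at most one unit along axis [j] fit in a box
    with one side [2 * t + 1 <= 3] and [k.+1] sides [2 * t], whence the constant. The base may be
    tilted against the axis, as the faces of a simplex are. *)
Lemma lebesgue_prism_le_hausdorff : exists2 c : R, (0 < c)%R &
  forall (A W : set 'rV[R]_k.+2) (j : 'I_k.+2), measurable W ->
    (forall y, W y -> exists x t, [/\ A x, (0 <= t <= 1)%R &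
       y = x + t *: delta_mx 0 j]%R) ->
    lebesgue_rV W <= c%:E * hausdorff k.+1 A.
Proof.
exists (3 * 2 ^+ k.+1 / (unit_ball_volume R k.+1 / 2 ^+ k.+1))%R => [|A W j mW WA].
  by rewrite !divr_gt0 ?mulr_gt0 ?unit_ball_volume_gt0 ?exprn_gt0.
pose P (x : 'rV[R]_k.+2) : set 'rV[R]_k.+2 :=
  [set y | exists2 t, (0 <= t <= 1)%R & y = (x + t *: delta_mx 0 j)%R].
apply: (@lebesgue_le_hausdorff_fibre _ _ _ _ _ P) => //.
- by move=> y /WA[x [t [Ax t01 ->]]]; exists x => //; exists t.
move=> x t /andP[t0 t1].
exists (box (x + const_mx (- t)) (x + (const_mx t + delta_mx 0 j)))%R; split.
- exact: measurable_box.
- rewrite box_bound => [|i]; last first.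
    by rewrite !mxE /=; have : (0 <= (i == j)%:R :> R)%R by []; lra.
  rewrite lee_fin (bigD1 j) //= !mxE !eqxx /=.
  rewrite (eq_bigr (fun=> 2 * t)%R) => [|i /negbTE ij]; last by rewrite !mxE ij andbF /=; lra.
  rewrite prodr_const cardC1 card_ord /= exprMn -!mulrA.
  by apply: ler_wpM2r; [rewrite mulr_ge0 ?exprn_ge0|lra].
- move=> y xy _ [s /andP[s0 s1] ->] i.
  have := le_trans (le_coord_dist x y i) xy; rewrite distrC ler_norml !mxE eqxx /=.
  move=> /andP[]; case: (i == j) => /=; move: (x 0%R i) (y 0%R i) => a b ? ?;
  apply/andP; split; lra.
Qed.

End lebesgue_hausdorff.

(** * Hausdorff measure restricted to linear subspaces *)

Section hausdorff_on_planes.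
Context {R : realType} {d k : nat}.
Implicit Types (A Q V : set 'rV[R]_d).
Local Open Scope ereal_scope.

Let haus := @hausdorff R d k.+1.

Let le_haus A B : A `<=` B -> haus A <= haus B.
Proof. exact: (le_outer_measure (@hausdorff R d k.+1 : outer_measure _ _)). Qed.

(** [V] is parametrized through [B] by the coordinates [x *m P], and its part with bounded
    coordinates lies in a parallelepiped. In a space of higher dimension the measure itself is not
    sigma-finite, hence the restriction [mrestr]. *)
Lemma hausdorff_plane_sigma_finite V (mV : measurable V)
    (B : 'M[R]_(k.+1, d)) (P : 'M[R]_(d, k.+1)) :
  (forall x, V x -> x *m P *m B = x)%R ->
  sigma_finite setT (mrestr haus mV).
Proof.
move=> VP; pose G n : set 'rV[R]_d :=
  (fun x => x *m P)%R @^-1` box (const_mx (- n.+1%:R)%R) (const_mx n.+1%:R%R).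
have mG n : measurable (G n).
  by rewrite -[G n]setTI; apply: measurable_mulmx => //; exact: measurable_box.
exists G => [|n]; last split => //.
  apply/seteqP; split => // x _.
  pose c : R := (\sum_i `|(x *m P) 0 i|)%R.
  have c0 : (0 <= c)%R by apply: sumr_ge0.
  exists (Num.truncn c) => // i; rewrite !mxE -ler_norml.
  have /andP[_ /ltW] := truncn_itv c0; apply: le_trans.
  by rewrite /c (bigD1 i) //= mxE lerDl sumr_ge0.
apply: le_lt_trans (hausdorff_parallelepiped_fin
  ((2 * n.+1%:R) *: B)%R (- (const_mx n.+1%:R *m B))%R).
apply: le_haus => x [Gx /VP <-].
exists ((2 * n.+1%:R)^-1 *: (x *m P + const_mx n.+1%:R))%R => [i|].
  have := Gx i; rewrite !mxE => /andP[h1 h2].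
  rewrite mulr_ge0 ?invr_ge0 ?mulr_ge0 //=; last by rewrite -lerBlDr sub0r.
  by rewrite mulrC ler_pdivrMr ?mulr_gt0 ?ltr0n // mul1r mulr2n mulrDl mul1r lerD2r.
rewrite -scalemxAl -scalemxAr scalerA mulVf ?mulf_neq0 // scale1r mulmxDl.
by rewrite addrCA addNr addr0.
Qed.

(** By uniqueness the image of the measure under [L] is a multiple of it on [V]; applying [L] twice
    shows that the factor has square 1. No change of variables for surface measure is involved, and
    [L] may distort distances. *)
Lemma hausdorff_involution V (L : 'rV[R]_d -> 'rV[R]_d) Q (mV : measurable V) :
  (forall x y, V x -> V y -> V (x - y)%R) ->
  sigma_finite setT (mrestr haus mV) ->
  measurable_fun setT L -> involutive L -> {morph L : x y / (x + y)%R} ->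
  (forall x, V x -> V (L x)) ->
  measurable Q -> Q `<=` V -> (forall x, Q x -> Q (- x)%R) ->
  0 < haus Q < +oo ->
  forall A, measurable A -> A `<=` V -> haus (L @^-1` A) = haus A.
Proof.
move=> VB sV mL LK LD VL mQ QV QN /andP[Q0 Qoo].
have mLi A : measurable A -> measurable (L @^-1` A).
  by move=> mA; rewrite -[L @^-1` A]setTI; exact: mL.
have V0 x : V x -> V (- x)%R.
  by move=> Vx; rewrite -sub0r -(subrr x); apply: (VB) => //; exact: VB.
have VD x y : V x -> V y -> V (x + y)%R.
  by move=> Vx Vy; rewrite -[y]opprK; apply: (VB) => //; exact: V0.
pose mu0 : {measure set 'rV[R]_d -> \bar R} := mrestr haus mV.
have [mu muE] := sigma_finite_measureE (sV : sigma_finite setT mu0).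
pose nu0 : {measure set 'rV[R]_d -> \bar R} := pushforward mu0 L.
have snu : sigma_finite setT (nu0 mL).
  by apply: (pushforward_sigma_finite LK LK mL).
have [nu nuE] := sigma_finite_measureE snu.
have muV A : A `<=` V -> mu A = haus A.
  move=> AV; rewrite -muE -[LHS]/(haus (A `&` V)); congr haus.
  exact/setIidPl.
have LV A : A `<=` V -> L @^-1` A `<=` V.
  by move=> AV x /AV /VL; rewrite LK.
have nuV A : A `<=` V -> nu A = haus (L @^-1` A).
  by move=> AV; rewrite -nuE -[LHS]/(mu0 (L @^-1` A)) muE muV //; exact: LV.
have mu_inv v A : V v -> A `<=` V -> mu ((fun x => x + v)%R @^-1` A) = mu A.
  move=> Vv AV; rewrite !muV //; first by rewrite /haus hausdorff_translation.
  by move=> x /AV Vxv; rewrite -[x](addrK v); exact: VB.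
have E A : measurable A -> A `<=` V -> mu A * nu Q = mu Q * nu A.
  move=> mA AV; apply: (@translation_invariant_unique R d mu nu V) => // v B Vv mB BV.
    exact: mu_inv.
  have L0 : L 0%R = 0%R by apply: (addrI (L 0%R)); rewrite -LD !addr0.
  rewrite !nuV // => [|x /BV Vxv]; last by rewrite -[x](addrK v); exact: VB.
  rewrite /haus -[RHS](hausdorff_translation (L v)); congr hausdorff.
  by apply/seteqP; split => x /=; rewrite LD LK.
have Qfin : haus Q \is a fin_num by rewrite ge0_fin_numE // ltW.
have E1 A : measurable A -> A `<=` V ->
    haus A * haus (L @^-1` Q) = haus Q * haus (L @^-1` A).
  by move=> mA AV; have := E A mA AV; rewrite !muV // !nuV.
(* Taken at the preimage of [Q], the identity says that the measures of [Q] and of its preimage have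
   equal squares. *)
have := E1 _ (mLi _ mQ) (LV _ QV).
have LLQ A : L @^-1` (L @^-1` A) = A by apply/seteqP; split => x /=; rewrite LK.
rewrite LLQ => EQ.
have LQ : haus (L @^-1` Q) = haus Q.
  have : 0 <= haus (L @^-1` Q) by exact: measure_ge0.
  move: EQ Q0 Qoo; case: (haus Q) => [q| |] //; case: (haus (L @^-1` Q)) => [r| |] //.
    rewrite -!EFinM !lte_fin lee_fin => -[] /eqP; rewrite -!expr2 => rq q0 _ r0.
    by congr EFin; apply/eqP; rewrite -(@eqrXn2 _ 2) // ltW.
move=> A mA AV; have := E1 A mA AV; rewrite LQ muleC -(fineK Qfin).
have q0 : fine (haus Q) != 0%R by rewrite gt_eqF // -lte_fin fineK.
move=> /(congr1 (mule ((fine (haus Q))^-1)%:E)).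
by rewrite !muleA -EFinM mulVf // !mul1e => ->.
Qed.

End hausdorff_on_planes.

(** Both measures are translation invariant, so [c] is the ratio of their values on a cube, finite
    by the covering of a parallelepiped and positive by [lebesgue_le_hausdorff]. *)
Lemma hausdorff_lebesgue {R : realType} (k : nat) : exists2 c : R, 0 < c &
  forall A : set 'rV[R]_k.+1, measurable A ->
    hausdorff k.+1 A = (c%:E * lebesgue_rV A)%E.
Proof.
pose haus := @hausdorff R k.+1 k.+1; pose leb := @lebesgue_rV R k.+1.
have VP (x : 'rV[R]_k.+1) : setT x -> x *m 1%:M *m 1%:M = x by rewrite !mulmx1.
have sH := hausdorff_plane_sigma_finite measurableT VP.
pose mu0 : {measure set 'rV[R]_k.+1 -> \bar R} := mrestr haus measurableT.
have [mu muE] := sigma_finite_measureE (sH : sigma_finite setT mu0).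
have muA A : mu A = haus A by rewrite -muE -[LHS]/(haus (A `&` setT)) setIT.
pose Q : set 'rV[R]_k.+1 := box (const_mx (-1)) (const_mx 1).
have mQ : measurable Q by exact: measurable_box.
have lebQ : leb Q = (2 ^+ k.+1)%:E.
  rewrite /leb lebesgue_rV_box => [|i]; last by rewrite !mxE; lra.
  congr EFin; rewrite (eq_bigr (fun=> 2)) ?prodr_const ?card_ord // => i _.
  by rewrite !mxE opprK.
have hausQ_fin : (haus Q < +oo)%E.
  apply: le_lt_trans (hausdorff_parallelepiped_fin (2%:M) (const_mx (-1))).
  apply: (le_outer_measure (@hausdorff R k.+1 k.+1 : outer_measure _ _)) => x Qx.
  exists (2^-1 *: (x + const_mx 1)) => [i|].
    by have := Qx i; rewrite !mxE; move: (x 0 i) => t /andP[? ?]; apply/andP; split; lra.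
  rewrite mul_mx_scalar scalerA divff ?scale1r //; apply/rowP => i; rewrite !mxE; lra.
have [c1 c10 lebH] := @lebesgue_le_hausdorff R k.
have hausQ_gt0 : (0 < haus Q)%E.
  have := lebH Q mQ; rewrite -/leb lebQ => H; rewrite lt_neqAle measure_ge0 andbT.
  by apply/negP => /eqP E; move: H; rewrite -/haus -E mule0 lee_fin leNgt exprn_gt0.
have Qfin : haus Q \is a fin_num by rewrite ge0_fin_numE // ltW.
exists (fine (haus Q) / 2 ^+ k.+1) => [|A mA].
  by rewrite divr_gt0 ?exprn_gt0 // -lte_fin fineK.
have := @translation_invariant_unique R k.+1 mu leb setT.
move=> /(_ (fun _ _ _ _ => I)) E.
have {E} : (mu A * leb Q = mu Q * leb A)%E.
  apply: E => //.
  - by move=> v B _ _ _; rewrite !muA /haus hausdorff_translation.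
  - by move=> v B _ mB _; exact: lebesgue_rV_translation.
  - by move=> x Qx i; have := Qx i; rewrite !mxE -!ler_norml normrN.
rewrite !muA lebQ muleC -{1}(fineK Qfin) => /(congr1 (mule ((2 ^+ k.+1)^-1)%:E)).
rewrite !muleA -!EFinM mulVf ?expf_neq0 // mul1e [in RHS]mulrC.
exact.
Qed.

(** * Simplices *)

Section dot_product.
Context {R : realType} {d : nat}.
Implicit Types x y z : 'rV[R]_d.

Lemma dotvC x y : dotv x y = dotv y x.
Proof. by apply: eq_bigr => i _; rewrite mulrC. Qed.

Lemma dotvDr x y z : dotv x (y + z) = dotv x y + dotv x z.
Proof. by rewrite -big_split; apply: eq_bigr => i _; rewrite mxE mulrDr. Qed.

Lemma dotvZr a x y : dotv x (a *: y) = a * dotv x y.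
Proof. by rewrite mulr_sumr; apply: eq_bigr => i _; rewrite mxE mulrCA. Qed.

Lemma dotvNr x y : dotv x (- y) = - dotv x y.
Proof. by rewrite -scaleN1r dotvZr mulN1r. Qed.

Lemma dotvBr x y z : dotv x (y - z) = dotv x y - dotv x z.
Proof. by rewrite dotvDr dotvNr. Qed.

Lemma dotv0r x : dotv x 0 = 0.
Proof. by rewrite -(scale0r 0) dotvZr mul0r. Qed.

Lemma dotv_sumr (I : Type) (r : seq I) (P : pred I) x (F : I -> 'rV[R]_d) :
  dotv x (\sum_(i <- r | P i) F i) = \sum_(i <- r | P i) dotv x (F i).
Proof. exact: (big_morph _ (dotvDr x) (dotv0r x)). Qed.

Lemma dotv_delta x j : dotv x (delta_mx 0 j) = x 0 j.
Proof.
rewrite /dotv (bigD1 j) //= big1 ?addr0 => [|i /negbTE ij]; rewrite mxE eqxx /=.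
  by rewrite eqxx mulr1.
by rewrite ij mulr0.
Qed.

(** Cauchy-Schwarz, from the nonnegative quadratic in [H] at its minimum [c / b]. *)
Lemma norm_dotv x y : `|dotv x y| <= Num.sqrt (dotv x x) * Num.sqrt (dotv y y).
Proof.
set a := dotv x x; set b := dotv y y; set c := dotv x y.
have a0 : 0 <= a by exact: dotv_ge0.
have b0 : 0 <= b by exact: dotv_ge0.
have H t : 0 <= a - 2 * t * c + t ^+ 2 * b.
  suff -> : a - 2 * t * c + t ^+ 2 * b = dotv (x - t *: y) (x - t *: y).
    exact: dotv_ge0.
  rewrite dotvBr dotvZr !(dotvC (x - _)) !dotvBr !dotvZr (dotvC y x) -/a -/b -/c.
  ring.
rewrite -ler_sqr ?nnegrE ?mulr_ge0 ?sqrtr_ge0 // real_normK ?num_real //.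
rewrite exprMn !sqr_sqrtr //.
have [b00|b00] := eqVneq b 0.
  have cE : c = 0.
    have [//|c0] := eqVneq c 0.
    (* With [b = 0] the form is affine in [t], and this [t] gives it the negative value
       [- a - 2]. *)
    have := H ((a + 1) / c); rewrite b00 mulr0 addr0.
    rewrite -mulrA divfK //; lra.
  by rewrite cE b00 mulr0 expr0n.
have := H (c / b); rewrite -(pmulr_lge0 _ (_ : 0 < b)) ?lt_def ?b00 //.
suff -> : (a - 2 * (c / b) * c + (c / b) ^+ 2 * b) * b = a * b - c ^+ 2 by rewrite subr_ge0.
by field.
Qed.

End dot_product.

(** * Barycentric coordinates *)

Section barycentric.
Context {R : realType} {d : nat}.
Local Notation pt := ('rV[R]_d).
Implicit Types (T F : vset R d) (x y v : pt) (w : pt -> R).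

(** The coordinates exist at every point of the space, not only in the simplex. Their values at
    points that are not vertices of [T] are unspecified, hence the premises [p \in T] below. *)
Definition bary T x : pt -> R :=
  xget (fun=> 0) [set w | \sum_(p <- T) w p = 1 /\ \sum_(p <- T) w p *: p = x].

Section simplex.
Variable T : vset R d.
Hypothesis hT : d_simplex T.

Let sizeT : size (enum_fset T) = d.+1.
Proof. by have [] := hT; rewrite cardfE => <-; rewrite -cardfE. Qed.

(** Affine independence says that the square matrix [M], whose rows are the vertices preceded by a
    1, has trivial left kernel. *)
Let bary_exists x :
  exists w : pt -> R, \sum_(p <- T) w p = 1 /\ \sum_(p <- T) w p *: p = x.
Proof.
pose p_ (i : 'I_d.+1) : pt := nth 0 (enum_fset T) i.
pose M : 'M[R]_(d.+1, 1 + d) := \matrix_i row_mx 1 (p_ i).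
have bigT (V : nmodType) (F : pt -> V) : \sum_(p <- T) F p = \sum_i F (p_ i).
  by rewrite (big_nth 0) sizeT big_mkord.
have p_index (i : 'I_d.+1) : index (p_ i) (enum_fset T) = i.
  by rewrite index_uniq ?fset_uniq // sizeT.
have p_in i : p_ i \in T by apply: mem_nth; rewrite sizeT.
pose wt (u : 'rV[R]_d.+1) (p : pt) : R := u 0 (inord (index p (enum_fset T))).
have wtE u i : wt u (p_ i) = u 0 i by rewrite /wt p_index inord_val.
have uM u : u *m M = row_mx (\sum_(p <- T) wt u p)%:M (\sum_(p <- T) wt u p *: p).
  rewrite mulmx_sum_row !bigT; apply/rowP => j; rewrite summxE.
  case: (split_ordP j) => l ->; rewrite ?row_mxEl ?row_mxEr.
    rewrite ord1 mxE mulr1n; apply: eq_bigr => i _.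
    by rewrite wtE mxE rowK row_mxEl mxE eqxx mulr1.
  by rewrite summxE; apply: eq_bigr => i _; rewrite wtE [LHS]mxE rowK row_mxEr [RHS]mxE.
have Mu : M \in unitmx.
  rewrite -row_free_unit; apply: inj_row_free => u.
  move=> uM0; have := uM u; rewrite [LHS]uM0 -[LHS](@row_mx0 _ 1 1 d).
  move=> /esym/eq_row_mx[E0 E1].
  have /(_ (wt u)) H := hT.2; apply/rowP => i; rewrite mxE -wtE; apply: H => //.
  by have := congr1 (fun A : 'M[R]_1 => A 0 0) E0; rewrite !mxE mulr1n.
exists (wt (row_mx 1 x *m invmx M)).
have := uM (row_mx 1 x *m invmx M); rewrite mulmxKV // => /eq_row_mx[E0 E1].
split=> //; have := congr1 (fun A : 'M[R]_1 => A 0 0) E0.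
by rewrite !mxE mulr1n.
Qed.

Lemma baryP x : \sum_(p <- T) bary T x p = 1 /\ \sum_(p <- T) bary T x p *: p = x.
Proof. exact: (xgetPex (fun=> 0) (bary_exists x)). Qed.

Lemma bary_unique w x p : \sum_(p <- T) w p = 1 -> \sum_(p <- T) w p *: p = x ->
  p \in T -> w p = bary T x p.
Proof.
move=> w1 wx pT; have [b1 bx] := baryP x; apply/eqP; rewrite -subr_eq0; apply/eqP.
apply: (hT.2 (fun p => w p - bary T x p)) => //; first by rewrite sumrB w1 b1 subrr.
by under eq_bigr do rewrite scalerBl; rewrite sumrB wx bx subrr.
Qed.

Definition bary_grad p : pt := \row_j (bary T (delta_mx 0 j) p - bary T 0 p).

Lemma baryD x v p : p \in T -> bary T (x + v) p = bary T x p + dotv (bary_grad p) v.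
Proof.
move=> pT; symmetry.
apply: (@bary_unique (fun p => bary T x p + dotv (bary_grad p) v)) => //.
  rewrite big_split /= (baryP x).1 exchange_big big1 ?addr0 // => j _.
  rewrite -mulr_suml (eq_bigr (fun p => bary T (delta_mx 0 j) p - bary T 0 p)).
    by rewrite sumrB !(baryP _).1 subrr mul0r.
  by move=> q _; rewrite mxE.
under eq_bigr do rewrite scalerDl.
rewrite big_split /= (baryP x).2; congr (_ + _).
under eq_bigr do rewrite scaler_suml.
rewrite exchange_big /= [RHS]row_sum_delta; apply: eq_bigr => j _.
under eq_bigr => q _ do rewrite mxE mulrC -scalerA scalerBl.
by rewrite -scaler_sumr sumrB !(baryP _).2 subr0.
Qed.

Lemma bary_vertex p q : p \in T -> q \in T -> bary T q p = (p == q)%:R.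
Proof.
move=> pT qT; symmetry; apply: (@bary_unique (fun p => (p == q)%:R)) => //.
  rewrite (big_rem q) //= eqxx big_seq big1 ?addr0 // => r.
  by rewrite mem_rem_uniq ?fset_uniq // inE => /andP[/negbTE ->].
rewrite (big_rem q) //= eqxx scale1r big_seq big1 ?addr0 // => r.
by rewrite mem_rem_uniq ?fset_uniq // inE => /andP[/negbTE ->]; rewrite scale0r.
Qed.

Lemma bary_grad_diff p x y : p \in T ->
  dotv (bary_grad p) (x - y) = bary T x p - bary T y p.
Proof.
by move=> pT; rewrite -{2}(subrK y x) [x - y + y]addrC baryD // addrAC subrr add0r.
Qed.

Lemma sum_bary_grad v : \sum_(p <- T) dotv (bary_grad p) v = 0.
Proof.
have := (baryP (0 + v)).1; rewrite big_seq; under eq_bigr => p pT do rewrite baryD //.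
rewrite -big_seq big_split /= (baryP 0).1.
by move=> /(congr1 (fun t => t - 1)); rewrite addrAC subrr add0r.
Qed.

(** Interpolation reproduces the identity map. Paired with a linear form, this is the exactness of
    interpolated gradients on affine functions. *)
Lemma sum_bary_grad_vertex v : \sum_(p <- T) dotv (bary_grad p) v *: p = v.
Proof.
have := (baryP (0 + v)).2; rewrite big_seq.
under eq_bigr => p pT do rewrite baryD // scalerDl.
by rewrite -big_seq big_split /= (baryP 0).2 !add0r.
Qed.

Lemma hullP x : hull T x <-> forall p, p \in T -> 0 <= bary T x p.
Proof.
split=> [[w [w0 w1 wx]] p pT|H]; first by rewrite -(bary_unique w1 (esym wx)) // w0.
by exists (bary T x); split => //; have [] := baryP x.
Qed.

Lemma face_hullP F x : (F `<=` T)%fset -> hull F x <->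
  hull T x /\ forall p, p \in T -> p \notin F -> bary T x p = 0.
Proof.
move=> FT; split=> [[w [w0 w1 wx]]|[Tx HF]].
  pose w' p := if p \in F then w p else 0.
  have bigF (V : nmodType) (G : pt -> V) : (forall p, p \notin F -> G p = 0) ->
      \sum_(p <- T) G p = \sum_(p <- F) G p.
    move=> G0; rewrite [RHS](big_fset_incl _ FT) // => p _; exact: G0.
  have w'1 : \sum_(p <- T) w' p = 1.
    rewrite bigF => [|p /negbTE pF]; last by rewrite /w' pF.
    by rewrite -w1 big_seq [RHS]big_seq; apply: eq_bigr => p pF; rewrite /w' pF.
  have w'x : \sum_(p <- T) w' p *: p = x.
    rewrite bigF => [|p /negbTE pF]; last by rewrite /w' pF scale0r.
    by rewrite wx big_seq [RHS]big_seq; apply: eq_bigr => p pF; rewrite /w' pF.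
  split=> [|p pT /negbTE pF]; last by rewrite -(bary_unique w'1 w'x) // /w' pF.
  apply/hullP => p pT; rewrite -(bary_unique w'1 w'x) // /w'.
  by case: ifP => // /w0.
move/hullP : Tx => Tx; have [b1 bx] := baryP x.
have bigF (V : nmodType) (G : pt -> V) : (forall p, p \in T -> p \notin F -> G p = 0) ->
    \sum_(p <- T) G p = \sum_(p <- F) G p.
  by move=> G0; rewrite [RHS](big_fset_incl _ FT).
exists (bary T x); split => [p /(fsubsetP FT)/Tx//||].
  by rewrite -b1 bigF.
by rewrite -{1}bx bigF // => p pT pF; rewrite HF // scale0r.
Qed.

End simplex.
End barycentric.

(** The matrix determinant lemma: multiplying [A] by the same unitriangular matrix on the right and
    on the left gives two block triangular matrices, whose determinants are the two sides. *)
Lemma det_rank1 (R : comUnitRingType) (d : nat) (g u : 'rV[R]_d) :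
  \det (1%:M + g^T *m u) = 1 + (u *m g^T) 0 0.
Proof.
pose A : 'M[R]_(1 + d) := block_mx 1%:M (- u) g^T 1%:M.
have E1 : A *m block_mx 1%:M u 0 1%:M = block_mx 1%:M 0 g^T (1%:M + g^T *m u).
  rewrite mulmx_block !mulmx1 !mulmx0 !mul1mx !addr0 subrr.
  by rewrite addrC.
have E2 : block_mx 1%:M u 0 1%:M *m A = block_mx (1%:M + u *m g^T) 0 g^T 1%:M.
  by rewrite mulmx_block !mulmx1 !mul0mx !mul1mx !add0r addNr.
have := congr1 determinant E1; have := congr1 determinant E2.
rewrite !det_mulmx !det_ublock !det_lblock !det1 !mul1r !mulr1 => -> <-.
by rewrite det_mx11 !mxE eqxx.
Qed.

(** * Volumes of simplices *)

Section simplex_volume.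
Context {R : realType} {d : nat}.
Local Notation pt := ('rV[R]_d).
Implicit Types (T F : vset R d) (x y v : pt).

Lemma continuous_dotv (g : pt) : continuous (dotv g).
Proof.
rewrite /dotv => x; elim: (index_enum _) => [|i r IH].
  rewrite (_ : (fun y : pt => _) = fun=> 0); first exact: cst_continuous.
  by apply/funext => y; rewrite big_nil.
rewrite (_ : (fun y : pt => _) =
    (fun y => g 0 i * y 0 i) + (fun y => \sum_(i <- r) g 0 i * y 0 i)); last first.
  by apply/funext => y; rewrite big_cons.
apply: (@continuousD _ _ _ (fun y : pt => g 0 i * y 0 i)) => //.
apply: (@continuousM _ _ (fun=> g 0 i) (fun y : pt => y 0 i)).
  exact: cst_continuous.
exact: coord_continuous.
Qed.

Lemma continuous_bary T p : d_simplex T -> p \in T ->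
  continuous (fun x => bary T x p).
Proof.
move=> hT pT; have -> : (fun x => bary T x p) =
    (fun x => bary T 0 p + dotv (bary_grad T p) x).
  by apply/funext => x; rewrite -{1}[x]add0r baryD.
move=> x; apply: (@continuousD _ _ _ (fun=> bary T 0 p)); first exact: cst_continuous.
exact: continuous_dotv.
Qed.

Lemma closed_hull T : d_simplex T -> closed (hull T).
Proof.
move=> hT; rewrite (_ : hull T = \bigcap_(p in [set p | p \in T])
    ((fun x => bary T x p) @^-1` [set t | 0 <= t])).
  apply: closed_bigI => p pT.
  by move/continuous_closedP : (continuous_bary hT pT); apply; exact: closed_ge.
apply/seteqP; split => x; first by move=> /(hullP hT) H p /H.
by move=> H; apply/(hullP hT) => p; exact: H.
Qed.

Lemma measurable_hull T : d_simplex T -> measurable (hull T).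
Proof. by move=> hT; apply: closed_measurable_rV; exact: closed_hull. Qed.

Lemma hull_vertex T p : p \in T -> hull T p.
Proof.
move=> pT; exists (fun q => (q == p)%:R); split.
- by [].
- rewrite (big_rem p) //= eqxx big_seq big1 ?addr0 // => r.
  by rewrite mem_rem_uniq ?fset_uniq // inE => /andP[/negbTE ->].
- rewrite (big_rem p) //= eqxx scale1r big_seq big1 ?addr0 // => r.
  by rewrite mem_rem_uniq ?fset_uniq // inE => /andP[/negbTE ->]; rewrite scale0r.
Qed.

Lemma hull_coord_le T (i : 'I_d) (c : R) x :
  (forall p, p \in T -> p 0 i <= c) -> hull T x -> x 0 i <= c.
Proof.
move=> Tc [w [w0 w1 ->]]; rewrite summxE -[c]mul1r -w1 mulr_suml big_seq.
rewrite [leRHS]big_seq; apply: ler_sum => p pT; rewrite mxE.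
by apply: ler_wpM2l; [exact: w0|exact: Tc].
Qed.

Lemma hull_coord_ge T (i : 'I_d) (c : R) x :
  (forall p, p \in T -> c <= p 0 i) -> hull T x -> c <= x 0 i.
Proof.
move=> Tc [w [w0 w1 ->]]; rewrite summxE -[c]mul1r -w1 mulr_suml big_seq.
rewrite [leRHS]big_seq; apply: ler_sum => p pT; rewrite mxE.
by apply: ler_wpM2l; [exact: w0|exact: Tc].
Qed.

Lemma hull_box T (a : pt) (c : R) : (forall p i, p \in T -> `|p 0 i - a 0 i| <= c) ->
  hull T `<=` box (a + const_mx (- c)) (a + const_mx c).
Proof.
move=> Tc x Tx i; rewrite !mxE; apply/andP; split.
  by apply: hull_coord_ge Tx => p pT; have := Tc p i pT; rewrite ler_distl => /andP[].
by apply: hull_coord_le Tx => p pT; have := Tc p i pT; rewrite ler_distl => /andP[].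
Qed.

Definition barycenter T : pt := (#|` T|%:R)^-1 *: \sum_(p <- T) p.

Lemma bary_barycenter T F p : d_simplex T -> (F `<=` T)%fset -> (0 < #|` F|)%N ->
  p \in T -> bary T (barycenter F) p = if p \in F then (#|` F|%:R)^-1 else 0.
Proof.
move=> hT FT F0 pT; symmetry.
apply: (bary_unique hT (w := fun p => if p \in F then (#|` F|%:R)^-1 else 0)) => //.
  rewrite -(big_fset_incl _ FT) => [|q _ /negbTE -> //].
  rewrite big_seq (eq_bigr (fun=> (#|` F|%:R)^-1)) => [|q ->//].
  rewrite -big_seq big_const_seq count_predT iter_addr addr0 -[LHS]mulr_natr.
  by rewrite mulVf // pnatr_eq0 -lt0n.
rewrite -(big_fset_incl _ FT) => [|q _ /negbTE -> ]; last by rewrite scale0r.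
rewrite /barycenter scaler_sumr big_seq [RHS]big_seq.
by apply: eq_bigr => q ->.
Qed.

Lemma lebesgue_hull_pos T : d_simplex T -> (0 < lebesgue_rV (hull T) < +oo)%E.
Proof.
move=> hT; apply/andP; split.
  pose U : set pt := \bigcap_(p in [set` T]) ((fun x => bary T x p) @^-1` [set t | 0 < t]).
  have oU : open U.
    rewrite openE => x Ux; apply: filter_bigI => p pT; apply: open_nbhs_nbhs; split.
      by move/continuousP : (continuous_bary hT pT); apply; exact: open_gt.
    exact: Ux.
  have Ub : U (barycenter T).
    move=> p /= pT; rewrite bary_barycenter ?fsubset_refl ?hT.1 // pT.
    by rewrite invr_gt0 ltr0n.
  have /nbhs_ballP[e /= e0 beU] : nbhs (barycenter T) U by exact: open_nbhs_nbhs.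
  set b := barycenter T in beU.
  apply: (@lt_le_trans _ _ (lebesgue_rV
     (box (b + const_mx (- (e / 2)) : pt) (b + const_mx (e / 2))))).
    rewrite lebesgue_rV_box => [|i]; last by rewrite !mxE; lra.
    by rewrite lte_fin; apply: prodr_gt0 => i _; rewrite !mxE; lra.
  apply: le_measure; rewrite ?inE; [exact: measurable_box|exact: measurable_hull|].
  move=> x bx; apply/(hullP hT) => p pT; apply/ltW; apply: (beU x) => //.
  apply/ball_rVP => // i; have := bx i; rewrite !mxE -ler_distlC => /le_lt_trans; apply.
  lra.
pose c := \sum_(p <- T) \sum_i `|p 0 i|.
have Hc p i : p \in T -> `|p 0 i - (0 : pt) 0 i| <= c.
  move=> pT; rewrite mxE subr0 /c (big_rem p) //= (bigD1 i) //= -addrA lerDl.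
  by rewrite addr_ge0 ?sumr_ge0 // => q _; exact: sumr_ge0.
have c0 : 0 <= c by apply: sumr_ge0 => p _; exact: sumr_ge0.
apply: (@le_lt_trans _ _ (lebesgue_rV (box (0 + const_mx (- c) : pt) (0 + const_mx c)))).
  apply: le_measure; rewrite ?inE; [exact: measurable_hull|exact: measurable_box|].
  exact: hull_box.
by rewrite lebesgue_rV_box ?ltry // => i; rewrite !mxE; lra.
Qed.

(** The linear part is a rank-one perturbation of the identity; the constant [c] contributes a
    translation. *)
Lemma lebesgue_rV_rank1 (g u : pt) (c : R) (A : set pt) : 1 + dotv g u != 0 -> measurable A ->
  lebesgue_rV [set x + (c + dotv g x) *: u | x in A] =
  (`|1 + dotv g u|%:E * lebesgue_rV A)%E.
Proof.
move=> gu mA; have dotE (x : pt) : (x *m g^T) 0 0 = dotv g x.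
  by rewrite mxE; apply: eq_bigr => i _; rewrite mxE mulrC.
have detE : \det (1%:M + g^T *m u) = 1 + dotv g u by rewrite det_rank1 dotE.
have Mu : 1%:M + g^T *m u \in unitmx by rewrite unitmxE detE unitfE.
have mulE x : x *m (1%:M + g^T *m u) = x + dotv g x *: u.
  by rewrite mulmxDr mulmx1 mulmxA [x *m _]mx11_scalar dotE mul_scalar_mx.
rewrite -detE -lebesgue_rV_mulmx // -[RHS](lebesgue_rV_translation (- (c *: u))).
  congr lebesgue_rV; apply/seteqP; split => x /=.
    move=> [y Ay <-]; rewrite /preimage /=; exists y => //.
    by rewrite mulE scalerDl addrCA [c *: u + _]addrC addrK.
  by move=> [y Ay]; rewrite mulE => E; exists y => //; rewrite scalerDl addrCA E addrC subrK.
rewrite (_ : [set _ | _ in _] = (fun x => x *m invmx (1%:M + g^T *m u)) @^-1` A).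
  by rewrite -[_ @^-1` _]setTI; apply: measurable_mulmx.
apply/seteqP; split => x /=; first by move=> [y Ay <-]; rewrite mulmxK.
by move=> Ax; exists (x *m invmx (1%:M + g^T *m u)) => //; rewrite mulmxKV.
Qed.

Definition replace_vertex T p q : vset R d := (q |` (T `\ p))%fset.

Lemma big_replace_vertex (V : nmodType) T p q (F : pt -> V) : p \in T -> q \notin (T `\ p)%fset ->
  \sum_(r <- replace_vertex T p q) F r = F q + \sum_(r <- (T `\ p)%fset) F r.
Proof. by move=> pT qT; rewrite /replace_vertex big_fsetU1. Qed.

Lemma d_simplex_replace_vertex T p q : d_simplex T -> p \in T -> bary T q p != 0 ->
  q \notin (T `\ p)%fset /\ d_simplex (replace_vertex T p q).
Proof.
move=> hT pT qp.
have qT : q \notin (T `\ p)%fset.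
  apply: contra qp; rewrite in_fsetD1 => /andP[/negbTE nqp qT].
  by rewrite bary_vertex // [p == q]eq_sym nqp.
split=> //; split; first by rewrite /replace_vertex cardfsU1 qT -hT.1 [RHS](cardfsD1 p) pT.
move=> w; rewrite !big_replace_vertex // => w1 wx.
(* The expansion of [q] in the vertices of [T] turns an affine relation on the new vertex set into
   one on [T], with coefficient [w q * bary T q p] at [p]. *)
pose w' r := if r == p then w q * bary T q p else w r + w q * bary T q r.
have split_T (V : nmodType) (F : pt -> V) : \sum_(r <- T) F r = F p + \sum_(r <- (T `\ p)%fset) F r.
  by rewrite (big_fsetD1 p).
have w'E r : r \in (T `\ p)%fset -> w' r = w r + w q * bary T q r.
  by rewrite in_fsetD1 /w' => /andP[/negbTE ->].
have w'1 : \sum_(r <- T) w' r = 0.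
  rewrite split_T big_seq; under eq_bigr => r rT do rewrite w'E //.
  rewrite -big_seq big_split /= {1}/w' eqxx addrCA -mulr_sumr -mulrDr -split_T.
  by rewrite (baryP hT q).1 mulr1 addrC.
have w'x : \sum_(r <- T) w' r *: r = 0.
  rewrite split_T big_seq; under eq_bigr => r rT do rewrite w'E // scalerDl -scalerA.
  rewrite -big_seq big_split /= {1}/w' eqxx addrCA -scalerA -scaler_sumr -scalerDr.
  rewrite -(split_T _ (fun r => bary T q r *: r)).
  by rewrite (baryP hT q).2 addrC.
have w'0 := hT.2 w' w'1 w'x.
have wq : w q = 0.
  by have := w'0 p pT; rewrite /w' eqxx => /eqP; rewrite mulf_eq0 (negbTE qp) orbF => /eqP.
move=> r; rewrite /replace_vertex in_fset1U => /orP[/eqP ->//|rT].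
have := w'0 r; rewrite w'E // wq mul0r addr0; apply.
by move: rT; rewrite in_fsetD1 => /andP[].
Qed.

(** The affine map adding [bary T x p *: (q - p)] to [x] fixes the other vertices and moves [p] to
    [q]; its determinant is [bary T q p]. *)
Lemma lebesgue_replace_vertex T p q : d_simplex T -> p \in T -> bary T q p != 0 ->
  lebesgue_rV (hull (replace_vertex T p q)) =
  (`|bary T q p|%:E * lebesgue_rV (hull T))%E.
Proof.
move=> hT pT qp; have [qT hT'] := d_simplex_replace_vertex hT pT qp.
pose g := bary_grad T p.
have gE : 1 + dotv g (q - p) = bary T q p.
  by rewrite bary_grad_diff // (bary_vertex hT pT pT) eqxx addrC subrK.
have baryE x : bary T x p = bary T 0 p + dotv g x by rewrite -{1}[x]add0r baryD.
rewrite -gE -(lebesgue_rV_rank1 (bary T 0 p)) ?gE //; last exact: measurable_hull.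
have split_T (V : nmodType) (F : pt -> V) : \sum_(r <- T) F r = F p + \sum_(r <- (T `\ p)%fset) F r.
  by rewrite (big_fsetD1 p).
congr lebesgue_rV; apply/seteqP; split => x.
  move=> [w [w0]]; rewrite !big_replace_vertex // => w1 ->.
  pose w' r := if r == p then w q else w r.
  have w'E r : r \in (T `\ p)%fset -> w' r = w r.
    by rewrite in_fsetD1 /w' => /andP[/negbTE ->].
  have w'1 : \sum_(r <- T) w' r = 1.
    rewrite split_T big_seq; under eq_bigr => r rT do rewrite w'E //.
    by rewrite -big_seq /w' eqxx.
  exists (w q *: p + \sum_(r <- (T `\ p)%fset) w r *: r).
    exists w'; split => // [r rT|].
      rewrite /w'; case: eqP => [_|/eqP rp]; apply: w0; rewrite /replace_vertex.
        by rewrite fset1U1.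
      by rewrite in_fset1U in_fsetD1 rp rT orbT.
    rewrite split_T [X in _ = _ + X]big_seq.
    under [X in _ = _ + X]eq_bigr => r rT do rewrite w'E //.
    by rewrite -big_seq /w' eqxx.
  rewrite -baryE -(bary_unique hT (w := w') w'1) //; last first.
    rewrite split_T [X in _ + X]big_seq.
    under [X in _ + X]eq_bigr => r rT do rewrite w'E //.
    by rewrite -big_seq /w' eqxx.
  by rewrite /w' eqxx scalerBr addrAC addrCA subrr addr0 addrC.
move=> [y Ty <-]; rewrite -baryE; have [b1 bx] := baryP hT y.
exists (fun r => if r == q then bary T y p else bary T y r); split.
- move=> r; rewrite /replace_vertex in_fset1U in_fsetD1; move/(hullP hT) : Ty => Ty.
  by case: eqP => [_ _|_ /= /andP[_]]; exact: Ty.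
- rewrite big_replace_vertex // eqxx big_seq.
  rewrite (eq_bigr (bary T y)) => [|r rT]; last by case: eqP rT qT => // -> ->.
  by rewrite -big_seq -split_T.
- rewrite big_replace_vertex // eqxx big_seq.
  rewrite (eq_bigr (fun r => bary T y r *: r)) => [|r rT]; last by case: eqP rT qT => // -> ->.
  rewrite -big_seq -{1}bx (split_T _ (fun r => bary T y r *: r)) scalerBr addrAC addrCA subrr addr0 addrC //.
Qed.

End simplex_volume.

(** * Bounds for volumes and barycentric gradients *)

Section simplex_estimates.
Context {R : realType} {d : nat}.
Local Notation pt := ('rV[R]_d).
Implicit Types (T F : vset R d) (a p q x y v : pt).

(** A working volume beside [volume], which is defined by the Hausdorff measure and is a fixed
    multiple of this one. *)
Definition lebvol T : R := fine (lebesgue_rV (hull T)).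

Lemma lebvolE T : d_simplex T -> lebesgue_rV (hull T) = (lebvol T)%:E.
Proof.
by move=> /lebesgue_hull_pos/andP[T0 Too]; rewrite fineK // ge0_fin_numE // ltW.
Qed.

Lemma lebvol_gt0 T : d_simplex T -> 0 < lebvol T.
Proof.
move=> hT; rewrite -lte_fin -lebvolE //.
by have /andP[] := lebesgue_hull_pos hT.
Qed.

Lemma lebvol_replace_vertex T p q : d_simplex T -> p \in T -> bary T q p != 0 ->
  lebvol (replace_vertex T p q) = `|bary T q p| * lebvol T.
Proof.
by move=> hT pT qp; rewrite /lebvol lebesgue_replace_vertex // lebvolE.
Qed.

Lemma bary_comb T p (s : seq pt) (w : pt -> R) : d_simplex T -> p \in T ->
  \sum_(r <- s) w r = 1 ->
  bary T (\sum_(r <- s) w r *: r) p = \sum_(r <- s) w r * bary T r p.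
Proof.
move=> hT pT w1; rewrite -[X in bary T X]add0r baryD // dotv_sumr.
rewrite -[X in X + _]mulr1 -w1 mulr_sumr -big_split; apply: eq_bigr => r _ /=.
by rewrite dotvZr mulrC -mulrDr -baryD // add0r.
Qed.

Lemma dist_sym x y : dist x y = dist y x.
Proof. by rewrite /dist -opprB dotvNr dotvC dotvNr opprK. Qed.

Lemma distxx x : dist x x = 0.
Proof. by rewrite /dist subrr dotv0r sqrtr0. Qed.

Lemma dist_eq0 x y : (dist x y == 0) = (x == y).
Proof.
apply/idP/idP => [/eqP xy|/eqP ->]; last by rewrite distxx.
apply/eqP/rowP => i; apply/eqP; rewrite -subr_eq0 -normr_eq0 eq_le normr_ge0 andbT.
by rewrite -xy le_coord_dist.
Qed.

Lemma dist_gt0 x y : x != y -> 0 < dist x y.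
Proof. by move=> xy; rewrite lt_def dist_ge0 dist_eq0 xy. Qed.

Lemma dist_add_scale a v (t : R) : 0 <= t -> dist (a + t *: v) a = t * dist (a + v) a.
Proof.
move=> t0; rewrite /dist ![a + _]addrC !addrK dotvZr dotvC dotvZr mulrA -expr2.
by rewrite sqrtrM ?sqr_ge0 // sqrtr_sqr ger0_norm.
Qed.

Lemma dist_add_delta a j : dist (a + delta_mx 0 j) a = 1.
Proof. by rewrite /dist [a + _]addrC addrK dotv_delta mxE !eqxx sqrtr1. Qed.

Lemma replace_vertexD1 T p q a : a \in T -> a != p -> a != q ->
  (replace_vertex T p q `\ a = q |` (T `\ p `\ a))%fset.
Proof.
move=> aT ap aq; apply/fsetP => r; rewrite !inE.
by case: (eqVneq r q) => [->|_] //=; rewrite ?orbT ?andbT // eq_sym aq.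
Qed.

(* Hadamard's inequality up to a constant: normalizing the edges at [a] one by
   one multiplies the volume by the reciprocal of their lengths. *)
Lemma lebvol_le_prod T a : d_simplex T -> a \in T ->
  lebvol T <= 2 ^+ d * \prod_(q <- (T `\ a)%fset) dist q a.
Proof.
(* Induction on the number of edges at [a] whose length is not 1; when none is left, the simplex
   lies in a cube of side 2 about [a]. *)
pose count1 (U : vset R d) := count (fun q => dist q a != 1) (U `\ a)%fset.
have [n] := ubnP (count1 T); elim: n T => // n IH T /ltnSE Tn hT aT.
have [all1|] := boolP (all (fun q => dist q a == 1) (T `\ a)%fset).
  rewrite big_seq big1 ?mulr1 => [|q]; last by move/allP : all1 => /[apply] /eqP.
  rewrite -lee_fin -lebvolE //.
  apply: (@le_trans _ _ (lebesgue_rV (box (a + const_mx (- 1) : pt) (a + const_mx 1)))).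
    apply: le_measure; rewrite ?inE; [exact: measurable_hull|exact: measurable_box|].
    apply: hull_box => p i pT; apply: le_trans (le_coord_dist _ _ _) _.
    have [->|pa] := eqVneq p a; first by rewrite distxx.
    by move/allP : all1 => /(_ p); rewrite !inE pa pT => /(_ isT) /eqP ->.
  rewrite lebesgue_rV_box => [|i]; last by rewrite !mxE; lra.
  rewrite lee_fin (eq_bigr (fun=> 2)) ?prodr_const ?card_ord // => i _.
  by rewrite !mxE; lra.
move=> /allPn[q]; rewrite !inE => /andP[qa qT] q1.
have t0 : 0 < dist q a by exact: dist_gt0.
pose q' := a + (dist q a)^-1 *: (q - a).
have q'1 : dist q' a = 1.
  by rewrite dist_add_scale ?invr_ge0 ?ltW // [a + _]addrC subrK mulVf // gt_eqF.
have q'a : a != q' by apply: contra_eqN q'1 => /eqP <-; rewrite distxx eq_sym oner_neq0.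
have bq' : bary T q' q = (dist q a)^-1.
  rewrite baryD // (bary_vertex hT qT aT) (negbTE qa) add0r dotvZr bary_grad_diff //.
  by rewrite !(bary_vertex hT) // eqxx (negbTE qa) subr0 mulr1.
have bq'0 : bary T q' q != 0 by rewrite bq' invr_eq0 gt_eqF.
have [q'T hT'] := d_simplex_replace_vertex hT qT bq'0.
have aT' : a \in replace_vertex T q q' by rewrite !inE aT (eq_sym a q) qa orbT.
have q'Ta : q' \notin (T `\ q `\ a)%fset.
  by apply: contra q'T; rewrite !inE => /andP[_].
have D1 : (replace_vertex T q q' `\ a = q' |` (T `\ q `\ a))%fset.
  by apply: replace_vertexD1; rewrite // eq_sym.
have TaE : (T `\ a = q |` (T `\ q `\ a))%fset.
  apply/fsetP => r; rewrite !inE.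
  by case: (eqVneq r q) => [->|] /=; rewrite ?qa ?qT // andbF.
have qTa : q \notin (T `\ q `\ a)%fset by rewrite !inE eqxx /= andbF.
have cnt (r : pt) (S : vset R d) (P : pred pt) : r \notin S ->
    count P (r |` S)%fset = (P r + count P S)%N.
  move=> rS; have /seq.permP -> : perm_eq (r |` S)%fset (r :: S).
    by apply: uniq_perm; rewrite ?fset_uniq //= ?rS ?fset_uniq // => x; rewrite !inE.
  by [].
have T'n : (count1 (replace_vertex T q q') < n)%N.
  apply: leq_trans Tn; rewrite /count1 D1 TaE !cnt //.
  by rewrite q'1 eqxx q1.
have := IH _ T'n hT' aT'; rewrite lebvol_replace_vertex // D1 big_fsetU1 //= q'1 mul1r.
rewrite bq' gtr0_norm ?invr_gt0 // ler_pdivrMl // => H.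
by rewrite TaE big_fsetU1 //= mulrCA.
Qed.

(** Moving [p] to [a + delta_mx 0 j] multiplies the volume by the absolute value of this component;
    the new edge at [a] has unit length and drops out of the product in [lebvol_le_prod]. *)
Lemma bary_grad_le T a p j : d_simplex T -> a \in T -> p \in T -> p != a ->
  `|bary_grad T p 0 j| * lebvol T <=
    2 ^+ d * \prod_(q <- (T `\ p `\ a)%fset) dist q a.
Proof.
move=> hT aT pT pa.
have [->|gj] := eqVneq (bary_grad T p 0 j) 0.
  rewrite normr0 mul0r mulr_ge0 ?exprn_ge0 // prodr_ge0 // => q _.
  exact: dist_ge0.
pose q := a + delta_mx 0 j.
have bq : bary T q p = bary_grad T p 0 j.
  by rewrite baryD // (bary_vertex hT pT aT) (negbTE pa) add0r dotv_delta.
have bq0 : bary T q p != 0 by rewrite bq.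
have [qT hT'] := d_simplex_replace_vertex hT pT bq0.
have aT' : a \in replace_vertex T p q by rewrite !inE aT (eq_sym a p) pa orbT.
have aq : a != q.
  apply/eqP => aq; have := dist_add_delta a j; rewrite -/q -aq distxx => /eqP.
  by rewrite eq_sym oner_eq0.
have := lebvol_le_prod hT' aT'; rewrite lebvol_replace_vertex // bq.
rewrite replace_vertexD1 // 1?eq_sym // big_fsetU1 /= ?dist_add_delta ?mul1r //.
by apply: contra qT; rewrite !inE => /andP[_].
Qed.

Lemma bary_adjacent T1 T2 p1 p2 x : d_simplex T1 -> d_simplex T2 ->
  p1 \in T1 -> p2 \in T2 -> (T1 `\ p1 = T2 `\ p2)%fset ->
  bary T1 x p1 = bary T1 p2 p1 * bary T2 x p2.
Proof.
move=> hT1 hT2 p1T p2T FE.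
have [w1 wx] := baryP hT2 x; rewrite -{1}wx bary_comb // (big_fsetD1 p2) //=.
rewrite big_seq big1 ?addr0 => [|r]; first by rewrite mulrC.
rewrite -FE !inE => /andP[/negbTE rp rT].
by rewrite (bary_vertex hT1 p1T rT) eq_sym rp mulr0.
Qed.

(** Up to a common negative factor these are the area-weighted outward normals of the shared face.
    Volumes suffice to compare them: exchanging [p1] for [p2] scales the volume by the absolute
    value of [bary T1 p2 p1], which is also the ratio of the gradients. *)
Lemma lebvol_grad_opposite T1 T2 p1 p2 : d_simplex T1 -> d_simplex T2 ->
  p1 \in T1 -> p2 \in T2 -> (T1 `\ p1 = T2 `\ p2)%fset -> bary T1 p2 p1 < 0 ->
  lebvol T1 *: bary_grad T1 p1 = - (lebvol T2 *: bary_grad T2 p2).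
Proof.
move=> hT1 hT2 p1T p2T FE b0.
have T2E : T2 = replace_vertex T1 p1 p2 by rewrite /replace_vertex FE fsetD1K.
have bE x := bary_adjacent x hT1 hT2 p1T p2T FE.
have -> : bary_grad T1 p1 = bary T1 p2 p1 *: bary_grad T2 p2.
  by apply/rowP => j; rewrite !mxE bE [bary T1 0 _]bE mulrBr.
rewrite [in RHS]T2E lebvol_replace_vertex ?lt_eqF // ltr0_norm // -T2E.
by rewrite scalerA mulNr scaleNr opprK mulrC.
Qed.

End simplex_estimates.

Section face_estimates.
Context {R : realType} {k : nat}.
Local Notation d := k.+2.
Local Notation pt := ('rV[R]_d).
Implicit Types (T F : vset R d) (p q x y v : pt).

(** With [p] moved to [a + delta_mx 0 j], the simplex lies in the prism of unit height along axis
    [j] over the face, and its volume is the left-hand side. *)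
Lemma bary_grad_le_face : exists2 c : R, 0 < c & forall T p j, d_simplex T -> p \in T ->
  ((`|bary_grad T p 0 j| * lebvol T)%:E <= c%:E * hausdorff k.+1 (hull (T `\ p)%fset))%E.
Proof.
have [c c0 Hc] := @lebesgue_prism_le_hausdorff R k.
exists c => // T p j hT pT.
have [->|gj] := eqVneq (bary_grad T p 0 j) 0.
  by rewrite normr0 mul0r mule_ge0 ?measure_ge0 // lee_fin ltW.
have [F0|[a]] := fset_0Vmem (T `\ p)%fset.
  by have := hT.1; rewrite (cardfsD1 p) pT F0 cardfs0.
rewrite !inE => /andP[ap aT].
pose q := a + delta_mx 0 j.
have bq : bary T q p = bary_grad T p 0 j.
  by rewrite baryD // (bary_vertex hT pT aT) eq_sym (negbTE ap) add0r dotv_delta.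
have bq0 : bary T q p != 0 by rewrite bq.
have [qT hT'] := d_simplex_replace_vertex hT pT bq0.
rewrite -bq -lebvol_replace_vertex // -lebvolE //.
apply: (Hc _ _ j); first exact: measurable_hull.
move=> y [w [w0]]; rewrite !big_replace_vertex // => w1 ->.
exists (w q *: a + \sum_(r <- (T `\ p)%fset) w r *: r), (w q); split.
- have aF : a \in (T `\ p)%fset by rewrite !inE ap.
  exists (fun r => w r + (r == a)%:R * w q); split.
  + move=> r rF; apply: addr_ge0; last apply: mulr_ge0 => //;
      by apply: w0; rewrite /replace_vertex !inE ?eqxx //; move: rF; rewrite !inE => ->; rewrite orbT.
  + rewrite big_split /= -mulr_suml [X in _ + X * _](_ : _ = 1) ?mul1r 1?addrC //.
    rewrite (big_rem a) //= eqxx big_seq big1 ?addr0 // => r.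
    by rewrite mem_rem_uniq ?fset_uniq // inE => /andP[/negbTE ->].
  + under [RHS]eq_bigr do rewrite scalerDl.
    rewrite [RHS]big_split /= addrC; congr (_ + _); symmetry.
    rewrite (big_rem a) //= eqxx mul1r big_seq big1 ?addr0 // => r.
    by rewrite mem_rem_uniq ?fset_uniq // inE => /andP[/negbTE ->]; rewrite mul0r scale0r.
- have wq : 0 <= w q by apply: w0; rewrite /replace_vertex !inE eqxx.
  rewrite wq -w1 lerDl big_seq sumr_ge0 // => r rF; apply: w0.
  by rewrite /replace_vertex !inE; move: rF; rewrite !inE => ->; rewrite orbT.
- by rewrite scalerDr addrAC.
Qed.

(** The coordinate of [p] has derivative 1 along [p - q]. Multiplied by the volume, this is a sum of
    [d] terms, each bounded by [bary_grad_le_face] and the edge length. *)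
Lemma lebvol_le_face : exists2 c : R, 0 < c & forall T p q, d_simplex T ->
  p \in T -> q \in T -> p != q ->
  ((lebvol T)%:E <= (c * dist p q)%:E * hausdorff k.+1 (hull (T `\ p)%fset))%E.
Proof.
have [c c0 Hc] := bary_grad_le_face.
exists (d%:R * c) => [|T p q hT pT qT pq]; first by rewrite mulr_gt0 ?ltr0n.
set H := hausdorff _ _.
have H0 : (0 <= H)%E by exact: measure_ge0.
have gE : \sum_j bary_grad T p 0 j * (p - q) 0 j = 1.
  rewrite -[LHS]/(dotv _ _) bary_grad_diff // !(bary_vertex hT) // eqxx (negbTE pq).
  by rewrite subr0.
have : lebvol T <= \sum_j `|bary_grad T p 0 j| * lebvol T * dist p q.
  rewrite -[leLHS]mul1r -[1]normr1 -gE.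
  rewrite -mulr_suml -mulr_suml mulrAC; apply: ler_wpM2r; first exact/ltW/lebvol_gt0.
  apply: le_trans (ler_norm_sum _ _ _) _; rewrite mulr_suml; apply: ler_sum => j _.
  rewrite normrM; apply: ler_wpM2l => //.
  by have := le_coord_dist p q j; rewrite !mxE.
rewrite -lee_fin => /le_trans; apply; rewrite -sumEFin.
apply: (@le_trans _ _ (\sum_(j < d) ((c * dist p q)%:E * H))%E).
  apply: lee_sum => j _; rewrite [X in (X%:E <= _)%E]mulrC [(c * _)%R]mulrC.
  rewrite !(EFinM (dist p q)) -muleA.
  by apply: lee_wpmul2l; [rewrite lee_fin dist_ge0|exact: Hc].
rewrite -[(d%:R * c * _)%R]mulrA [(d%:R * _)%:E]EFinM -[(d%:R%:E * _ * _)%E]muleA.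
have cH0 : (0 <= (c * dist p q)%:E * H)%E.
  by rewrite mule_ge0 // lee_fin mulr_ge0 ?dist_ge0 // ltW.
case: ((c * _)%:E * H)%E cH0 => [r _|_|] //; first by rewrite sumEFin sumr_const card_ord -EFinM mulr_natl.
by rewrite gt0_muley ?lte_fin ?ltr0n // leey.
Qed.

End face_estimates.

(** * Integrals of affine functions over faces and elements *)

Section affine_integrals.
Context {R : realType} {k : nat}.
Local Notation d := k.+2.
Local Notation pt := ('rV[R]_d).
Implicit Types (T F : vset R d) (a p q x y v : pt) (f : pt -> R).

Lemma measurable_dotv a : measurable_fun setT (dotv a).
Proof.
apply: (@measurable_sum _ _ _ _ _ _ (fun i x => a 0 i * x 0 i)) => i.
by apply: measurable_funM; [exact: measurable_cst|exact: measurable_coord].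
Qed.

Lemma measurable_affine a c : measurable_fun setT (fun x => dotv a x + c).
Proof. by apply: measurable_funD; [exact: measurable_dotv|exact: measurable_cst]. Qed.

Lemma bary_affine T p : d_simplex T -> p \in T ->
  bary T ^~ p = fun x => dotv (bary_grad T p) x + bary T 0 p.
Proof. by move=> hT pT; apply/funext => x; rewrite -{1}[x]add0r baryD // addrC. Qed.

Lemma measurable_bary T p : d_simplex T -> p \in T -> measurable_fun setT (bary T ^~ p).
Proof. by move=> hT pT; rewrite bary_affine //; exact: measurable_affine. Qed.

Section face.
Variables (T : vset R d) (P : pt).
Hypotheses (hT : d_simplex T) (PT : P \in T).
Let F := (T `\ P)%fset.

Lemma mem_faceW p : p \in F -> p \in T.
Proof. by rewrite !inE => /andP[]. Qed.

Lemma in_faceP x : hull F x <-> hull T x /\ bary T x P = 0.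
Proof.
rewrite (face_hullP hT) ?fsubD1set //; split=> [[Tx H]|[Tx H]]; split=> //.
  by apply: H; rewrite // !inE eqxx.
by move=> p pT; rewrite !inE pT andbT negbK => /eqP ->.
Qed.

Lemma measurable_face : measurable (hull F).
Proof.
rewrite (_ : hull F = hull T `&` (bary T ^~ P) @^-1` [set 0]).
  apply: measurableI; first exact: measurable_hull.
  by rewrite -[X in measurable X]setTI; apply: measurable_bary.
by apply/seteqP; split => x /in_faceP.
Qed.

Lemma face_card : #|` F| = d.
Proof. by have := hT.1; rewrite (cardfsD1 P) PT => -[]. Qed.

Definition face_dir : set pt := [set v | dotv (bary_grad T P) v = 0].

Lemma measurable_face_dir : measurable face_dir.
Proof. rewrite -[face_dir]setTI.
exact: (measurable_dotv (bary_grad T P) measurableT (measurable_set1 0)). Qed.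

Lemma face_dirB x y : face_dir x -> face_dir y -> face_dir (x - y).
Proof. by rewrite /face_dir /= dotvBr => -> ->; rewrite subrr. Qed.

Variable p0 : pt.
Hypothesis p0F : p0 \in F.

Let s : seq pt := (F `\ p0)%fset.

Let size_s : size s = k.+1.
Proof. by have := face_card; rewrite (cardfsD1 p0) p0F => -[]. Qed.

Let sF (i : 'I_k.+1) : s`_i \in F /\ s`_i != p0.
Proof.
have : s`_i \in s by rewrite mem_nth // size_s.
by rewrite /s !inE => /and3P[-> -> ->].
Qed.

Definition face_mx : 'M[R]_(k.+1, d) := \matrix_(i, j) (s`_i - p0) 0 j.
(** The coordinates of a direction of the face along the edges from [p0] are the derivatives of the
    barycentric coordinates. *)
Definition face_coord_mx : 'M[R]_(d, k.+1) := \matrix_(j, i) bary_grad T s`_i 0 j.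

Lemma mul_face_mx (w : pt -> R) :
  (\row_i w s`_i) *m face_mx = \sum_(q <- (F `\ p0)%fset) w q *: (q - p0).
Proof.
rewrite mulmx_sum_row -[RHS]/(\sum_(q <- s) w q *: (q - p0)).
rewrite [RHS](big_nth 0) size_s big_mkord; apply: eq_bigr => i _.
by rewrite mxE; congr (_ *: _); apply/rowP => j; rewrite !mxE.
Qed.

Lemma sum_face_dir (w : pt -> R) : \sum_(q <- F) w q = 0 ->
  \sum_(q <- (F `\ p0)%fset) w q *: (q - p0) = \sum_(q <- F) w q *: q.
Proof.
move=> w0; under eq_bigr do rewrite scalerBr.
rewrite big_split /= (big_fsetD1 p0 p0F) /= addrC; congr (_ + _).
rewrite sumrN -scaler_suml -scaleNr; congr (_ *: _).
by move/eqP: w0; rewrite (big_fsetD1 p0) //= addr_eq0 => /eqP ->.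
Qed.

Lemma face_coordK v : face_dir v -> v *m face_coord_mx *m face_mx = v.
Proof.
move=> Pv; have Pv0 : dotv (bary_grad T P) v = 0 by [].
have -> : v *m face_coord_mx = \row_i dotv (bary_grad T s`_i) v.
  apply/rowP => i; rewrite !mxE dotvC; apply: eq_bigr => j _; rewrite mxE.
  by [].
rewrite (mul_face_mx (fun q => dotv (bary_grad T q) v)) sum_face_dir.
  by have := sum_bary_grad_vertex hT v; rewrite (big_fsetD1 P) //= Pv0 scale0r add0r.
by have := sum_bary_grad hT v; rewrite (big_fsetD1 P) //= Pv0 add0r.
Qed.

Lemma face_dir_sigma_finite : sigma_finite setT
  (mrestr (@hausdorff R d k.+1) measurable_face_dir).
Proof. exact: hausdorff_plane_sigma_finite face_coordK. Qed.

Lemma face_subset_parallelepiped x : hull F x -> exists2 u,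
  box (const_mx 0) (const_mx 1) u & x - p0 = u *m face_mx.
Proof.
move=> [w [w0 w1 wx]]; exists (\row_i w s`_i).
  move=> i; rewrite !mxE; have [siF _] := sF i; rewrite w0 //=.
  rewrite -w1 (big_fsetD1 _ siF) /= lerDl big_seq sumr_ge0 // => q.
  by rewrite !inE => /and3P[_ qP qT]; rewrite w0 // !inE qP.
rewrite mul_face_mx wx -[X in _ - X]scale1r -w1 scaler_suml -sumrB.
under eq_bigr do rewrite -scalerBr.
by rewrite (big_fsetD1 p0 p0F) /= subrr scaler0 add0r.
Qed.

Lemma hausdorff_face_fin : (hausdorff k.+1 (hull F) < +oo)%E.
Proof.
apply: le_lt_trans (hausdorff_parallelepiped_fin face_mx p0).
apply: (le_outer_measure (@hausdorff R d k.+1 : outer_measure _ _)).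
by move=> x /face_subset_parallelepiped[u ub xu]; exists u => //; rewrite -xu addrC subrK.
Qed.

Lemma hausdorff_face_pos : (0 < hausdorff k.+1 (hull F))%E.
Proof.
have [c c0 /(_ T P p0 hT PT (mem_faceW p0F))] := @lebvol_le_face R k.
move: p0F; rewrite !inE eq_sym => /andP[Pp0 p0T] /(_ Pp0).
rewrite lt0e measure_ge0 andbT; apply: contraTneq => ->; rewrite mule0.
by rewrite -ltNge lte_fin lebvol_gt0.
Qed.

(* The affine involution exchanging [p0] and [q] and fixing the other vertices
   of the face preserves the Hausdorff measure of its plane. *)
Lemma integral_bary_swap q : q \in F ->
  (\int[@hausdorff R d k.+1]_(x in hull F) (bary T x p0)%:E =
   \int[@hausdorff R d k.+1]_(x in hull F) (bary T x q)%:E)%E.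
Proof.
move=> qF; have [->//|qp] := eqVneq q p0.
have p0T := mem_faceW p0F; have qT := mem_faceW qF.
have PF r : r \in F -> (P == r) = false by rewrite !inE eq_sym => /andP[/negbTE].
pose g : pt := bary_grad T p0 - bary_grad T q.
(* Linear part of the exchange: [g] is the gradient of the difference of the two coordinates and
   takes the value -2 on [q - p0], so [L] is a reflection, in general an oblique one. *)
pose L v := v + dotv g v *: (q - p0).
have gE x y : dotv g (x - y) = (bary T x p0 - bary T y p0) - (bary T x q - bary T y q).
  by rewrite dotvC dotvBr !(dotvC (x - y)) !bary_grad_diff.
have gqp : dotv g (q - p0) = - 2.
  by rewrite gE !(bary_vertex hT) // !eqxx (eq_sym p0) (negbTE qp) /=; ring.
have LK : involutive L.
  move=> v; rewrite /L dotvDr dotvZr gqp -addrA -scalerDl.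
  have -> : dotv g v + (dotv g v + dotv g v * - 2) = 0 by ring.
  by rewrite scale0r addr0.
have LD : {morph L : x y / x + y}.
  by move=> x y; rewrite /L dotvDr scalerDl addrACA.
have LV v : face_dir v -> face_dir (L v).
  rewrite /face_dir /L /= dotvDr => ->; rewrite dotvZr bary_grad_diff //.
  by rewrite !(bary_vertex hT) // !PF // subrr mulr0 addr0.
have mL : measurable_fun setT L.
  apply: measurable_fun_rV => i; under eq_fun do rewrite !mxE.
  apply: measurable_funD; first exact: measurable_coord.
  by apply: measurable_funM; [exact: measurable_dotv|exact: measurable_cst].
have mN : measurable_fun setT (fun x : pt => - x).
  apply: measurable_fun_rV => i; under eq_fun do rewrite mxE.
  by apply: measurableT_comp => //; exact: measurable_coord.
pose S : set pt := (fun x => x + p0) @^-1` hull F.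
have mS : measurable S by rewrite -[S]setTI; apply: measurable_addv => //; exact: measurable_face.
(* The uniqueness argument wants a symmetric set, so the translated face is united with its
   opposite. *)
pose Q := S `|` (fun x => - x) @^-1` S.
have mQ : measurable Q.
  by apply: measurableU => //; rewrite -[X in measurable X]setTI; exact: mN.
have SV v : S v -> face_dir v.
  move=> /in_faceP[_]; rewrite addrC baryD // (bary_vertex hT) //.
  by rewrite PF // add0r.
have QV : Q `<=` face_dir.
  by move=> v [|] /SV //; rewrite /face_dir /= dotvNr => /eqP; rewrite oppr_eq0 => /eqP.
have QN v : Q v -> Q (- v) by case; [right; rewrite /= opprK|left].
have Q0 : (0 < hausdorff k.+1 Q < +oo)%E.
  apply/andP; split.
    apply: lt_le_trans hausdorff_face_pos _; rewrite -(hausdorff_translation p0).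
    by apply: (le_outer_measure (@hausdorff R d k.+1 : outer_measure _ _)) => x; left.
  apply: le_lt_trans (measureU2 _ _ _) _ => //.
    by rewrite -[X in measurable X]setTI; exact: mN.
  apply: lte_add_pinfty; first by
    rewrite -[X in (X < _)%E]/(hausdorff k.+1 S) hausdorff_translation hausdorff_face_fin.
  rewrite -[X in (X < _)%E]/(hausdorff k.+1 (-%R @^-1` S)).
  apply: le_lt_trans (hausdorff_parallelepiped_fin (- face_mx) 0).
  apply: (le_outer_measure (@hausdorff R d k.+1 : outer_measure _ _)).
  move=> x /face_subset_parallelepiped[u ub]; rewrite addrK => xu; exists u => //.
  by rewrite add0r mulmxN -xu opprK.
have HL := hausdorff_involution face_dirB face_dir_sigma_finite mL LK LD LV mQ QV QN Q0.
(* The affine map with linear part [L] that takes [p0] to [q]; it then takes [q] to [p0]. *)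
pose G x := L (x - p0) + q.
have mG : measurable_fun setT G.
  rewrite /G; apply: (@measurableT_comp _ _ _ _ _ _ (fun x => x + q)).
    exact: measurable_addv.
  apply: (measurableT_comp mL).
  exact: measurable_addv.
have GE x r : r \in T -> bary T (G x) r =
    bary T x r + (bary T x p0 - bary T x q) * ((r == q)%:R - (r == p0)%:R).
  move=> rT.
  have -> : G x = x + (1 + dotv g (x - p0)) *: (q - p0).
    by rewrite /G /L scalerDl scale1r; apply/rowP => i; rewrite !mxE; ring.
  rewrite gE baryD // dotvZr bary_grad_diff // ![bary T p0 _](bary_vertex hT) //.
  rewrite [bary T q r](bary_vertex hT) // eqxx (negbTE qp) /=.
  by move: (r == q)%:R (r == p0)%:R => u v; ring.
have Gp x : bary T (G x) p0 = bary T x q.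
  by rewrite GE // eqxx eq_sym (negbTE qp) /=; ring.
have Gq x : bary T (G x) q = bary T x p0.
  by rewrite GE // eqxx (negbTE qp) /=; ring.
have Gr x r : r \in T -> r != p0 -> r != q -> bary T (G x) r = bary T x r.
  by move=> rT /negbTE rp /negbTE rq; rewrite GE // rp rq /=; ring.
have GF : G @^-1` hull F = hull F.
  have sub x : hull F x -> hull F (G x).
    move=> /in_faceP[/(hullP hT) Hx xP]; apply/in_faceP; split; last first.
      by rewrite Gr ?xP // ?PF.
    apply/(hullP hT) => r rT; have [->|rp] := eqVneq r p0; first by rewrite Gp Hx.
    by have [->|rq] := eqVneq r q; [rewrite Gq Hx|rewrite Gr // Hx].
  apply/seteqP; split => [x|] //= /sub; rewrite (_ : G (G x) = x) //.
  have -> : G (G x) = L (L (x - p0) + (q - p0)) + q by rewrite /G addrA.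
  rewrite LD LK [L (q - p0)]/L gqp; apply/rowP => i; rewrite !mxE; ring.
have HG (A : set pt) : A `<=` hull F -> measurable A ->
    hausdorff k.+1 (G @^-1` A) = hausdorff k.+1 A.
  move=> AF mA; rewrite -(hausdorff_translation q A).
  rewrite -[RHS]HL; last 2 first.
  - by rewrite -[X in measurable X]setTI; exact: measurable_addv.
  - move=> v /AF /in_faceP[_]; rewrite addrC baryD // (bary_vertex hT) //.
    by rewrite PF // add0r.
  by rewrite -[RHS](hausdorff_translation (- p0)).
transitivity (\int[pushforward (@hausdorff R d k.+1) G]_(x in hull F) (bary T x p0)%:E)%E.
  by apply: eq_measure_integral => A mA AF; rewrite -[LHS]HG.
rewrite ge0_integral_pushforward //.
- by rewrite GF; apply: eq_integral => x _ /=; rewrite Gp.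
- exact: measurable_face.
- by apply/measurable_EFinP/measurable_funTS; exact: measurable_bary.
- by move=> x /set_mem /in_faceP[/(hullP hT) Hx _]; rewrite lee_fin Hx.
Qed.

Lemma hausdorff_faceE : hausdorff k.+1 (hull F) = (face_area F)%:E.
Proof. by rewrite /face_area fineK // ge0_fin_numE ?measure_ge0 // hausdorff_face_fin. Qed.

Lemma integrable_bary q : q \in F ->
  (@hausdorff R d k.+1).-integrable (hull F) (EFin \o (bary T ^~ q)).
Proof.
move=> qF; apply: measurable_bounded_integrable.
- exact: measurable_face.
- exact: hausdorff_face_fin.
- by apply: measurable_funTS; apply: measurable_bary => //; exact: mem_faceW.
- exists 1; split => // t t1 x /in_faceP[/(hullP hT) Hx _].
  rewrite /= ger0_norm ?Hx ?mem_faceW //; apply: le_trans (ltW t1).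
  have [<- _] := baryP hT x; rewrite (big_fsetD1 q) ?mem_faceW //= lerDl big_seq.
  by apply: sumr_ge0 => r; rewrite inE => /andP[_ /Hx].
Qed.

(** The coordinates of the [d] vertices have equal integrals and add up to 1 on the face. *)
Lemma integral_bary q : q \in F ->
  (\int[@hausdorff R d k.+1]_(x in hull F) (bary T x q)%:E = (d%:R^-1 * face_area F)%:E)%E.
Proof.
move=> qF; set I := LHS.
have I_fin : I \is a fin_num by apply: integrable_fin_num; [exact: measurable_face|exact: integrable_bary].
have : (\sum_(r : F) \int[@hausdorff R d k.+1]_(x in hull F) (bary T x (val r))%:E =
    hausdorff k.+1 (hull F))%E.
  rewrite -(integral_sum measurable_face (f := fun (r : F) x => (bary T x (val r))%:E)); last first.
    by move=> r; exact: (integrable_bary (valP r)).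
  rewrite -[RHS]mul1e -(integral_cst _ measurable_face); apply: eq_integral => x.
  move=> /set_mem /in_faceP[_ xP]; rewrite sumEFin /cst; congr (_%:E).
  have [] := baryP hT x; rewrite (big_fsetD1 P) //= xP add0r => <- _.
  by rewrite (big_seq_fsetE _ F).
rewrite hausdorff_faceE -(fineK I_fin).
have Iq (r : F) : (\int[@hausdorff R d k.+1]_(x in hull F) (bary T x (val r))%:E = (fine I)%:E)%E.
  rewrite fineK // /I -(integral_bary_swap qF) (integral_bary_swap (valP r)).
  by [].
rewrite (eq_bigr _ (fun r _ => Iq r)) sumEFin => -[]; rewrite sumr_const -cardfE face_card.
move=> <-; rewrite -(mulr_natl (fine I) d) [(d%:R^-1 * _)%R]mulrA.
by rewrite mulVf ?mul1r ?fineK // pnatr_eq0.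
Qed.

End face.

Section face_integrals.
Variables (T : vset R d) (P : pt).
Hypotheses (hT : d_simplex T) (PT : P \in T).
Let F := (T `\ P)%fset.

Lemma face_nonempty : exists p, p \in F.
Proof.
have [F0|[p pF]] := fset_0Vmem F; last by exists p.
by have := face_card hT PT; rewrite -/F F0 cardfs0.
Qed.

Lemma integral_face_affine a c :
  (\int[@hausdorff R d k.+1]_(x in hull F) (dotv a x + c)%:E =
   ((dotv a (barycenter F) + c) * face_area F)%:E)%E.
Proof.
have [p0 p0F] := face_nonempty.
transitivity (\int[@hausdorff R d k.+1]_(x in hull F)
    \sum_(r : F) ((dotv a (val r) + c)%:E * (bary T x (val r))%:E))%E.
  apply: eq_integral => x /set_mem /(in_faceP hT PT)[_ xP].
  under eq_bigr do rewrite -EFinM.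
  rewrite sumEFin -(big_seq_fsetE _ F predT (fun r => (dotv a r + c) * bary T x r)) /=.
  have [b1 bx] := baryP hT x; move: b1 bx.
  rewrite !(big_fsetD1 P PT) /= xP scale0r !add0r => b1 {1}<-.
  congr (_%:E); under [RHS]eq_bigr do rewrite mulrDl.
  rewrite big_split /= -mulr_sumr b1 mulr1 dotv_sumr; congr (_ + _).
  by apply: eq_bigr => r _; rewrite dotvZr mulrC.
rewrite integral_sum; [|exact: measurable_face|]; last first.
  by move=> r; apply: integrableZl; [exact: measurable_face|exact: (integrable_bary hT PT p0F (valP r))].
under eq_bigr => r _.
  rewrite integralZl; [|exact: measurable_face|exact: (integrable_bary hT PT p0F (valP r))].
  rewrite (integral_bary hT PT p0F (valP r)) -EFinM. over.
rewrite sumEFin -(big_seq_fsetE _ F predT (fun r => (dotv a r + c) * (d%:R^-1 * face_area F))) /=.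
rewrite -mulr_suml mulrA; congr ((_ * _)%:E).
rewrite big_split /= /barycenter dotvZr dotv_sumr face_card // mulrDl mulrC.
congr (_ + _); rewrite big_const_seq count_predT iter_addr_0 [size _](face_card hT PT).
by rewrite -[c *+ _]mulr_natr mulfK // pnatr_eq0.
Qed.

Lemma face_area_gt0 : 0 < face_area F.
Proof.
have [p0 p0F] := face_nonempty.
by rewrite -lte_fin -(hausdorff_faceE hT PT p0F) (hausdorff_face_pos hT PT p0F).
Qed.

(** The barycenter rule is exact on affine functions, so the barycenter value satisfies the
    orthogonality; testing with [q = 1] shows that no other constant does, which identifies the
    choice made by [xget]. *)
Lemma proj0_affine f a c : (forall x, f x = dotv a x + c) ->
  proj0 (@hausdorff R d d.-1) (hull F) f = f (barycenter F).
Proof.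
move=> fE; rewrite /proj0.
have E (t q : R) : rint (@hausdorff R d d.-1) (hull F) (fun x => (f x - t) * q) =
    (f (barycenter F) - t) * q * face_area F.
  rewrite /rint (_ : (fun x => ((f x - t) * q)%:E) =
    (fun x => (dotv (q *: a) x + (c - t) * q)%:E)) ?integral_face_affine /=.
    by rewrite !fE (dotvC (q *: a)) dotvZr (dotvC _ a); ring.
  by apply/funext => x; rewrite fE (dotvC (q *: a)) dotvZr (dotvC _ a); congr (_%:E); ring.
case: xgetP => [t _ /(_ 1)|/(_ (f (barycenter F)))].
  rewrite E mulr1 => /eqP; rewrite mulf_eq0 (gt_eqF face_area_gt0) orbF.
  by rewrite subr_eq0 => /eqP.
by case=> q; rewrite E subrr !mul0r.
Qed.

Lemma face_norm_proj f a c : (forall x, f x = dotv a x + c) ->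
  face_norm F (face_proj F f) ^+ 2 = f (barycenter F) ^+ 2 * face_area F.
Proof.
move=> fE; have [p0 p0F] := face_nonempty.
rewrite /face_norm /face_proj (proj0_affine fE) /L2norm /rint.
rewrite [X in fine X](_ : _ = (f (barycenter F) ^+ 2 * face_area F)%:E) /=.
  by rewrite sqr_sqrtr // mulr_ge0 ?sqr_ge0 // ltW ?face_area_gt0.
rewrite [LHS](integral_cst (@hausdorff R d k.+1) (measurable_face hT PT)).
by rewrite [RHS]EFinM -(hausdorff_faceE hT PT p0F).
Qed.

End face_integrals.

End affine_integrals.

#[local] Arguments lebesgue_rV : simpl never.

Section element_integrals.
Context {R : realType} {k : nat}.
Local Notation d := k.+2.
Local Notation pt := ('rV[R]_d).
Implicit Types (T F : vset R d) (a p q x y v : pt) (f : pt -> R).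

Lemma derive_affine f a c v x : (forall x, f x = dotv a x + c) -> 'D_v f x = dotv a v.
Proof.
move=> fE; apply: cvg_lim => //; apply: cvg_near_cst; near=> h.
rewrite /= !fE dotvDr dotvZr -[_ + _ + c]addrA addrK [_ *: _]mulrA mulVf ?mul1r //.
by near: h; exact: nbhs_dnbhs_neq.
Unshelve. all: by end_near. Qed.

Lemma H1_seminorm_affine T f a c : d_simplex T -> (forall x, f x = dotv a x + c) ->
  H1_seminorm T f ^+ 2 = dotv a a * lebvol T.
Proof.
move=> hT fE; rewrite /H1_seminorm /rint.
rewrite [X in fine X](_ : _ = (dotv a a * lebvol T)%:E) /=.
  by rewrite sqr_sqrtr // mulr_ge0 ?dotv_ge0 // ltW ?lebvol_gt0.
rewrite [RHS]EFinM -lebvolE //.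
rewrite -(integral_cst (@lebesgue_rV R d) (measurable_hull hT)).
apply: eq_integral => x _; congr (_%:E); apply: eq_bigr => i _.
by rewrite (derive_affine _ _ fE) dotv_delta.
Qed.

Lemma dist_le_diam T x y : d_simplex T -> hull T x -> hull T y -> dist x y <= diam (hull T).
Proof.
move=> hT Tx Ty; rewrite -lee_fin /diam fineK.
  exact: dist_le_ediam.
rewrite ge0_fin_numE ?ediam_ge0 //.
have [p pT] : exists p, p \in T.
  have [F0|[p pF]] := fset_0Vmem T; last by exists p.
  by have := hT.1; rewrite F0 cardfs0.
pose c : R := \sum_(q <- T) dist q p.
have Tc : hull T `<=` box (p + const_mx (- c)) (p + const_mx c).
  apply: hull_box => q i qT; apply: le_trans (le_coord_dist _ _ _) _.
  by rewrite /c (big_fsetD1 q) //= lerDl sumr_ge0 // => r _; exact: dist_ge0.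
apply: (@le_lt_trans _ _ (\sum_(i < d) (2 * c))%:E); last exact: ltry.
apply: ediam_le => [|u v Tu Tv].
  rewrite lee_fin sumr_ge0 // => i _; rewrite mulr_ge0 // sumr_ge0 // => q _.
  exact: dist_ge0.
rewrite lee_fin; apply: le_trans (dist_le_sum _ _) _; apply: ler_sum => i _.
have := Tc _ Tu i; have := Tc _ Tv i; rewrite !mxE.
by move: (u 0 i) (v 0 i) (p 0 i) => s t w; rewrite ler_norml; lra.
Qed.

Lemma affine_sqr_le f a c x y (h : R) : (forall x, f x = dotv a x + c) -> dist x y <= h ->
  f x ^+ 2 <= 2 * f y ^+ 2 + 2 * (h ^+ 2 * dotv a a).
Proof.
move=> fE xy; have -> : f x = f y + dotv a (x - y) by rewrite !fE dotvBr; ring.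
have : dotv a (x - y) ^+ 2 <= h ^+ 2 * dotv a a.
  rewrite -real_normK ?num_real // mulrC -[X in X * _]sqr_sqrtr ?dotv_ge0 //.
  rewrite -exprMn ler_pXn2r // ?nnegrE ?mulr_ge0 ?sqrtr_ge0 ?(le_trans (dist_ge0 _ _) xy) //.
  by apply: le_trans (norm_dotv _ _) _; rewrite ler_wpM2l ?sqrtr_ge0.
have := sqr_ge0 (f y - dotv a (x - y)).
by move: (h ^+ 2 * _) (dotv a (x - y)) (f y) => w s t; nra.
Qed.

(** Almost everywhere the square of [psi] is dominated by the sum of the [M T] times the indicators
    of the elements. For such an upper bound, overlaps of elements do no harm, and finitely many
    null sets are discarded at once. *)
Lemma L2norm_le Omega (Th : mesh R d) psi (M : vset R d -> R) :
  open Omega -> (forall T, T \in Th -> d_simplex T) ->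
  Omega `<=` [set x | exists2 T, T \in Th & hull T x] ->
  measurable_fun Omega psi ->
  (forall T, T \in Th -> is_restriction psi T (restriction psi T)) ->
  (forall T, T \in Th -> 0 <= M T) ->
  (forall T x, T \in Th -> hull T x -> restriction psi T x ^+ 2 <= M T) ->
  L2norm (@lebesgue_rV R d) Omega psi ^+ 2 <= \sum_(T <- Th) M T * lebvol T.
Proof.
move=> oO hTh cover mpsi hr M0 hM.
have mO : measurable Omega by exact: open_measurable_rV.
pose g x := (\sum_(T : Th) (M (val T))%:E * (\1_(hull (val T)) x)%:E)%E.
have gT0 (T : Th) x : (0 <= (M (val T))%:E * (\1_(hull (val T)) x)%:E)%E.
  by rewrite mule_ge0 ?lee_fin ?M0 ?(valP T).
have mI (T : Th) : measurable (hull (val T)).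
  exact: measurable_hull (hTh _ (valP T)).
have mgT (T : Th) : measurable_fun setT (fun x => (M (val T))%:E * (\1_(hull (val T)) x)%:E)%E.
  apply: measurable_funeM; apply/measurable_EFinP.
  exact: measurable_indic.
have g0 x : (0 <= g x)%E by rewrite sume_ge0.
have mg : measurable_fun setT g by exact: emeasurable_sum.
have I : (\int[@lebesgue_rV R d]_(x in Omega) (psi x ^+ 2)%:E <=
    (\sum_(T <- Th) M T * lebvol T)%:E)%E.
  apply: (@le_trans _ _ (\int[@lebesgue_rV R d]_(x in Omega) g x)%E).
    apply: ae_ge0_le_integral => //.
    - by move=> x _; rewrite lee_fin sqr_ge0.
    - by apply/measurable_EFinP; apply: measurable_funX.
    - exact: measurable_funTS.
    have ae : \forall x \ae (@lebesgue_rV R d), forall T : Th,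
        ~ (hull (val T) x /\ psi x <> restriction psi (val T) x).
      apply: filter_forall => T; have [_] := hr _ (valP T).
      by apply: negligibleS => x /= /contrapT.
    apply: filterS ae => x H /cover[T TTh Tx].
    have := H [` TTh]%fset => /= /not_andP[//|/contrapT ->].
    rewrite /g (bigD1 [` TTh]%fset) //= indicE mem_set // mule1.
    apply: (@le_trans _ _ (M T)%:E); first by rewrite lee_fin hM.
    by rewrite leeDl //; apply: sume_ge0 => i _; exact: gT0.
  apply: (@le_trans _ _ (\int[@lebesgue_rV R d]_x g x)%E).
    exact: ge0_subset_integral.
  rewrite ge0_integral_sum // -sumEFin.
  rewrite (big_seq_fsetE _ Th predT (fun T => (M T * lebvol T)%:E)) /=.
  apply: lee_sum => T _; rewrite ge0_integralZl //.
  - rewrite integral_indic //; last exact: (mI T).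
    by rewrite setIT EFinM -lebvolE //; exact: hTh _ (valP T).
  - by apply/measurable_EFinP; apply: measurable_indic; exact: (mI T).
  - by rewrite lee_fin M0 ?(valP T).
have I0 : (0 <= \int[@lebesgue_rV R d]_(x in Omega) (psi x ^+ 2)%:E)%E.
  by apply: integral_ge0 => x _; rewrite lee_fin sqr_ge0.
rewrite /L2norm /rint sqr_sqrtr ?fine_ge0 //.
by rewrite -lee_fin fineK // ge0_fin_numE // (le_lt_trans I) // ltry.
Qed.

Lemma restrictionP Omega Th psi T : P1dc Omega Th psi -> T \in Th ->
  is_restriction psi T (restriction psi T).
Proof. by move=> [_ H] /H; exact: xgetPex. Qed.

End element_integrals.

(** * Faces of a conformal mesh *)

Section conformity.
Context {R : realType} {k : nat}.
Local Notation d := k.+2.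
Local Notation pt := ('rV[R]_d).
Implicit Types (T F : vset R d) (a p q x y v : pt).

Lemma open_line (U : set pt) x v : open U -> U x ->
  exists2 s : R, 0 < s < 1 & U (x + s *: v).
Proof.
move=> oU Ux.
have Uc : (x + s *: v) @[s --> (0 : R)] --> x.
  rewrite -[X in _ --> X]addr0 -[X in _ --> _ + X](scale0r v).
  by apply: cvgD; [exact: cvg_cst|exact: scalel_continuous].
have /nbhs_ballP[e /= e0 He] : \forall s \near (0 : R), U (x + s *: v).
  by apply: Uc; exact: open_nbhs_nbhs.
exists (Num.min e 1 / 2).
  by rewrite divr_gt0 ?lt_min ?e0 //= ltr_pdivrMr // mul1r gt_min ltr1n orbT.
apply: He; rewrite /ball /= sub0r normrN ger0_norm ?divr_ge0 ?le_min ?(ltW e0) ?ler01 //.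
by rewrite ltr_pdivrMr // gt_min ltr_pMr // ltr1n.
Qed.

Lemma face_opposite T F : d_simplex T -> (F `<=` T)%fset -> #|` F| = d ->
  exists2 p, p \in T & F = (T `\ p)%fset.
Proof.
move=> hT FT Fd; have : #|` (T `\` F)%fset| = 1%N.
  by rewrite cardfsD (fsetIidPr FT) hT.1 Fd subSnn.
move=> /eqP /cardfs1P[p pE].
have pT : p \in (T `\` F)%fset by rewrite pE inE.
move: pT; rewrite inE => /andP[pF pT]; exists p => //.
apply/fsetP => r; rewrite !inE; have := pE => /fsetP /(_ r); rewrite !inE.
have [->|rp] := eqVneq r p; first by rewrite (negbTE pF).
have [rF|rF] /= := boolP (r \in F); first by rewrite (fsubsetP FT).
by move=> ->.
Qed.

Variables (Omega : set pt) (Th : mesh R d).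
Hypothesis Oo : open Omega.
Hypothesis hTh : conformal_mesh Omega Th.

Let hS T : T \in Th -> d_simplex T.
Proof. by case: hTh => H _ _; exact: H. Qed.

(* Otherwise the points near the barycenter of the common face on the segment to
   [p2] lie in both elements but not on the face. *)
Lemma bary_across_lt0 T1 T2 p1 p2 : T1 \in Th -> T2 \in Th -> T1 != T2 ->
  p1 \in T1 -> p2 \in T2 -> (T1 `\ p1 = T2 `\ p2)%fset -> bary T1 p2 p1 < 0.
Proof.
move=> T1h T2h T12 p1T p2T FE; have [hT1 hT2] := (hS T1h, hS T2h).
have [_ _ hI] := hTh.
rewrite ltNge; apply/negP => b0.
pose F := (T1 `\ p1)%fset; pose b := barycenter F.
have F0 : (0 < #|` F|)%N by rewrite face_card.
have FT1 : (F `<=` T1)%fset by exact: fsubD1set.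
have FT2 : (F `<=` T2)%fset by rewrite /F FE; exact: fsubD1set.
have p12 : p1 != p2.
  by apply: contraNneq T12 => p12; rewrite -(fsetD1K p1T) FE p12 fsetD1K.
have TI : (T1 `&` T2 = F)%fset.
  apply/fsetP => r; have := FE => /fsetP /(_ r); rewrite !inE.
  have [->|rp1] /= := eqVneq r p1; last by have [->|rp2] /= := eqVneq r p2 => [->|->]; rewrite ?andbb // => ->.
  by rewrite (negbTE p12) /= => <-; rewrite andbF.
pose M := \sum_(r <- T1) `|bary T1 p2 r|.
have M0 : 0 <= M by apply: sumr_ge0.
(* This [t] gives [(1 - t) / d = t * M], so that the weight [(1 - t) / d] of each face vertex
   outweighs the possibly negative [t * bary T1 p2 r]. *)
pose t := (1 + d%:R * M)^-1.
have D0 : 0 < 1 + d%:R * M by rewrite ltr_pwDl // mulr_ge0.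
have t0 : 0 < t by rewrite invr_gt0.
pose x := b + t *: (p2 - b).
have x1 r : r \in T1 -> bary T1 x r = (1 - t) * bary T1 b r + t * bary T1 p2 r.
  by move=> rT; rewrite baryD // dotvZr bary_grad_diff //; ring.
have x2 r : r \in T2 -> bary T2 x r = (1 - t) * bary T2 b r + t * bary T2 p2 r.
  by move=> rT; rewrite baryD // dotvZr bary_grad_diff //; ring.
have t1 : 1 - t = t * (d%:R * M).
  by rewrite /t -[X in X - _](mulVf (lt0r_neq0 D0)); ring.
have x1T : hull T1 x.
  apply/hullP => // r rT; rewrite x1 //.
  rewrite (bary_barycenter hT1) //; have [rF|rF] := boolP (r \in F); last first.
    have -> : r = p1 by move: rF; rewrite !inE rT andbT negbK => /eqP.
    by rewrite mulr0 add0r mulr_ge0 // ltW.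
  rewrite t1 face_card // -mulrA -mulrDr mulr_ge0 ?(ltW t0) // mulrAC mulfV ?pnatr_eq0 // mul1r.
  have : `|bary T1 p2 r| <= M.
    by rewrite /M (big_fsetD1 r) //= lerDl sumr_ge0.
  by rewrite ler_norml => /andP[+ _]; rewrite lerNl -subr_ge0 opprK addrC.
have x2T : hull T2 x.
  apply/hullP => // r rT; rewrite x2 // (bary_barycenter hT2) // (bary_vertex hT2) //.
  rewrite addr_ge0 ?mulr_ge0 ?ler0n ?(ltW t0) //; last by case: ifP.
  by rewrite t1 mulr_ge0 ?(ltW t0) // mulr_ge0.
have : hull (T1 `&` T2)%fset x by rewrite -hI.
rewrite TI /F FE => /(in_faceP hT2 p2T)[_].
rewrite x2 // (bary_barycenter hT2) // /F FE !inE eqxx /= mulr0 add0r.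
by rewrite (bary_vertex hT2) // eqxx mulr1 => /eqP; rewrite gt_eqF.
Qed.

(** The three opposite vertices would lie pairwise on different sides of one plane: [bary T1 p3 p1]
    would be negative and also a product of two negative numbers. *)
Lemma face_elts_le2 T1 T2 T3 F : T1 \in Th -> T2 \in Th -> T3 \in Th ->
  (F `<=` T1)%fset -> (F `<=` T2)%fset -> (F `<=` T3)%fset -> #|` F| = d ->
  T1 != T2 -> T1 != T3 -> T2 != T3 -> False.
Proof.
move=> T1h T2h T3h F1 F2 F3 Fd T12 T13 T23.
have [p1 p1T E1] := face_opposite (hS T1h) F1 Fd; have [p2 p2T E2] := face_opposite (hS T2h) F2 Fd.
have [p3 p3T E3] := face_opposite (hS T3h) F3 Fd.
have b12 : bary T1 p2 p1 < 0 by apply: (@bary_across_lt0 T1 T2) => //; rewrite -E1.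
have b13 : bary T1 p3 p1 < 0 by apply: (@bary_across_lt0 T1 T3) => //; rewrite -E1.
have b23 : bary T2 p3 p2 < 0 by apply: (@bary_across_lt0 T2 T3) => //; rewrite -E2.
move: b13; rewrite (bary_adjacent _ (hS T1h) (hS T2h) p1T p2T); last by rewrite -E1.
by rewrite ltNge mulr_le0 // ltW.
Qed.

(* If a point of the face were in [Omega], moving it towards the barycenter of the
   face and then out of [T] would lead into another element having the face. *)
Lemma single_elt_boundary T P : T \in Th -> P \in T ->
  (forall T', T' \in Th -> (T `\ P `<=` T')%fset -> T' = T) ->
  on_boundary Omega (T `\ P)%fset.
Proof.
move=> Tth PT uniqT; have hT := hS Tth; have [_ hcov hI] := hTh.
set F := (T `\ P)%fset in uniqT *.
have F0 : (0 < #|` F|)%N by rewrite face_card.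
have FT : (F `<=` T)%fset by exact: fsubD1set.
move=> x Fx; have [Tx xP] := (in_faceP hT PT x).1 Fx.
split; first by rewrite hcov; exists T.
move=> Ox; pose b := barycenter F.
have [s /andP[s0 s1] Ox'] := open_line (b - x) Oo Ox.
set x' := x + _ in Ox'.
have bx' r : r \in T -> bary T x' r = (1 - s) * bary T x r + s * bary T b r.
  by move=> rT; rewrite baryD // dotvZr bary_grad_diff //; ring.
have x'P : bary T x' P = 0.
  by rewrite bx' // xP (bary_barycenter hT) // !inE eqxx /= !mulr0 addr0.
have x'F r : r \in F -> 0 < bary T x' r.
  move=> rF; have rT := fsubsetP FT _ rF.
  rewrite bx' // ltr_wpDl // ?mulr_ge0 ?subr_ge0 ?(ltW s1) //.
    exact: ((hullP hT _).1 Tx).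
  by rewrite (bary_barycenter hT) // rF mulr_gt0 // invr_gt0 ltr0n.
have Tx' : hull T x'.
  apply/hullP => // r rT; have [->|rP] := eqVneq r P; first by rewrite x'P.
  by apply: ltW; apply: x'F; rewrite !inE rP.
(* Since [x'] has positive coordinates at all vertices of the face, conformity forces an element
   containing it to have all of them as vertices. *)
have nT' T' : T' \in Th -> T' != T -> ~ hull T' x'.
  move=> T'h T'T T'x; move/eqP: T'T; apply; apply: uniqT => //.
  apply/fsubsetP => r rF; apply: contraTT isT => rT'.
  have : hull (T `&` T')%fset x' by rewrite -hI.
  rewrite (face_hullP hT) ?fsubsetIl // => -[_ /(_ r (fsubsetP FT _ rF))].
  by rewrite inE (negbTE rT') andbF => /(_ isT) b0; have := x'F _ rF; rewrite b0 ltxx.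
pose C := \bigcup_(T' in [set T' | T' \in (Th `\ T)%fset]) hull T'.
have Cc : closed C.
  apply: closed_bigcup; first exact: finite_fset.
  by move=> T'; rewrite /= !inE => /andP[_ /hS]; exact: closed_hull.
have oU : open (Omega `&` ~` C) by apply: openI => //; exact: closed_openC.
have Ux' : (Omega `&` ~` C) x'.
  by split=> // -[T']; rewrite /= !inE => /andP[T'T T'h]; exact: nT'.
(* A step across the face stays in [Omega] and off the other elements, while the coordinate at [P]
   becomes [- t]. *)
have [t /andP[t0 _] [Oy nCy]] := open_line (x' - P) oU Ux'.
set y := x' + _ in Oy nCy.
have : closure Omega y by exact: subset_closure.
rewrite hcov => -[T' T'h T'y]; have [T'T|T'T] := eqVneq T' T; last first.
  by apply: nCy; exists T' => //=; rewrite !inE T'T.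
have := (hullP hT y).1; rewrite -{1}T'T => /(_ T'y P PT).
rewrite baryD // dotvZr bary_grad_diff // x'P (bary_vertex hT) // eqxx.
by rewrite sub0r add0r mulrN mulr1 oppr_ge0 leNgt t0.
Qed.

End conformity.

(** * Semi-regular simplices *)

Section semi_regular_gradients.
Context {R : realType} {k : nat}.
Local Notation d := k.+2.
Local Notation pt := ('rV[R]_d).
Implicit Types (T F : vset R d) (a p q x y v : pt) (w : pt -> R).

Lemma volumeE : exists2 c : R, 0 < c & forall T, d_simplex T -> volume T = c * lebvol T.
Proof.
have [c c0 H] := hausdorff_lebesgue (R := R) k.+1.
by exists c => // T hT; rewrite /volume H ?lebvolE //; exact: measurable_hull.
Qed.

Lemma prod_lengths_le T hs (gamma0 : R) : d_simplex T ->
  H_ T hs / diam (hull T) <= gamma0 -> \prod_(h <- hs) h <= gamma0 * volume T.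
Proof.
move=> hT; have [c c0 /(_ T hT) vE] := volumeE.
have v0 : 0 < volume T by rewrite vE mulr_gt0 // lebvol_gt0.
have D0 : diam (hull T) != 0.
  have [p [q [pT qT pq]]] : exists p q, [/\ p \in T, q \in T & p != q].
    have [T0|[p pT]] := fset_0Vmem T; first by have := hT.1; rewrite T0 cardfs0.
    have [T0|[q]] := fset_0Vmem (T `\ p)%fset.
      by have := hT.1; rewrite (cardfsD1 p) pT T0 cardfs0.
    by rewrite !inE => /andP[qp qT]; exists p, q; rewrite eq_sym.
  rewrite gt_eqF //; apply: lt_le_trans (dist_gt0 pq) _.
  by apply: dist_le_diam => //; exact: hull_vertex.
by rewrite /H_ mulfK // ler_pdivrMr.
Qed.

(** The labellings in [lengths] do not state that their points are distinct; the cardinality of the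
    simplex forces it. *)
Lemma fset_perm (T : vset R d) (s : seq pt) : d_simplex T -> T =i s -> (size s <= d.+1)%N ->
  uniq s /\ perm_eq T s.
Proof.
move=> hT Ts sd; have us : uniq s.
  by apply: (@leq_size_uniq _ T); [exact: fset_uniq|move=> x; rewrite Ts|rewrite hT.1].
by split=> //; apply: uniq_perm => //; exact: fset_uniq.
Qed.

Lemma prod_fsetD2 (T : vset R d) (s : seq pt) p a (f : pt -> R) : perm_eq T s ->
  \prod_(q <- (T `\ p `\ a)%fset) f q =
  \prod_(q <- [seq q <- s | (q != a) && (q != p)]) f q.
Proof.
move=> Ts; apply: perm_big; apply: uniq_perm.
- exact: fset_uniq.
- by rewrite filter_uniq // -(perm_uniq Ts) fset_uniq.
- by move=> x; rewrite mem_filter -(perm_mem Ts) !inE andbA.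
Qed.

Lemma sum_bary_gradj T j : d_simplex T -> \sum_(p <- T) (bary_grad T p 0 j : R) = 0.
Proof.
move=> hT; rewrite -[RHS](sum_bary_grad hT (delta_mx 0 j)).
by apply: eq_bigr => p _; rewrite dotv_delta.
Qed.

(** Hadamard's bound involves the product [l] of the edges at [a] other than the one to [p]. A
    length [h] that completes it to a product bounded by the volume makes the gradient at most a
    constant over [h]. *)
Lemma bary_grad_le_length T s p a j (h K l : R) : d_simplex T -> perm_eq T s ->
  a \in T -> p \in T -> p != a ->
  l = (\prod_(q <- [seq q <- s | (q != a) && (q != p)]) dist q a) ->
  0 <= h -> l * h <= K * lebvol T ->
  `|bary_grad T p 0 j| * h <= 2 ^+ d * K.
Proof.
move=> hT Ts aT pT pa -> h0 lK; rewrite -(ler_pM2r (lebvol_gt0 hT)).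
have := bary_grad_le j hT aT pT pa; rewrite (prod_fsetD2 _ _ _ Ts).
move=> /(ler_wpM2r h0); rewrite mulrAC => /le_trans; apply.
have : (0 : R) <= 2 ^+ d by exact: exprn_ge0.
by move: (2 ^+ d) => N N0; rewrite -!mulrA ler_wpM2l.
Qed.

End semi_regular_gradients.

(** [h1] and [h2] are the edges at [p1]. The gradients sum to zero, so the interpolant is
    differenced along these two edges, and semi-regularity bounds each coefficient by a constant
    over the length of its own edge. *)
Lemma semi_regular_grad2 {R : realType} (gamma0 : R) : 0 < gamma0 ->
  exists2 K : R, 0 < K & forall (T : vset R 2) hs, d_simplex T -> lengths T hs ->
    H_ T hs / diam (hull T) <= gamma0 ->
    forall (w : 'rV[R]_2 -> R) (L : R) j, 0 <= L ->
    (forall x y, x \in T -> y \in T -> `|w x - w y| <= L * dist x y) ->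
    `|\sum_(p <- T) w p * (bary_grad T p 0 j : R)| <= K * L.
Proof.
move=> g0; have [cv cv0 vE] := @volumeE R 0.
exists (2 * (2 ^+ 2 * (gamma0 * cv))) => [|T hs hT]; first by rewrite !mulr_gt0.
move=> [h1 [h2 [-> [p1 [p2 [p3 [TE _ h1E h2E _]]]]]]] /(prod_lengths_le hT).
rewrite vE // mulrA; set K := gamma0 * cv.
rewrite !big_cons big_nil mulr1 => hK w L j L0 wL.
have [] := @fset_perm R 0 T [:: p1; p2; p3] hT.
- by move=> x; rewrite TE !inE orbA.
- by [].
rewrite /= !inE !negb_or andbT => /andP[/andP[n12 n13] n23] Ts.
have [p1T p2T p3T] : [/\ p1 \in T, p2 \in T & p3 \in T].
  by rewrite TE !inE !eqxx !orbT.
pose c p : R := bary_grad T p 0 j.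
have c0 : c p1 = - c p2 - c p3.
  have := sum_bary_gradj j hT; rewrite (perm_big _ Ts) /= !big_cons big_nil addr0 -!/(c _).
  by move: (c p1) (c p2) (c p3) => s t u; lra.
have c2 : `|c p2| * h1 <= 2 ^+ 2 * K.
  apply: (@bary_grad_le_length R 0 T _ _ p1 _ _ _ h2 hT Ts) => //; rewrite 1?eq_sym //.
  - by rewrite /= !eqxx (eq_sym p2) n12 (eq_sym p3) n13 (eq_sym p3) n23 big_seq1 h2E dist_sym.
  - by rewrite h1E dist_ge0.
  - by rewrite mulrC.
have c3 : `|c p3| * h2 <= 2 ^+ 2 * K.
  apply: (@bary_grad_le_length R 0 T _ _ p1 _ _ _ h1 hT Ts) => //; rewrite 1?eq_sym //.
  - by rewrite /= !eqxx (eq_sym p2) n12 n23 andbF big_seq1 h1E dist_sym.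
  - by rewrite h2E dist_ge0.
rewrite (perm_big _ Ts) /= !big_cons big_nil addr0 -!/(c _) c0.
rewrite (_ : _ + _ = c p2 * (w p2 - w p1) + c p3 * (w p3 - w p1)); last by ring.
apply: le_trans (ler_normD _ _) _; rewrite !normrM.
have b2 : `|c p2| * `|w p2 - w p1| <= 2 ^+ 2 * K * L.
  apply: (@le_trans _ _ (`|c p2| * h1 * L)); last exact: ler_wpM2r.
  by rewrite -mulrA ler_wpM2l // h1E dist_sym mulrC wL.
have b3 : `|c p3| * `|w p3 - w p1| <= 2 ^+ 2 * K * L.
  apply: (@le_trans _ _ (`|c p3| * h2 * L)); last exact: ler_wpM2r.
  by rewrite -mulrA ler_wpM2l // h2E dist_sym mulrC wL.
by rewrite [2 * _ * L]mulrAC -mulrA mulr2n mulrDl mul1r [L * _]mulrC lerD.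
Qed.

(** In the first type all three lengths start at [p1], as in the plane. In the second they form the
    path [p3], [p2], [p1], [p4], and the values are differenced along it, with coefficients [c p3],
    [c p2 + c p3] and [c p4]. *)
Lemma semi_regular_grad3 {R : realType} (gamma0 : R) : 0 < gamma0 ->
  exists2 K : R, 0 < K & forall (T : vset R 3) hs, d_simplex T -> lengths T hs ->
    H_ T hs / diam (hull T) <= gamma0 ->
    forall (w : 'rV[R]_3 -> R) (L : R) j, 0 <= L ->
    (forall x y, x \in T -> y \in T -> `|w x - w y| <= L * dist x y) ->
    `|\sum_(p <- T) w p * (bary_grad T p 0 j : R)| <= K * L.
Proof.
move=> g0; have [cv cv0 vE] := @volumeE R 1.
pose M := 2 ^+ 3 * (gamma0 * cv).
have M0 : 0 < M by rewrite !mulr_gt0 // exprn_gt0.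
(* Dictated by the second type, which costs [3 * (1 + 2 * M)] along the edge from [p1] to [p2] and
   [M] along each of the other two. *)
exists (3 * (1 + 3 * M)) => [|T hs hT].
  by rewrite mulr_gt0 // addr_gt0 // mulr_gt0.
move=> [h1 [h2 [h3 [-> [p1 [p2 [p3 [p4 [a [TE aE _ _ [h1E h2E h3E]]]]]]]]]]].
move=> /(prod_lengths_le hT).
rewrite vE // mulrA !big_cons big_nil mulr1 => hK w L j L0 wL.
have [] := @fset_perm R 1 T [:: p1; p2; p3; p4] hT.
- by move=> x; rewrite TE !inE !orbA.
- by [].
rewrite /= !inE !negb_or andbT -!andbA => /and5P[n12 n13 n14 n23 /andP[n24 n34]] Ts.
have n21 : p2 != p1 by rewrite eq_sym.
have n31 : p3 != p1 by rewrite eq_sym.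
have n41 : p4 != p1 by rewrite eq_sym.
have n32 : p3 != p2 by rewrite eq_sym.
have n42 : p4 != p2 by rewrite eq_sym.
have n43 : p4 != p3 by rewrite eq_sym.
have [p1T p2T p3T p4T] : [/\ p1 \in T, p2 \in T, p3 \in T & p4 \in T].
  by rewrite TE !inE !eqxx !orbT.
pose c p : R := bary_grad T p 0 j.
have c1E : c p1 = - c p2 - c p3 - c p4.
  have := sum_bary_gradj j hT; rewrite (perm_big _ Ts) /= !big_cons big_nil addr0 -!/(c _).
  by move: (c p1) (c p2) (c p3) (c p4) => s t u v; lra.
rewrite (perm_big _ Ts) /= !big_cons big_nil addr0 -!/(c _).
have edge (t h : R) x y : x \in T -> y \in T -> h = dist x y -> `|t| * h <= M ->
    `|t * (w x - w y)| <= M * L.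
  move=> xT yT -> tM; rewrite normrM.
  apply: (@le_trans _ _ (`|t| * dist x y * L)); last by apply: ler_wpM2r.
  by rewrite -mulrA ler_wpM2l // mulrC wL.
have len p q (l h : R) : p \in T -> q \in T -> p != q -> 0 <= h -> l * h = h1 * (h2 * h3) ->
    l = (\prod_(r <- [seq r <- [:: p1; p2; p3; p4] | (r != q) && (r != p)]) dist r q) ->
    `|c p| * h <= M.
  move=> pT qT pq h0 lh lE; apply: (@bary_grad_le_length R 1 T _ p q j h _ l hT Ts) => //.
  by rewrite lh.
have h10 : 0 <= h1 by rewrite h1E dist_ge0.
have h20 : 0 <= h2 by rewrite h2E dist_ge0.
have h30 : 0 <= h3 by rewrite h3E dist_ge0.
have ML0 : 0 <= M * L by rewrite mulr_ge0 // ltW.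
case: aE => -[aE _]; rewrite aE in h2E.
  have c2 : `|c p2| * h1 <= M.
    apply: (len p2 p1 (h2 * h3)) => //; first by ring.
    rewrite /= eqxx n21 n31 n41 eqxx n32 n42 /= !big_cons big_nil mulr1.
    by rewrite h2E h3E (dist_sym p3) (dist_sym p4).
  have c3 : `|c p3| * h2 <= M.
    apply: (len p3 p1 (h1 * h3)) => //; first by ring.
    rewrite /= eqxx n21 n31 n41 eqxx n23 n43 /= !big_cons big_nil mulr1.
    by rewrite h1E h3E (dist_sym p2) (dist_sym p4).
  have c4 : `|c p4| * h3 <= M.
    apply: (len p4 p1 (h1 * h2)) => //; first by ring.
    rewrite /= eqxx n21 n31 n41 eqxx n24 n34 /= !big_cons big_nil mulr1.
    by rewrite h1E h2E (dist_sym p2) (dist_sym p3).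
  rewrite (_ : w p1 * _ + _ = c p2 * (w p2 - w p1) + c p3 * (w p3 - w p1) + c p4 * (w p4 - w p1)).
    have := edge _ _ p2 p1 p2T p1T (etrans h1E (dist_sym _ _)) c2.
    have := edge _ _ p3 p1 p3T p1T (etrans h2E (dist_sym _ _)) c3.
    have := edge _ _ p4 p1 p4T p1T (etrans h3E (dist_sym _ _)) c4.
    move: (c p2 * _) (c p3 * _) (c p4 * _) => x y z; rewrite !ler_norml; move: ML0.
    have -> : 3 * (1 + 3 * M) * L = 3 * L + 9 * (M * L) by ring.
    by move: (M * L) => m; move: L0; lra.
  by rewrite c1E; ring.
(* The base vertex is chosen so that its remaining edges are admissible lengths: [p1] offers [h1]
   and [h3], while [p2], used for [c4], offers [h1] and [h2]. *)
have c3 : `|c p3| * h2 <= M.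
  apply: (len p3 p1 (h1 * h3)) => //; first by ring.
  rewrite /= eqxx n21 n31 n41 eqxx n23 n43 /= !big_cons big_nil mulr1.
  by rewrite h1E h3E (dist_sym p2) (dist_sym p4).
have c4 : `|c p4| * h3 <= M.
  apply: (len p4 p2 (h1 * h2)) => //; first by ring.
  rewrite /= eqxx n12 n32 n42 n14 eqxx n34 /= !big_cons big_nil mulr1.
  by rewrite h1E h2E (dist_sym p3).
(* This coefficient is not a single barycentric gradient, so Hadamard's bound does not reach it.
   Interpolating the coordinate functions does: their derivatives are 0 or 1 and the other two terms
   are at most [M] each; the factor 3 sums over coordinates. *)
have c23 : `|c p2 + c p3| * h1 <= 3 * (1 + 2 * M).
  have h1s : h1 <= \sum_i `|p2 0 i - p1 0 i| by rewrite h1E dist_sym dist_le_sum.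
  apply: (le_trans (ler_wpM2l _ h1s)) => //; rewrite mulr_sumr.
  apply: (@le_trans _ _ (\sum_(i < 3) (1 + 2 * M))); last first.
    by rewrite !big_ord_recr big_ord0 /=; move: (M) => m; lra.
  apply: ler_sum => i _; rewrite -normrM.
  have : (delta_mx 0 j : 'rV[R]_3) 0 i =
      (c p2 + c p3) * (p2 0 i - p1 0 i) + c p3 * (p3 0 i - p2 0 i) + c p4 * (p4 0 i - p1 0 i).
    rewrite -[in LHS](sum_bary_grad_vertex hT (delta_mx 0 j)) (perm_big _ Ts) /=.
    rewrite !big_cons big_nil addr0 !dotv_delta -!/(c _) c1E !mxE; ring.
  have d1 : `|(delta_mx 0 j : 'rV[R]_3) 0 i| <= 1.
    by rewrite mxE eqxx /=; case: (i == j); rewrite ?normr1 ?normr0.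
  have e3 : `|c p3 * (p3 0 i - p2 0 i)| <= M.
    rewrite normrM; apply: le_trans c3; rewrite ler_wpM2l // h2E dist_sym.
    exact: le_coord_dist.
  have e4 : `|c p4 * (p4 0 i - p1 0 i)| <= M.
    rewrite normrM; apply: le_trans c4; rewrite ler_wpM2l // h3E dist_sym.
    exact: le_coord_dist.
  move: d1 e3 e4; move: ((delta_mx 0 j : 'rV[R]_3) 0 i) => e.
  move: (_ * (p2 0 i - _)) (c p3 * _) (c p4 * _) => x y z.
  by rewrite !ler_norml; lra.
have e2 : `|(c p2 + c p3) * (w p2 - w p1)| <= 3 * (1 + 2 * M) * L.
  rewrite normrM; apply: le_trans (ler_wpM2r L0 c23).
  by rewrite -mulrA ler_wpM2l // h1E dist_sym mulrC wL.
rewrite (_ : w p1 * _ + _ = (c p2 + c p3) * (w p2 - w p1) + c p3 * (w p3 - w p2) + c p4 * (w p4 - w p1)).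
  have := edge _ _ p3 p2 p3T p2T (etrans h2E (dist_sym _ _)) c3.
  have := edge _ _ p4 p1 p4T p1T (etrans h3E (dist_sym _ _)) c4.
  move: e2 ML0 L0; move: (_ * (w p2 - _)) (c p3 * _) (c p4 * _) => x y z; rewrite !ler_norml.
  have -> : 3 * (1 + 3 * M) * L = 3 * L + 9 * (M * L) by ring.
  have -> : 3 * (1 + 2 * M) * L = 3 * L + 6 * (M * L) by ring.
  by move: (M * L) => m; lra.
by rewrite c1E; ring.
Qed.

(** Writing the difference of squares as [2 * u * J - J ^+ 2] keeps only the value [u] on the
    element of volume [m]. The cross term is split with weight [e * m], and [m <= c * F] brings the
    quadratic term to the weight [F ^+ 2 / m] that the penalty supplies. *)
Lemma sqr_diff_young {R : realFieldType} (e D F m c u v nu : R) :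
  0 < e -> 0 < m -> 0 <= F -> 0 <= D -> `|nu| <= D * F -> m <= c * F ->
  nu * (u ^+ 2 - v ^+ 2) <=
    e * (m * u ^+ 2) + (D ^+ 2 / e + D * c) * (F ^+ 2 / m * (u - v) ^+ 2).
Proof.
move=> e0 m0 F0 D0 nuD mF; set J := u - v.
have -> : u ^+ 2 - v ^+ 2 = 2 * u * J - J ^+ 2 by rewrite /J; ring.
have JJ : 0 <= J ^+ 2 by exact: sqr_ge0.
have step1 : nu * (2 * u * J - J ^+ 2) <= D * F * (2 * (`|u| * `|J|) + J ^+ 2).
  apply: le_trans (ler_norm _) _; rewrite normrM; apply: ler_pM => //.
  apply: le_trans (ler_normB _ _) _.
  by rewrite (ger0_norm JJ) !normrM normr_nat -mulrA.
apply: le_trans step1 _.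
have cross : D * F * (2 * (`|u| * `|J|)) <=
    e * (m * u ^+ 2) + D ^+ 2 / e * (F ^+ 2 / m * J ^+ 2).
  have em0 : 0 < e * m by rewrite mulr_gt0.
  rewrite -subr_ge0.
  have -> : e * (m * u ^+ 2) + D ^+ 2 / e * (F ^+ 2 / m * J ^+ 2) - D * F * (2 * (`|u| * `|J|))
      = (e * m * `|u| - D * F * `|J|) ^+ 2 / (e * m).
    rewrite -[u ^+ 2]real_normK ?num_real // -[J ^+ 2]real_normK ?num_real //.
    by field; rewrite !gt_eqF.
  by rewrite divr_ge0 ?sqr_ge0 // ltW.
have sq : D * F * J ^+ 2 <= D * c * (F ^+ 2 / m * J ^+ 2).
  have FF : F <= c * (F ^+ 2 / m).
    by rewrite mulrA ler_pdivlMr // expr2 mulrA [leLHS]mulrC ler_wpM2r.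
  have -> : D * c * (F ^+ 2 / m * J ^+ 2) = D * (c * (F ^+ 2 / m)) * J ^+ 2 by ring.
  by apply: ler_wpM2r => //; exact: ler_wpM2l.
by rewrite [leLHS]mulrDr [(D ^+ 2 / e + _) * _]mulrDl addrA lerD.
Qed.

(** * The quadrature identity on an element *)

Section element_identity.
Context {R : realType} {k : nat}.
Local Notation d := k.+2.
Local Notation pt := ('rV[R]_d).
Implicit Types (T F : vset R d) (a p q x y v : pt) (w : pt -> R).

Lemma barycenter_face T P : d_simplex T -> P \in T ->
  barycenter (T `\ P)%fset = barycenter T - d%:R^-1 *: (P - barycenter T).
Proof.
move=> hT PT; rewrite /barycenter face_card // hT.1 (big_fsetD1 P PT) /=.
move: (\sum_(i <- _) i) => s; apply/rowP => j; rewrite !mxE.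
move: (s 0 j) (P 0 j) => x y; rewrite -[k.+3%:R]natr1.
have n0 : d%:R != 0 :> R by rewrite pnatr_eq0.
have n1 : d%:R + 1 != 0 :> R by rewrite natr1 pnatr_eq0.
by move: d%:R n0 n1 => n n0 n1; field; rewrite n0 n1.
Qed.

Lemma barycenter_hull T : d_simplex T -> hull T (barycenter T).
Proof.
move=> hT; apply/hullP => // p pT.
rewrite (bary_barycenter hT) ?fsubset_refl ?hT.1 // pT.
by rewrite invr_ge0 ler0n.
Qed.

Lemma barycenter_face_hull T P : d_simplex T -> P \in T -> hull T (barycenter (T `\ P)%fset).
Proof.
move=> hT PT; apply/hullP => // p pT.
rewrite (bary_barycenter hT) ?fsubD1set ?face_card //.
by case: ifP => // _; rewrite invr_ge0 ler0n.
Qed.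

(** [K] is applied only to products of the deviations [z] of [f] and [xi] of the first coordinate
    from their barycenter values. As the diameter is at most 1, these products have Lipschitz
    constants of order [na] or [na ^+ 2], so every error is either quadratic in the gradient or
    linear in it with a factor [f b]. *)
Lemma element_estimate T (B K : R) f a c : d_simplex T -> diam (hull T) <= 1 ->
  0 <= B -> (forall x, hull T x -> `|x 0 0| <= B) -> 0 <= K ->
  (forall w (L : R), 0 <= L -> (forall x y, x \in T -> y \in T -> `|w x - w y| <= L * dist x y) ->
    `|\sum_(p <- T) w p * (bary_grad T p 0 0 : R)| <= K * L) ->
  (forall x, f x = dotv a x + c) ->
  3 / 4 * f (barycenter T) ^+ 2 <=
    \sum_(P <- T) (- d%:R * bary_grad T P 0 0 * barycenter (T `\ P)%fset 0 0 *
                    f (barycenter (T `\ P)%fset) ^+ 2)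
    + ((2 * B + 4 * K) ^+ 2 + 2 * B * K + 3 * K) * dotv a a.
Proof.
move=> hT T1 B0 TB K0 TK fE; set b := barycenter T.
have Tb : hull T b by exact: barycenter_hull.
pose z p := f p - f b; pose xi p : R := p 0 0 - b 0 0.
pose na := Num.sqrt (dotv a a).
have na0 : 0 <= na by exact: sqrtr_ge0.
have naE : dotv a a = na ^+ 2 by rewrite sqr_sqrtr // dotv_ge0.
pose g p : R := bary_grad T p 0 0.
pose S w := \sum_(p <- T) w p * g p.
have zd x y : `|f x - f y| <= na * dist x y.
  have -> : f x - f y = dotv a (x - y) by rewrite !fE dotvBr; ring.
  exact: norm_dotv.
have xd x y : `|x 0 0 - y 0 0| <= dist x y by exact: le_coord_dist.
have pb p : p \in T -> dist p b <= 1.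
  by move=> pT; apply: le_trans T1; apply: dist_le_diam => //; exact: hull_vertex.
have z1 p : p \in T -> `|z p| <= na.
  by move=> pT; apply: le_trans (zd _ _) _; rewrite -[leRHS]mulr1 ler_wpM2l // pb.
have x1 p : p \in T -> `|xi p| <= 1 by move=> pT; apply: le_trans (xd _ _) (pb _ pT).
have zz x y : z x - z y = f x - f y by rewrite /z; ring.
have xx x y : xi x - xi y = x 0 0 - y 0 0 by rewrite /xi; ring.
have lipM (u v : pt -> R) (Lu Lv Mu Mv : R) : 0 <= Lu -> 0 <= Lv ->
    (forall x y, x \in T -> y \in T -> `|u x - u y| <= Lu * dist x y) ->
    (forall x y, x \in T -> y \in T -> `|v x - v y| <= Lv * dist x y) ->
    (forall x, x \in T -> `|u x| <= Mu) -> (forall x, x \in T -> `|v x| <= Mv) ->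
    forall x y, x \in T -> y \in T ->
      `|u x * v x - u y * v y| <= (Mv * Lu + Mu * Lv) * dist x y.
  move=> Lu0 Lv0 Hu Hv Bu Bv x y xT yT.
  have -> : u x * v x - u y * v y = v x * (u x - u y) + u y * (v x - v y) by ring.
  apply: le_trans (ler_normD _ _) _; rewrite !normrM mulrDl -!mulrA.
  by apply: lerD; apply: ler_pM => //; [exact: Bv|exact: Hu|exact: Bu|exact: Hv].
have Lz x y : x \in T -> y \in T -> `|z x - z y| <= na * dist x y by rewrite zz.
have Lx x y : x \in T -> y \in T -> `|xi x - xi y| <= 1 * dist x y by rewrite xx mul1r.
have Lzz := lipM z z na na na na na0 na0 Lz Lz z1 z1.
have Mzz p : p \in T -> `|z p * z p| <= na * na.
  by move=> pT; rewrite normrM ler_pM // z1.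
have Lxz := lipM xi z 1 na 1 na ler01 na0 Lx Lz x1 z1.
have L1 : 0 <= na * na + na * na by rewrite addr_ge0 // mulr_ge0.
have Lxzz := lipM xi (fun p => z p * z p) 1 _ 1 _ ler01 L1 Lx Lzz x1 Mzz.
have S1 := TK _ _ L1 Lzz.
have S2 := TK _ _ _ Lxz; have {}S2 := S2 ltac:(by rewrite addr_ge0 ?mulr_ge0).
have S3 := TK _ _ _ Lxzz; have {}S3 := S3 ltac:(by rewrite addr_ge0 ?mulr_ge0).
have g0 : S (fun=> 1) = 0.
  by rewrite /S -[RHS](sum_bary_gradj 0 hT); apply: eq_bigr => p _; rewrite mul1r.
have gv v : \sum_(p <- T) dotv v p * g p = v 0 0.
  rewrite -dotv_delta -[in RHS](sum_bary_grad_vertex hT (delta_mx 0 0)) dotv_sumr.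
  by apply: eq_bigr => p _; rewrite dotvZr dotv_delta mulrC.
have gz : S z = a 0 0.
  have -> : S z = \sum_(p <- T) dotv a p * g p - (f b - c) * S (fun=> 1).
    by rewrite /S mulr_sumr -sumrB; apply: eq_bigr => p _; rewrite /z !fE; ring.
  by rewrite g0 gv mulr0 subr0.
have gx : S xi = 1.
  have -> : S xi = \sum_(p <- T) dotv (delta_mx 0 0) p * g p - b 0 0 * S (fun=> 1).
    rewrite /S mulr_sumr -sumrB; apply: eq_bigr => p _.
    by rewrite dotvC dotv_delta /xi; ring.
  by rewrite g0 gv mulr0 subr0 mxE.
have fbP P : P \in T -> f (barycenter (T `\ P)%fset) = f b - d%:R^-1 * z P.
  move=> PT; rewrite barycenter_face // /z !fE -/b !(dotvBr, dotvZr); ring.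
have xbP P : P \in T -> barycenter (T `\ P)%fset 0 0 = b 0 0 - d%:R^-1 * xi P.
  by move=> PT; rewrite barycenter_face // /xi !mxE.
pose i : R := d%:R^-1.
have i0 : 0 < i by rewrite invr_gt0 ltr0n.
have i1 : i <= 1 by rewrite invf_le1 ?ltr0n // ler1n.
(* Exact expansion: deviations at a face barycenter are [- i] times those at the opposite vertex,
   and [S] kills constants, sends [xi] to 1 and [z] to [a 0 0]. The main term is
   [f b ^+ 2 * S xi]. *)
have -> : \sum_(P <- T) (- d%:R * bary_grad T P 0 0 * barycenter (T `\ P)%fset 0 0 *
      f (barycenter (T `\ P)%fset) ^+ 2) =
    f b ^+ 2 + 2 * f b * b 0 0 * a 0 0 - i * b 0 0 * S (fun p => z p * z p)
    - 2 * i * f b * S (fun p => xi p * z p) + i ^+ 2 * S (fun p => xi p * (z p * z p)).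
  rewrite /S; transitivity (- d%:R * (b 0 0 * f b ^+ 2) * S (fun=> 1)
      + f b ^+ 2 * S xi + 2 * f b * b 0 0 * S z - i * b 0 0 * S (fun p => z p * z p)
      - 2 * i * f b * S (fun p => xi p * z p) + i ^+ 2 * S (fun p => xi p * (z p * z p))).
    rewrite /S !mulr_sumr -!sumrN -!big_split /= big_seq [RHS]big_seq.
    apply: eq_bigr => p pT; rewrite fbP // xbP // -/i -/(g p).
    have n0 : d%:R != 0 :> R by rewrite pnatr_eq0.
    rewrite /i; move: d%:R n0 (b 0 0) (f b) (z p) (xi p) (g p) => n n0 s t u v w.
    by field.
  by rewrite g0 gx gz mulr0 add0r mulr1.
have a0 : `|a 0 0| <= na.
  by have := norm_dotv a (delta_mx 0 0); rewrite !dotv_delta mxE !eqxx sqrtr1 mulr1.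
have b0 := TB _ Tb.
rewrite naE; move: S1 S2 S3; rewrite -!/(S _).
have -> : na * na * 1 + 1 * (na * na + na * na) = 3 * na ^+ 2 by ring.
have -> : na * na + na * na = 2 * na ^+ 2 by ring.
have -> : na * 1 + 1 * na = 2 * na by ring.
move: (S _) (S _) (S _) (f b) (b 0 0) (a 0 0) a0 b0 => s3 s2 s1 t u v a0 b0 S1 S2 S3.
have e1 : `|2 * t * u * v| <= `|t| * (2 * B * na).
  have -> : 2 * t * u * v = t * (2 * (u * v)) by ring.
  by rewrite !normrM normr_nat ler_wpM2l // -mulrA ler_wpM2l // ler_pM.
have e2 : `|i * u * s1| <= 2 * B * K * na ^+ 2.
  rewrite !normrM (ger0_norm (ltW i0)).
  apply: (@le_trans _ _ (1 * B * (K * (2 * na ^+ 2)))); last by rewrite le_eqVlt; apply/orP; left; apply/eqP; ring.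
  by rewrite ler_pM ?mulr_ge0 ?ler_pM ?(ltW i0).
have e3 : `|2 * i * t * s2| <= `|t| * (4 * K * na).
  rewrite !normrM normr_nat (ger0_norm (ltW i0)).
  apply: (@le_trans _ _ (2 * 1 * `|t| * (K * (2 * na)))); last by rewrite le_eqVlt; apply/orP; left; apply/eqP; ring.
  by rewrite ler_pM ?mulr_ge0 ?(ltW i0) // ler_wpM2r // ler_wpM2l.
have e4 : `|i ^+ 2 * s3| <= 3 * K * na ^+ 2.
  rewrite normrM normrX (ger0_norm (ltW i0)).
  apply: (@le_trans _ _ (1 * (K * (3 * na ^+ 2)))); last by rewrite le_eqVlt; apply/orP; left; apply/eqP; ring.
  by rewrite ler_pM ?exprn_ge0 ?exprn_ile1 ?(ltW i0).
(* Young's inequality spends a quarter of [f b ^+ 2], which leaves the 3/4 of the statement. *)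
have e5 : `|t| * (2 * B * na) + `|t| * (4 * K * na) <=
    1 / 4 * t ^+ 2 + (2 * B + 4 * K) ^+ 2 * na ^+ 2.
  rewrite -[t ^+ 2]real_normK ?num_real // -subr_ge0.
  have E : 1 / 4 * `|t| ^+ 2 + (2 * B + 4 * K) ^+ 2 * na ^+ 2 -
      (`|t| * (2 * B * na) + `|t| * (4 * K * na)) =
    (`|t| / 2 - (2 * B + 4 * K) * na) ^+ 2 by field.
  by rewrite E sqr_ge0.
move: e1 e2 e3 e4 e5; rewrite !ler_norml.
move: (2 * t * u * v) (i * u * s1) (2 * i * t * s2) (i ^+ 2 * s3) => r1 r2 r3 r4.
move: (`|t| * (2 * B * na)) (`|t| * (4 * K * na)) ((2 * B + 4 * K) ^+ 2) => y1 y2 y3.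
move: (t ^+ 2) (na ^+ 2) => t2 n2; rewrite !mulrDl.
move: (y3 * n2) (2 * B * K * n2) (3 * K * n2) => w1 w2 w3.
lra.
Qed.

End element_identity.

(** * Faces and the elements containing them *)

Section mesh_faces.
Context {R : realType} {k : nat}.
Local Notation d := k.+2.
Local Notation pt := ('rV[R]_d).
Implicit Types (T F : vset R d) (a p q x y v : pt) (Th : mesh R d).

Lemma facesP Th F : reflect (exists2 T, T \in Th & (F `<=` T)%fset /\ #|` F| = d)
  (F \in faces Th).
Proof.
apply: (iffP (bigfcupP _ _ _ _)) => [[T]|[T Th_T [FT Fd]]].
  by rewrite andbT => TTh; rewrite !inE fpowersetE => /andP[FT /eqP Fd]; exists T.
by exists T; rewrite ?Th_T // !inE fpowersetE FT Fd eqxx.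
Qed.

(** Vertices and faces of a simplex correspond by opposition, so each face is counted once for every
    element containing it. *)
Lemma sum_faces Th (psi : vset R d -> vset R d -> R) :
  (forall T, T \in Th -> d_simplex T) ->
  \sum_(T <- Th) \sum_(P <- T) psi T (T `\ P)%fset =
  \sum_(F <- faces Th) \sum_(T <- elts Th F) psi T F.
Proof.
move=> hTh.
transitivity (\sum_(T <- Th) \sum_(F <- faces Th | (F `<=` T)%fset) psi T F).
  rewrite big_seq [RHS]big_seq; apply: eq_bigr => T Th_T; have hT := hTh _ Th_T.
  rewrite -[RHS]big_filter -(big_map (fun P => T `\ P)%fset predT (psi T)); apply: perm_big.
  apply: uniq_perm.
  - rewrite map_inj_in_uniq ?fset_uniq // => P Q PT QT /fsetP /(_ P).
    by rewrite !inE eqxx /= PT andbT => /esym /negbFE /eqP.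
  - by rewrite filter_uniq // fset_uniq.
  move=> F; rewrite mem_filter; apply/mapP/andP => [[P PT ->]|[FT /facesP[_ _ [_ Fd]]]].
    rewrite fsubD1set; split=> //; apply/facesP; exists T => //.
    by rewrite fsubD1set face_card.
  exact: face_opposite.
under [RHS]eq_bigr do rewrite big_filter.
by rewrite (exchange_big_dep predT).
Qed.

Variables (Omega : set pt) (Th : mesh R d).
Hypothesis Oo : open Omega.
Hypothesis hTh : conformal_mesh Omega Th.

Lemma elts_uniq F : uniq (elts Th F).
Proof. by rewrite filter_uniq // fset_uniq. Qed.

Lemma mem_elts F T : (T \in elts Th F) = (F `<=` T)%fset && (T \in Th).
Proof. exact: mem_filter. Qed.

(** The two sides of a plane leave room for at most two elements, and a face of a single element
    lies on the boundary. The cases are not claimed to exclude membership in both sets of faces. *)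
Lemma elts_cases F : F \in faces Th ->
  (exists T P, [/\ elts Th F = [:: T], T \in Th, P \in T, F = (T `\ P)%fset &
     F \in boundary_faces Omega Th]) \/
  (exists T1 T2 P1 P2, [/\ elts Th F = [:: T1; T2], F \in interior_faces Th,
     T1 \in Th /\ T2 \in Th, T1 != T2 & [/\ P1 \in T1, P2 \in T2,
     F = (T1 `\ P1)%fset & F = (T2 `\ P2)%fset]]).
Proof.
move=> FTh; have /facesP[T Th_T [FT Fd]] := FTh.
have hS T' : T' \in Th -> d_simplex T' by case: hTh => H _ _; exact: H.
have memP T' : T' \in elts Th F -> [/\ T' \in Th, (F `<=` T')%fset &
    exists2 p, p \in T' & F = (T' `\ p)%fset].
  by rewrite mem_elts => /andP[FT' T'h]; split=> //; apply: face_opposite => //; exact: hS.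
have := elts_uniq F; have : T \in elts Th F by rewrite mem_elts FT.
have eltsI T' : T' \in Th -> (F `<=` T')%fset -> T' \in elts Th F by rewrite mem_elts => -> ->.
case E : (elts Th F) eltsI memP => [//|T1 [|T2 [|T3 s]]] eltsI memP _ U.
- left; have [T1h FT1 [P PT1 FE]] := memP T1 (mem_head _ _).
  exists T1, P; split=> //; rewrite !inE FTh /=; apply/asboolP; rewrite FE.
  apply: (single_elt_boundary Oo hTh) => // T' T'h; rewrite -FE => /(eltsI _ T'h).
  by rewrite inE => /eqP.
- right; have [T1h _ [P1 PT1 FE1]] := memP T1 (mem_head _ _).
  have [T2h _ [P2 PT2 FE2]] : [/\ T2 \in Th, (F `<=` T2)%fset &
      exists2 p, p \in T2 & F = (T2 `\ p)%fset] by apply: memP; rewrite !inE eqxx orbT.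
  exists T1, T2, P1, P2; split=> //; first by rewrite !inE FTh E.
  by move: U; rewrite /= !inE => /andP[].
- have [T1h F1 _] := memP T1 (mem_head _ _).
  have [T2h F2 _] : [/\ T2 \in Th, (F `<=` T2)%fset &
      exists2 p, p \in T2 & F = (T2 `\ p)%fset] by apply: memP; rewrite !inE eqxx orbT.
  have [T3h F3 _] : [/\ T3 \in Th, (F `<=` T3)%fset &
      exists2 p, p \in T3 & F = (T3 `\ p)%fset] by apply: memP; rewrite !inE eqxx !orbT.
  exfalso; move: U => /= /and4P[]; rewrite !inE !negb_or => /and3P[n12 n13 _] /andP[n23 _] _ _.
  exact: (face_elts_le2 hTh T1h T2h T3h F1 F2 F3 Fd n12 n13 n23).
Qed.

End mesh_faces.

(** * Summation over the mesh *)

Section face_estimates_real.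
Context {R : realType} {k : nat}.
Local Notation d := k.+2.
Local Notation pt := ('rV[R]_d).
Implicit Types (T F : vset R d) (a p q x y v : pt).

Lemma hausdorff_face_area T P : d_simplex T -> P \in T ->
  hausdorff k.+1 (hull (T `\ P)%fset) = (face_area (T `\ P)%fset)%:E.
Proof.
by move=> hT PT; have [p0 p0F] := face_nonempty hT PT; exact: hausdorff_faceE p0F.
Qed.

Lemma grad_le_face_area : exists2 c : R, 0 < c & forall T P j, d_simplex T -> P \in T ->
  `|bary_grad T P 0 j| * lebvol T <= c * face_area (T `\ P)%fset.
Proof.
have [c c0 H] := @bary_grad_le_face R k; exists c => // T P j hT PT.
by have := H _ _ j hT PT; rewrite hausdorff_face_area.
Qed.

(** The bound 1 on the diameter stands in for the edge length in [lebvol_le_face]. *)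
Lemma lebvol_le_face_area : exists2 c : R, 0 < c & forall T P, d_simplex T -> P \in T ->
  diam (hull T) <= 1 -> lebvol T <= c * face_area (T `\ P)%fset.
Proof.
have [c c0 H] := @lebvol_le_face R k; exists c => // T P hT PT T1.
have [q qF] := face_nonempty hT PT.
have qT := mem_faceW qF; have Pq : P != q by move: qF; rewrite !inE eq_sym => /andP[].
have := H _ _ _ hT PT qT Pq; rewrite hausdorff_face_area // lee_fin => /le_trans; apply.
have A0 := ltW (face_area_gt0 hT PT).
rewrite ler_wpM2r // -[leRHS]mulr1 ler_wpM2l ?(ltW c0) //; apply: le_trans T1.
by apply: dist_le_diam => //; exact: hull_vertex.
Qed.

(* For [F] opposite to [p] the sum has the single term [p]; up to the factor
   [- d] this is the first component of the area-weighted outward normal. *)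
Definition flux T F : R := lebvol T * \sum_(p <- (T `\` F)%fset) (bary_grad T p 0 0 : R).

Lemma fluxE T P : P \in T -> flux T (T `\ P)%fset = lebvol T * bary_grad T P 0 0.
Proof.
move=> PT; rewrite /flux (_ : (T `\` (T `\ P))%fset = [fset P]%fset) ?big_seq_fset1 //.
by apply/fsetP => r; rewrite !inE; have [->|] := eqVneq r P; rewrite //= andNb.
Qed.

Lemma ell_lebvol : exists2 c : R, 0 < c & forall T F, d_simplex T ->
  ell T F = c * lebvol T / face_area F.
Proof.
have [c c0 H] := @volumeE R k; exists (d`!%:R * c); first by rewrite mulr_gt0 // ltr0n fact_gt0.
by move=> T F hT; rewrite /ell H // [_%:R * (c * _)]mulrA.
Qed.

Lemma flux_le_face_area : exists2 c : R, 0 < c & forall T P (B : R), d_simplex T -> P \in T ->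
  0 <= B -> (forall x, hull T x -> `|x 0 0| <= B) ->
  `|- d%:R * flux T (T `\ P)%fset * barycenter (T `\ P)%fset 0 0| <=
    c * B * face_area (T `\ P)%fset.
Proof.
have [c c0 H] := grad_le_face_area; exists (d%:R * c) => [|T P B hT PT B0 TB].
  by rewrite mulr_gt0 // ltr0n.
rewrite fluxE // !normrM normrN normr_nat (ger0_norm (ltW (lebvol_gt0 hT))).
have b1 := TB _ (barycenter_face_hull hT PT); have b2 := H _ _ 0 hT PT.
apply: (@le_trans _ _ (d%:R * (c * face_area (T `\ P)%fset) * B)).
  by rewrite ler_pM ?mulr_ge0 ?(ltW (lebvol_gt0 hT)) // ler_wpM2l // mulrC.
by move: (d%:R) (face_area _) => n F; rewrite le_eqVlt; apply/orP; left; apply/eqP; ring.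
Qed.

Lemma kappa_int_ge (l1 l2 L : R) : 0 < l1 -> 0 < l2 -> l1 <= L -> l2 <= L ->
  (4 * L)^-1 <= (Num.sqrt l1 + Num.sqrt l2) ^- 2.
Proof.
move=> l10 l20 l1L l2L.
have s1 : 0 < Num.sqrt l1 by rewrite sqrtr_gt0.
have s2 : 0 < Num.sqrt l2 by rewrite sqrtr_gt0.
have L0 : 0 < L by exact: lt_le_trans l1L.
rewrite lef_pV2 ?posrE ?exprn_gt0 ?addr_gt0 ?mulr_gt0 //.
apply: (@le_trans _ _ ((2 * Num.sqrt L) ^+ 2)); last by rewrite exprMn sqr_sqrtr ?(ltW L0) //; lra.
rewrite ler_pXn2r ?nnegrE ?addr_ge0 ?mulr_ge0 ?sqrtr_ge0 //.
by rewrite (_ : 2 * _ = Num.sqrt L + Num.sqrt L) ?lerD ?ler_wsqrtr //; ring.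
Qed.

End face_estimates_real.

(** * Face terms bounded by the penalty *)

Section jump_estimates.
Context {R : realType} {k : nat}.
Local Notation d := k.+2.
Local Notation pt := ('rV[R]_d).
Implicit Types (T F : vset R d) (P : pt).
Variables (Omega : set pt) (Th : mesh R d) (f : vset R d -> pt -> R) (D c2 Cl e : R).
Hypothesis hTh : conformal_mesh Omega Th.
Hypothesis diam1 : forall T, T \in Th -> diam (hull T) <= 1.
Hypothesis affine : forall T, T \in Th -> exists a c, forall x, f T x = dotv a x + c.
Hypotheses (D0 : 0 <= D) (c20 : 0 < c2) (Cl0 : 0 < Cl) (e0 : 0 < e).
Hypothesis flux_le : forall T P, T \in Th -> P \in T ->
  `|- d%:R * flux T (T `\ P)%fset * barycenter (T `\ P)%fset 0 0| <= D * face_area (T `\ P)%fset.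
Hypothesis Hc2 : forall T P, d_simplex T -> P \in T ->
  diam (hull T) <= 1 -> lebvol T <= c2 * face_area (T `\ P)%fset.
Hypothesis ellE : forall T F, d_simplex T -> ell T F = Cl * lebvol T / face_area F.

Let hS T : T \in Th -> d_simplex T. Proof. by case: hTh => H _ _; exact: H. Qed.

Let psi T F : R := - d%:R * flux T F * barycenter F 0 0 * f T (barycenter F) ^+ 2.
Let n_int F := kappa_int Th F * face_norm F (face_proj F (jump_int Th f F)) ^+ 2.
Let n_bd F := kappa_bd Th F * face_norm F (face_proj F (jump_bd Th f F)) ^+ 2.

(** The whole trace is the jump here. The flux is of the order of the area, which [Hc2] bounds by
    [c2] times the squared area over the volume, that is, by the penalty weight times the area up to
    constants. *)
Lemma boundary_face_estimate T P : elts Th (T `\ P)%fset = [:: T] -> T \in Th -> P \in T ->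
  psi T (T `\ P)%fset <= D * c2 * Cl * n_bd (T `\ P)%fset.
Proof.
move=> E Th_T PT; have hT := hS Th_T; have [a [c fE]] := affine Th_T.
rewrite /n_bd /kappa_bd /jump_bd /elt1 E /= (face_norm_proj hT PT fE) ellE //.
have A0 := face_area_gt0 hT PT; have m0 := lebvol_gt0 hT.
have mA := Hc2 hT PT (diam1 Th_T); have fl := flux_le Th_T PT.
rewrite /psi; move: (f T _ ^+ 2) (sqr_ge0 (f T (barycenter (T `\ P)%fset))) fl A0 mA.
move: (_ * flux _ _ * _) (face_area _) (lebvol T) m0 => nu F m m0 s s0 fl A0 mA.
have -> : D * c2 * Cl * ((Cl * m / F)^-1 * (s * F)) = D * (c2 * F / m * F) * s.
  by field; rewrite !gt_eqF.
apply: ler_wpM2r => //; apply: le_trans (ler_norm _) _; apply: le_trans fl _.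
by rewrite ler_wpM2l // ler_peMl ?(ltW A0) // ler_pdivlMr // mul1r.
Qed.

(** The fluxes of the two elements are opposite, which leaves one flux times a difference of
    squares. *)
Lemma interior_face_estimate T1 T2 P1 P2 F : elts Th F = [:: T1; T2] ->
  T1 \in Th -> T2 \in Th -> T1 != T2 -> P1 \in T1 -> P2 \in T2 ->
  F = (T1 `\ P1)%fset -> F = (T2 `\ P2)%fset ->
  psi T1 F + psi T2 F <=
    e * (lebvol T1 * f T1 (barycenter F) ^+ 2 + lebvol T2 * f T2 (barycenter F) ^+ 2)
    + (D ^+ 2 / e + D * c2) * (4 * Cl) * n_int F.
Proof.
move=> E T1h T2h T12 P1T P2T F1 F2; have [h1 h2] := (hS T1h, hS T2h).
have [a1 [b1 f1E]] := affine T1h; have [a2 [b2 f2E]] := affine T2h.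
have g12 : lebvol T1 * bary_grad T1 P1 0 0 = - (lebvol T2 * bary_grad T2 P2 0 0).
  have FE := etrans (esym F1) F2.
  have := lebvol_grad_opposite h1 h2 P1T P2T FE (bary_across_lt0 hTh T1h T2h T12 P1T P2T FE).
  by move=> /rowP /(_ 0); rewrite [LHS]mxE [RHS]mxE [X in _ = - X]mxE.
have opp : flux T2 F = - flux T1 F.
  rewrite [in LHS]F2 F1 (fluxE P1T) (fluxE P2T).
  exact: (etrans (esym (opprK _)) (congr1 -%R (esym g12))).
have A0 : 0 < face_area F by rewrite F1 face_area_gt0.
have [m10 m20] := (lebvol_gt0 h1, lebvol_gt0 h2).
have mA1 : lebvol T1 <= c2 * face_area F by rewrite {1}F1; exact: Hc2 (diam1 T1h).
have mA2 : lebvol T2 <= c2 * face_area F by rewrite {1}F2; exact: Hc2 (diam1 T2h).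
have fl : `|- d%:R * flux T1 F * barycenter F 0 0| <= D * face_area F.
  by rewrite F1; exact: flux_le.
have fl' : `|- d%:R * flux T2 F * barycenter F 0 0| <= D * face_area F.
  by rewrite F2; exact: flux_le.
pose J := f T1 (barycenter F) - f T2 (barycenter F).
have JE : face_norm F (face_proj F (jump_int Th f F)) ^+ 2 = J ^+ 2 * face_area F.
  have -> : jump_int Th f F = fun x => f T1 x - f T2 x by rewrite /jump_int /elt1 /elt2 E.
  rewrite F1 (@face_norm_proj _ _ _ _ h1 P1T _ (a1 - a2) (b1 - b2)); first by rewrite -F1.
  by move=> x; rewrite f1E f2E [dotv (_ - _) _]dotvC dotvBr !(dotvC x); ring.
(* [kappa_int] is governed by the larger of the two [ell], so [m] has to dominate both volumes; this
   is why the value retained in Young's inequality must be that of the larger element. *)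
have kap m : lebvol T1 <= m -> lebvol T2 <= m ->
    face_area F ^+ 2 / m * J ^+ 2 <= 4 * Cl * n_int F.
  move=> l1 l2; have m0 : 0 < m := lt_le_trans m10 l1.
  have kle : (4 * (Cl * m / face_area F))^-1 <= kappa_int Th F.
    rewrite /kappa_int /elt1 /elt2 E /= !ellE //.
    have V0 : 0 <= (face_area F)^-1 by rewrite invr_ge0 ltW.
    apply: kappa_int_ge.
    - exact: divr_gt0 (mulr_gt0 Cl0 m10) A0.
    - exact: divr_gt0 (mulr_gt0 Cl0 m20) A0.
    - exact: ler_wpM2r V0 _ _ (ler_wpM2l (ltW Cl0) l1).
    - exact: ler_wpM2r V0 _ _ (ler_wpM2l (ltW Cl0) l2).
  rewrite /n_int JE.
  have -> : face_area F ^+ 2 / m * J ^+ 2 =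
      4 * Cl * ((4 * (Cl * m / face_area F))^-1 * (J ^+ 2 * face_area F)).
    by field; rewrite !gt_eqF.
  have C4 : 0 <= 4 * Cl by rewrite mulr_ge0 // ltW.
  have JA : 0 <= J ^+ 2 * face_area F by rewrite mulr_ge0 ?sqr_ge0 // ltW.
  exact: ler_wpM2l (ler_wpM2r JA kle).
have C0 : 0 <= D ^+ 2 / e + D * c2.
  by rewrite addr_ge0 ?divr_ge0 ?mulr_ge0 ?exprn_ge0 ?(ltW e0) ?(ltW c20).
have := fl; have := fl'; rewrite /psi opp.
set nu := - d%:R * flux T1 F * barycenter F 0 0.
have -> : - d%:R * - flux T1 F * barycenter F 0 0 = - nu by rewrite /nu; ring.
move=> nu1 nu2.
have p1 : 0 <= e * (lebvol T1 * f T1 (barycenter F) ^+ 2).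
  exact: (mulr_ge0 (ltW e0) (mulr_ge0 (ltW m10) (sqr_ge0 _))).
have p2 : 0 <= e * (lebvol T2 * f T2 (barycenter F) ^+ 2).
  exact: (mulr_ge0 (ltW e0) (mulr_ge0 (ltW m20) (sqr_ge0 _))).
have [le12|le21] := leP (lebvol T1) (lebvol T2).
  have := sqr_diff_young (f T2 (barycenter F)) (f T1 (barycenter F)) e0 m20 (ltW A0) D0 nu1 mA2.
  move=> young; rewrite [leLHS](_ : _ = - nu * (f T2 (barycenter F) ^+ 2 - f T1 (barycenter F) ^+ 2)).
    2: by ring.
  apply: le_trans young _; have := kap _ le12 (lexx _); rewrite /J -opprB sqrrN.
  move=> /(ler_wpM2l C0) k1; apply: le_trans (lerD (lexx _) k1) _.
  by rewrite -[_ * (4 * Cl) * _]mulrA [e * (_ + _)]mulrDr lerD2r lerDr.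
have := sqr_diff_young (f T1 (barycenter F)) (f T2 (barycenter F)) e0 m10 (ltW A0) D0 nu2 mA1.
move=> young; rewrite [leLHS](_ : _ = nu * (f T1 (barycenter F) ^+ 2 - f T2 (barycenter F) ^+ 2)).
  2: by ring.
apply: le_trans young _; have := kap _ (lexx _) (ltW le21); rewrite /J.
move=> /(ler_wpM2l C0) k1; apply: le_trans (lerD (lexx _) k1) _.
by rewrite -[_ * (4 * Cl) * _]mulrA [e * (_ + _)]mulrDr lerD2r lerDl.
Qed.

End jump_estimates.

Lemma sum_fset_sub (R : nmodType) (I : choiceType) (A B : {fset I}) (g : I -> R) :
  (A `<=` B)%fset -> \sum_(i <- B) (if i \in A then g i else 0) = \sum_(i <- A) g i.
Proof.
move=> AB; rewrite -big_mkcond -big_filter; apply: perm_big; apply: uniq_perm.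
- by rewrite filter_uniq // fset_uniq.
- exact: fset_uniq.
by move=> i; rewrite mem_filter; have [/(fsubsetP AB) ->|] := boolP (i \in A).
Qed.

(** * The inequality for barycenter values *)

Section discrete_poincare.
Context {R : realType} {k : nat}.
Local Notation d := k.+2.
Local Notation pt := ('rV[R]_d).
Implicit Types (T F : vset R d) (P : pt) (Th : mesh R d) (Omega : set pt)
  (f : vset R d -> pt -> R).

Lemma kappa_int_ge0 Th F : 0 <= kappa_int Th F.
Proof. by rewrite invr_ge0 sqr_ge0. Qed.

Lemma kappa_bd_ge0 Th F : 0 <= kappa_bd Th F.
Proof.
rewrite invr_ge0 divr_ge0 //; last by rewrite fine_ge0 // measure_ge0.
by rewrite mulr_ge0 // fine_ge0 // measure_ge0.
Qed.

Definition int_term Th f F : R :=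
  kappa_int Th F * face_norm F (face_proj F (jump_int Th f F)) ^+ 2.
Definition bd_term Th f F : R :=
  kappa_bd Th F * face_norm F (face_proj F (jump_bd Th f F)) ^+ 2.

Lemma int_term_ge0 Th f F : 0 <= int_term Th f F.
Proof. exact: (mulr_ge0 (kappa_int_ge0 _ _) (sqr_ge0 _)). Qed.

Lemma bd_term_ge0 Th f F : 0 <= bd_term Th f F.
Proof. exact: (mulr_ge0 (kappa_bd_ge0 _ _) (sqr_ge0 _)). Qed.

(** Both contributions are added, so that a face of either kind, or of both, is covered; an
    additional one is nonnegative and only helps. *)
Definition face_term Omega Th f F : R :=
  (if F \in interior_faces Th then int_term Th f F else 0) +
  (if F \in boundary_faces Omega Th then bd_term Th f F else 0).

Lemma hstar_sqr Omega Th f : hstar_norm Omega Th f ^+ 2 =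
  \sum_(T <- Th) H1_seminorm T (f T) ^+ 2 + \sum_(F <- faces Th) face_term Omega Th f F.
Proof.
have -> : \sum_(F <- faces Th) face_term Omega Th f F =
    \sum_(F <- interior_faces Th) int_term Th f F +
    \sum_(F <- boundary_faces Omega Th) bd_term Th f F.
  rewrite big_split; congr (_ + _); apply: sum_fset_sub.
  - by apply/fsubsetP => F; rewrite !inE => /andP[].
  - by apply/fsubsetP => F; rewrite !inE => /andP[].
apply: sqr_sqrtr; apply: addr_ge0; first by apply: sumr_ge0 => T _; exact: sqr_ge0.
by apply: addr_ge0; apply: sumr_ge0 => F _; [exact: int_term_ge0|exact: bd_term_ge0].
Qed.

Lemma barycenter_l2_estimate (B K : R) : 0 <= B -> 0 <= K ->
  exists2 C : R, 0 < C & forall Omega Th f, open Omega -> conformal_mesh Omega Th ->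
    (forall T, T \in Th -> diam (hull T) <= 1) ->
    (forall T x, T \in Th -> hull T x -> `|x 0 0| <= B) ->
    (forall T (w : pt -> R) (L : R), T \in Th -> 0 <= L ->
      (forall x y, x \in T -> y \in T -> `|w x - w y| <= L * dist x y) ->
      `|\sum_(p <- T) w p * (bary_grad T p 0 0 : R)| <= K * L) ->
    (forall T, T \in Th -> exists a c, forall x, f T x = dotv a x + c) ->
    \sum_(T <- Th) lebvol T * f T (barycenter T) ^+ 2 <= C * hstar_norm Omega Th f ^+ 2.
Proof.
move=> B0 K0; have [c1 c10 Hc1] := @flux_le_face_area R k.
have [c2 c20 Hc2] := @lebvol_le_face_area R k; have [Cl Cl0 ellE] := @ell_lebvol R k.
(* Each of the [d.+1] faces of an element costs at most twice its barycenter term plus twice its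
   squared seminorm, so this [e] absorbs a quarter of [S] and of [H]. With the 3/4 from the
   elements, half of [S] is left. *)
pose e : R := (8 * d.+1%:R)^-1; pose D := c1 * B.
have e0 : 0 < e by rewrite invr_gt0 mulr_gt0 // ltr0n.
have D0 : 0 <= D by rewrite mulr_ge0 // ltW.
pose CF := (D ^+ 2 / e + D * c2) * (4 * Cl) + D * c2 * Cl.
pose C1 := (2 * B + 4 * K) ^+ 2 + 2 * B * K + 3 * K.
have CI0 : 0 <= (D ^+ 2 / e + D * c2) * (4 * Cl).
  apply: mulr_ge0; last by rewrite mulr_ge0 // ltW.
  by apply: addr_ge0; [rewrite divr_ge0 ?exprn_ge0 // ltW|rewrite mulr_ge0 // ltW].
have CB0 : 0 <= D * c2 * Cl.
  by apply: mulr_ge0 (ltW Cl0); apply: mulr_ge0 (ltW c20).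
have CF0 : 0 <= CF by exact: addr_ge0.
have C10 : 0 <= C1.
  by apply: addr_ge0; [apply: addr_ge0; [exact: sqr_ge0|]|]; rewrite !mulr_ge0.
(* The factors 2 come from dividing by that half; the 1 covers the remaining half of [H] and gives
   positivity. *)
exists (2 * CF + 2 * C1 + 1).
  by rewrite ltr_wpDl // addr_ge0 // mulr_ge0.
move=> Omega Th f Oo hTh diam1 boundX grad affine.
have hS T : T \in Th -> d_simplex T by case: hTh => H _ _; exact: H.
have flux_le T P : T \in Th -> P \in T ->
    `|- d%:R * flux T (T `\ P)%fset * barycenter (T `\ P)%fset 0 0| <= D * face_area (T `\ P)%fset.
  by move=> Th_T PT; apply: Hc1 => // [|x Tx]; [exact: hS|exact: boundX Tx].
pose psi T F : R := - d%:R * flux T F * barycenter F 0 0 * f T (barycenter F) ^+ 2.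
pose mf T F : R := lebvol T * f T (barycenter F) ^+ 2.
pose H := \sum_(T <- Th) H1_seminorm T (f T) ^+ 2.
pose S := \sum_(T <- Th) lebvol T * f T (barycenter T) ^+ 2.
pose N := \sum_(F <- faces Th) face_term Omega Th f F.
have elem T : T \in Th -> 3 / 4 * (lebvol T * f T (barycenter T) ^+ 2) <=
    \sum_(P <- T) psi T (T `\ P)%fset + C1 * H1_seminorm T (f T) ^+ 2.
  move=> Th_T; have hT := hS _ Th_T; have [a [c fE]] := affine _ Th_T.
  have gradT w (L : R) := grad T w L Th_T.
  have := element_estimate hT (diam1 _ Th_T) B0 (boundX _ ^~ Th_T) K0 gradT fE.
  rewrite -/C1 (H1_seminorm_affine hT fE) => /(ler_wpM2l (ltW (lebvol_gt0 hT))).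
  rewrite mulrCA => /le_trans; apply.
  rewrite mulrDr [C1 * (_ * _)]mulrA [X in _ + X <= _]mulrC; apply: lerD => //.
  rewrite mulr_sumr big_seq [leRHS]big_seq; apply: ler_sum => P PT.
  rewrite /psi fluxE // !mulrA.
  rewrite [lebvol T * _]mulrC; exact: lexx.
have faceT T P : T \in Th -> P \in T ->
    mf T (T `\ P)%fset <= 2 * (lebvol T * f T (barycenter T) ^+ 2) + 2 * H1_seminorm T (f T) ^+ 2.
  move=> Th_T PT; have hT := hS _ Th_T; have [a [c fE]] := affine _ Th_T.
  have := @affine_sqr_le _ _ (f T) a c (barycenter (T `\ P)%fset) (barycenter T) 1 fE.
  rewrite (H1_seminorm_affine hT fE) expr1n mul1r => H1.
  have := ler_wpM2l (ltW (lebvol_gt0 hT)) (H1 _); rewrite /mf => /(_ _)/le_trans; apply.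
    apply: le_trans (diam1 _ Th_T); apply: dist_le_diam => //.
      exact: barycenter_face_hull.
    exact: barycenter_hull.
  by rewrite mulrDr ![lebvol T * (2 * _)]mulrCA [lebvol T * dotv _ _]mulrC.
have face F : F \in faces Th -> \sum_(T <- elts Th F) psi T F <=
    e * \sum_(T <- elts Th F) mf T F + CF * face_term Omega Th f F.
  move=> FTh.
  have [[T [P [E Th_T PT FE Fbd]]]|[T1 [T2 [P1 [P2 [E Fint [T1h T2h] T12 [P1T P2T F1 F2]]]]]]] :=
    elts_cases Oo hTh FTh.
    rewrite E !big_seq1.
    have HE : psi T F <= D * c2 * Cl * bd_term Th f F.
      by rewrite FE; apply: (boundary_face_estimate hTh diam1) => //; rewrite -FE.
    apply: le_trans HE _.
    rewrite -[leLHS]add0r; apply: lerD.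
      by apply: mulr_ge0 (ltW e0) _; apply: mulr_ge0 (sqr_ge0 _); exact: ltW (lebvol_gt0 (hS _ Th_T)).
    apply: ler_pM => //; first exact: bd_term_ge0.
      by rewrite /CF lerDr.
    by rewrite /face_term Fbd; case: ifP => _; rewrite ?lerDr ?int_term_ge0 // add0r.
  rewrite E !big_cons !big_nil !addr0.
  have HE : psi T1 F + psi T2 F <= e * (mf T1 F + mf T2 F) +
      (D ^+ 2 / e + D * c2) * (4 * Cl) * int_term Th f F.
    exact: (interior_face_estimate hTh diam1 affine D0 c20 Cl0 e0 flux_le Hc2 ellE E
      T1h T2h T12 P1T P2T F1 F2).
  apply: le_trans HE _; apply: lerD => //; apply: ler_pM => //; first exact: int_term_ge0.
    by rewrite /CF lerDl.
  by rewrite /face_term Fint; case: ifP => _; rewrite ?lerDl ?bd_term_ge0 // addr0.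
have sum1 : 3 / 4 * S <= \sum_(T <- Th) \sum_(P <- T) psi T (T `\ P)%fset + C1 * H.
  rewrite /S /H !mulr_sumr -big_split /= big_seq [leRHS]big_seq.
  by apply: ler_sum => T; exact: elem.
have sum2 : \sum_(T <- Th) \sum_(P <- T) psi T (T `\ P)%fset <=
    e * \sum_(T <- Th) \sum_(P <- T) mf T (T `\ P)%fset + CF * N.
  rewrite !(sum_faces _ hS) /N !mulr_sumr -big_split /= big_seq [leRHS]big_seq.
  by apply: ler_sum => F; exact: face.
have sum3 : e * \sum_(T <- Th) \sum_(P <- T) mf T (T `\ P)%fset <= 1 / 4 * S + 1 / 4 * H.
  rewrite /S /H !mulr_sumr -big_split /= big_seq [leRHS]big_seq.
  apply: ler_sum => T Th_T.
  have -> : 1 / 4 * (lebvol T * f T (barycenter T) ^+ 2) + 1 / 4 * H1_seminorm T (f T) ^+ 2 =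
      e * (d.+1%:R * (2 * (lebvol T * f T (barycenter T) ^+ 2) + 2 * H1_seminorm T (f T) ^+ 2)).
    have n0 : d.+1%:R != 0 :> R by rewrite pnatr_eq0.
    rewrite /e; move: (d.+1%:R) n0 (lebvol T * _) (H1_seminorm _ _ ^+ 2) => n n0 u v.
    by field.
  rewrite ler_pM2l // -(hS _ Th_T).1.
  apply: (@le_trans _ _ (\sum_(P <- T)
    (2 * (lebvol T * f T (barycenter T) ^+ 2) + 2 * H1_seminorm T (f T) ^+ 2))).
    by rewrite big_seq [leRHS]big_seq; apply: ler_sum => P; exact: faceT.
  rewrite big_const_seq count_predT iter_addr_0 [leRHS]mulr_natl; exact: lexx.
rewrite hstar_sqr -/H -/N -/S.
have H0 : 0 <= H by apply: sumr_ge0 => T _; exact: sqr_ge0.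
have N0 : 0 <= N.
  apply: sumr_ge0 => F _; apply: addr_ge0; case: ifP => // _.
    exact: int_term_ge0.
  exact: bd_term_ge0.
have CFH := mulr_ge0 CF0 H0; have C1N := mulr_ge0 C10 N0.
move: sum1 sum2 sum3 H0 N0 CFH C1N.
have -> : (2 * CF + 2 * C1 + 1) * (H + N) =
    2 * (CF * H) + 2 * (CF * N) + 2 * (C1 * H) + 2 * (C1 * N) + H + N by ring.
move: (\sum_(T <- Th) \sum_(P <- T) psi T _) (e * _) (CF * H) (CF * N) (C1 * H) (C1 * N).
by move: S H N => S' H' N' s1 s2 x1 x2 x3 x4; lra.
Qed.

End discrete_poincare.

(** * From barycenter values to the norm on the domain *)

Section poincare.
Context {R : realType} {k : nat}.
Local Notation d := k.+2.
Local Notation pt := ('rV[R]_d).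

Lemma bounded_coord (Omega : set pt) : bounded_set Omega ->
  exists2 B : R, 0 <= B & forall x, closure Omega x -> `|x 0 0| <= B.
Proof.
move=> [M [_ bM]]; pose B := Num.max 0 (M + 1).
have B0 : 0 <= B by rewrite le_max lexx.
exists B => // x clx.
have cl : closed ((fun x : pt => `|x 0 0|) @^-1` [set t | t <= B]).
  apply: closed_comp => [y _|]; last exact: closed_le.
  by apply: continuous_comp; [exact: coord_continuous|exact: norm_continuous].
have sub : Omega `<=` (fun x : pt => `|x 0 0|) @^-1` [set t | t <= B].
  move=> y Oy /=; apply: (@le_trans _ _ (M + 1)); last by rewrite le_max lexx orbT.
  apply: le_trans (bM _ _ y Oy); last by rewrite ltrDl.
  by rewrite [leRHS]/Num.norm /= mx_normrE; apply: (le_bigmax _ (fun ij => `|y ij.1 ij.2|) (0, 0)).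
by move: clx; rewrite closureEbigcap => /(_ _ (conj cl sub)).
Qed.

(** The constant is built from [B], which bounds the first coordinate on the domain, and from [K],
    which comes from [gamma0]; both are fixed before the family of meshes. *)
Lemma poincare_of_gradient_bound (gamma0 : R) (Omega : set pt) :
  bounded_polyhedral_domain Omega ->
  (exists2 K : R, 0 < K & forall (T : vset R d) hs, d_simplex T -> lengths T hs ->
    H_ T hs / diam (hull T) <= gamma0 ->
    forall (w : pt -> R) (L : R) j, 0 <= L ->
    (forall x y, x \in T -> y \in T -> `|w x - w y| <= L * dist x y) ->
    `|\sum_(p <- T) w p * (bary_grad T p 0 j : R)| <= K * L) ->
  exists C : R, 0 < C /\
    forall fam : set (mesh R d),
      (forall Th, fam Th -> conformal_mesh Omega Th) ->
      semi_regular gamma0 fam ->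
      forall Th, fam Th -> mesh_size Th <= 1 ->
      forall psi : pt -> R, P1dc Omega Th psi ->
        L2norm (@lebesgue_rV R d) Omega psi
          <= C * hstar_norm Omega Th (restriction psi).
Proof.
move=> [Oo _ _ bO _] [K K0 HK]; have [B B0 HB] := bounded_coord bO.
have [C C0 HC] := @barycenter_l2_estimate R k B K B0 (ltW K0).
have C20 : 0 < 2 * C + 2 by rewrite ltr_wpDl // mulr_ge0 // ltW.
exists (Num.sqrt (2 * C + 2)); split; first by rewrite sqrtr_gt0.
move=> fam conf reg Th fTh h1 psi hpsi; have hTh := conf _ fTh.
have [hS cov _] := hTh; set f := restriction psi.
have rP T : T \in Th -> is_restriction psi T (f T) by exact: restrictionP hpsi.
have affine T : T \in Th -> exists a c, forall x, f T x = dotv a x + c by move=> /rP[].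
have diam1 T : T \in Th -> diam (hull T) <= 1.
  by move=> Th_T; apply: le_trans h1; exact: (le_bigmax_seq 0 T predT (fun T => diam (hull T))).
have boundX T x : T \in Th -> hull T x -> `|x 0 0| <= B.
  by move=> Th_T Tx; apply: HB; rewrite cov; exists T.
have grad T (w : pt -> R) (L : R) : T \in Th -> 0 <= L ->
    (forall x y, x \in T -> y \in T -> `|w x - w y| <= L * dist x y) ->
    `|\sum_(p <- T) w p * (bary_grad T p 0 0 : R)| <= K * L.
  move=> Th_T; have [hs len le_hs] := reg _ fTh _ Th_T.
  exact: HK T hs (hS T Th_T) len le_hs w L 0.
have := HC Omega Th f Oo hTh diam1 boundX grad affine.
(* On an element of diameter at most 1, the square of an affine function is at most twice its square
   at the barycenter plus twice its squared gradient; dividing the squared seminorm by the volume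
   recovers the latter. *)
pose M T := 2 * f T (barycenter T) ^+ 2 + 2 * (H1_seminorm T (f T) ^+ 2 / lebvol T).
have MT T : T \in Th -> M T * lebvol T =
    2 * (lebvol T * f T (barycenter T) ^+ 2) + 2 * H1_seminorm T (f T) ^+ 2.
  move=> Th_T; have := lt0r_neq0 (lebvol_gt0 (hS _ Th_T)); rewrite /M.
  by move: (lebvol T) (_ ^+ 2) (_ ^+ 2) => m u v m0; field.
have M0 T : T \in Th -> 0 <= M T.
  move=> Th_T; have m0 := lebvol_gt0 (hS _ Th_T); apply: addr_ge0; apply: mulr_ge0 => //.
    exact: sqr_ge0.
  by apply: divr_ge0 (ltW m0); exact: sqr_ge0.
have MP T x : T \in Th -> hull T x -> f T x ^+ 2 <= M T.
  move=> Th_T Tx; have hT := hS _ Th_T; have [a [c fE]] := affine _ Th_T.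
  rewrite /M (H1_seminorm_affine hT fE) mulfK ?gt_eqF ?lebvol_gt0 //.
  have := @affine_sqr_le _ _ (f T) a c x (barycenter T) 1 fE.
  rewrite expr1n mul1r; apply; apply: le_trans (diam1 _ Th_T); apply: dist_le_diam => //.
  exact: barycenter_hull.
have cover : Omega `<=` [set x | exists2 T, T \in Th & hull T x].
  by rewrite -cov; exact: subset_closure.
have := L2norm_le Oo hS cover hpsi.1.1 rP M0 MP.
rewrite big_seq (eq_bigr _ MT) -big_seq big_split /= -!mulr_sumr => L2 bary2.
have N2 : L2norm (@lebesgue_rV R d) Omega psi ^+ 2 <=
    (2 * C + 2) * hstar_norm Omega Th f ^+ 2.
  apply: le_trans L2 _.
  have HH : \sum_(T <- Th) H1_seminorm T (f T) ^+ 2 <= hstar_norm Omega Th f ^+ 2.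
    rewrite hstar_sqr lerDl sumr_ge0 // => F _; apply: addr_ge0; case: ifP => // _.
      exact: int_term_ge0.
    exact: bd_term_ge0.
  move: bary2 HH; move: (_ ^+ 2) (\sum_(_ <- _) _) (\sum_(_ <- _) _) => h s t.
  by rewrite mulrDl; move: C0; nra.
rewrite -(ler_pXn2r (n := 2)) ?nnegrE ?mulr_ge0 ?sqrtr_ge0 //.
by rewrite exprMn (sqr_sqrtr (ltW C20)).
Qed.

End poincare.

Theorem lemma6 (R : realType) (d : nat) (hd : d = 2%N \/ d = 3%N)
    (Omega : set 'rV[R]_d) (hOmega : bounded_polyhedral_domain Omega)
    (hconv : convex_set Omega) (gamma0 : R) (hgamma0 : 0 < gamma0) :
  exists C : R, 0 < C /\
    forall fam : set (mesh R d),
      (forall Th, fam Th -> conformal_mesh Omega Th) ->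
      semi_regular gamma0 fam ->
      forall Th, fam Th -> mesh_size Th <= 1 ->
      forall psi : 'rV[R]_d -> R, P1dc Omega Th psi ->
        L2norm (@lebesgue_rV R d) Omega psi
          <= C * hstar_norm Omega Th (restriction psi).
Proof.
case: hd => E; subst d.
  exact: (poincare_of_gradient_bound hOmega (semi_regular_grad2 hgamma0)).
exact: (poincare_of_gradient_bound hOmega (semi_regular_grad3 hgamma0)).
Qed.
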